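(* Let $1<q<p<\infty$, let $\Omega\subset\subset\mathbb{R}^N$ be open, and let $s\in(0,1)$. Then there is a constant $C=C(\Omega,s,p,q)$ such that $$\|(-\Delta)^{s/2}\varphi\|_{L^q(\mathbb{R}^N)}\ \le\ C\,\|(-\Delta)^{s/2}\varphi\|_{L^p(\mathbb{R}^N)}$$ holds for all $\varphi\in C_c^\infty(\Omega)$.
   Context: $\Omega\subset\subset\mathbb{R}^N$ means that $\overline{\Omega}$ is compact (i.e. $\Omega$ is bounded). The fractional Laplacian $(-\Delta)^{s/2}$ on $\mathbb{R}^N$ is defined for $f\in C_c^\infty(\mathbb{R}^N)$ by $\mathcal{F}((-\Delta)^{s/2}f)(\xi)=c|\xi|^s\mathcal{F}f(\xi)$, with $c>0$ a normalization constant chosen so that for $s=2$ it is $-\Delta$. *)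

(* Defs.v *)
From HB Require Import structures.
From mathcomp Require Import all_boot all_order all_algebra.
From mathcomp Require Import all_classical all_reals all_analysis.
From mathcomp Require Import complex.

Set Implicit Arguments.
Unset Strict Implicit.
Unset Printing Implicit Defensive.

Import Order.TTheory GRing.Theory Num.Theory.
Import numFieldNormedType.Exports.

Local Open Scope classical_set_scope.
Local Open Scope ring_scope.
Local Open Scope complex_scope.

(* The library has the product sigma-algebra on n.-tuple R but no measure on
   it.  Lebesgue measure on R^n is built by induction on n: it is the image of
   the product measure lebesgue_measure \x lambda^n under (x, t) |-> x :: t.
   The recursion carries sigma-finiteness because the product needs it. *)
Section lebesgue_step.
Context (R : realType) (n : nat).
Variable mu :
  {sigma_finite_measure set (n.-tuple (measurableTypeR R)) -> \bar R}.

Definition tuple_cons (z : measurableTypeR R * n.-tuple (measurableTypeR R)) :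
  n.+1.-tuple (measurableTypeR R) := [the n.+1.-tuple _ of z.1 :: z.2].

Lemma measurable_tuple_cons : measurable_fun setT tuple_cons.
Proof. exact: measurable_cons. Qed.

Definition lebesgue_step : set (n.+1.-tuple (measurableTypeR R)) -> \bar R :=
  pushforward (@lebesgue_measure R \x mu)%E tuple_cons.

Let measurable_preimage A : measurable A -> measurable (tuple_cons @^-1` A).
Proof.
by move=> mA; rewrite -[_ @^-1` _]setTI; exact: measurable_tuple_cons.
Qed.

Let step0 : lebesgue_step set0 = 0%E.
Proof. by rewrite /lebesgue_step /pushforward preimage_set0 measure0. Qed.

Let step_ge0 A : (0 <= lebesgue_step A)%E.
Proof. by rewrite /lebesgue_step /pushforward; exact: measure_ge0. Qed.

Let step_sigma_additive : semi_sigma_additive lebesgue_step.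
Proof.
move=> F mF tF mUF; rewrite /lebesgue_step /pushforward preimage_bigcup.
apply: measure_semi_sigma_additive.
- by move=> k; exact: measurable_preimage.
- apply/trivIsetP => /= i j _ _ ij; rewrite -preimage_setI.
  by move/trivIsetP : tF => /(_ _ _ _ _ ij) ->//; rewrite preimage_set0.
- by rewrite -preimage_bigcup; exact: measurable_preimage.
Qed.

HB.instance Definition _ := isMeasure.Build _ _ _ lebesgue_step
  step0 step_ge0 step_sigma_additive.

Let step_sigma_finite : sigma_finite setT lebesgue_step.
Proof.
have /sigma_finiteP[F [FT ndF Foo]] := sigma_finiteT (@lebesgue_measure R).
have /sigma_finiteP[G [GT ndG Goo]] := sigma_finiteT mu.
pose g (t : n.+1.-tuple (measurableTypeR R)) :
  measurableTypeR R * n.-tuple (measurableTypeR R) :=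
  (thead t, [tuple of behead t]).
have mg : measurable_fun setT g.
  apply: measurable_fun_pair; first exact: measurable_tnth.
  exact: measurable_behead.
have cg : cancel tuple_cons g.
  by move=> [x t]; rewrite /g /tuple_cons theadE; congr pair; exact: val_inj.
exists (fun k => g @^-1` (F k `*` G k)).
  rewrite -preimage_bigcup (_ : \bigcup_k _ = setT) ?preimage_setT//.
  apply/seteqP; split=> // -[x y] _.
  have [i _ Fix] : (\bigcup_k F k) x by rewrite -FT.
  have [j _ Gjy] : (\bigcup_k G k) y by rewrite -GT.
  exists (maxn i j) => //; split => /=.
  - by move: x Fix {y Gjy}; exact/subsetPset/ndF/leq_maxl.
  - by move: y Gjy; exact/subsetPset/ndG/leq_maxr.
move=> k; have [mF Fk] := Foo k; have [mG Gk] := Goo k; split.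
  by rewrite -[_ @^-1` _]setTI; apply: mg => //; exact: measurableX.
rewrite /lebesgue_step /pushforward -comp_preimage.
rewrite (_ : g \o tuple_cons = id); last by apply/funext => z; exact: cg.
by rewrite preimage_id product_measure1E// lte_mul_pinfty// ge0_fin_numE.
Qed.

HB.instance Definition _ := Measure_isSigmaFinite.Build _ _ _ lebesgue_step
  step_sigma_finite.

End lebesgue_step.

Fixpoint lebesgue_tuple (R : realType) (n : nat) :
    {sigma_finite_measure set (n.-tuple (measurableTypeR R)) -> \bar R} :=
  match n with
  | 0 => dirac [tuple]
  | m.+1 => lebesgue_step (lebesgue_tuple R m)
  end.

Section euclidean_space.
Variables (R : realType) (N : nat).
Implicit Types (x y xi : 'rV[R]_N) (f : 'rV[R]_N -> R[i]).

(* Row vectors carry the topology and the differential structure, tuples the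
   measurable structure; integrals over R^N are transported along this
   bijection. *)
Definition row_of_tuple (t : N.-tuple (measurableTypeR R)) : 'rV[R]_N :=
  \row_i tnth t i.

Definition dotrv x y : R := \sum_i x 0 i * y 0 i.

(* The norm that 'rV[R]_N carries in the library is the sup norm. *)
Definition euclid_norm x : R := Num.sqrt (dotrv x x).

Definition Cintegral f : R[i] :=
  (\int[lebesgue_tuple R N]_t complex.Re (f (row_of_tuple t))) +i*
  (\int[lebesgue_tuple R N]_t complex.Im (f (row_of_tuple t))).

Definition cis (a : R) : R[i] := cos a +i* sin a.

Definition fourier f xi : R[i] :=
  Cintegral (fun x => f x * cis (- (2 * pi * dotrv x xi))).

Definition inv_fourier f x : R[i] :=
  Cintegral (fun xi => f xi * cis (2 * pi * dotrv x xi)).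

(* With the 2 pi in the phase, the symbol of - Delta is (2 pi |xi|)^2, so the
   normalization constant of (- Delta)^(s/2) is c = (2 pi)^s.  The function
   with Fourier transform c |xi|^s F f(xi) is given by the inversion integral;
   for f smooth with compact support and s > 0, the integrand is continuous
   and integrable. *)
Definition fraclap (s : R) f : 'rV[R]_N -> R[i] :=
  inv_fourier
    (fun xi => ((2 * pi) `^ s * euclid_norm xi `^ s)%:C * fourier f xi).

Definition Lpnorm (p : R) f : \bar R :=
  Lnorm (lebesgue_tuple R N) p%:E
    (fun t => (Normc.normc (f (row_of_tuple t)))%:E).

Fixpoint partials (l : seq 'I_N) (u : 'rV[R]_N -> R^o) : 'rV[R]_N -> R^o :=
  match l with
  | [::] => u
  | i :: l' => partials l' ('D_(delta_mx 0 i) u)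
  end.

Definition smooth (u : 'rV[R]_N -> R^o) : Prop :=
  forall l : seq 'I_N, continuous (partials l u) /\
    forall i x, derivable (partials l u) x (delta_mx 0 i).

Definition Csupport f : set 'rV[R]_N := closure [set x | f x != 0].

Definition Cc_infty (Omega : set 'rV[R]_N) f : Prop :=
  [/\ smooth (fun x => complex.Re (f x)), smooth (fun x => complex.Im (f x)),
      compact (Csupport f) & Csupport f `<=` Omega].

End euclidean_space.

(* Main.v *)
Require Import Defs.
From mathcomp Require Import all_boot all_order all_algebra.
From mathcomp Require Import all_classical all_reals all_analysis.
From mathcomp Require Import measurable_realfun complex ring lra.

(** Write [T = (- Delta) ^ (s / 2)].  Two facts make the inequality true: the
    kernel of [T] is integrable away from the diagonal, and a function with
    support in a fixed bounded set is controlled by its image under [T].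

    Where [|T phi| <= M] the power [|T phi| ^ q] is at most a multiple of
    [|T phi|], elsewhere it is at most a multiple of [|T phi| ^ p]; taking for
    [M] an upper bound of the [L^p] norm, [Lnorm_interpolation] reduces the
    claim to an [L^1] bound by a multiple of [M].  Up to a contribution of
    integral at most [M], [|T phi|] is bounded by [M] ([le_add_powR]), so its
    integral over a box is at most a multiple of [M] and only the integral far
    from the support is at stake.

    Both remaining estimates express [T] through the Gaussian averages
    [heat r u], whose Fourier multipliers are [exp (- pi r ^ 2 |xi| ^ 2)].
    Superposing [u - heat r u] with the weight [r ^ (- s) dr / r] gives a
    multiple of [T u] ([low_representation]).  Far from the support [u] vanishes
    and only displacements of length at least one contribute, so the integral of
    [|T u|] there is at most a multiple of that of [|u|] ([multiplier_far_L1]).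
    Conversely, superposing [heat r (T u)] with the weight [r ^ s dr / r] gives a
    multiple of [u] ([high_representation]).  For large [r] that weight is too
    large, but [u] vanishes at a point translated out of the support, so [u x]
    may be replaced by a difference of two values; the difference of the two
    translated Gaussians gains a factor [1 / r], and [s < 1] makes the
    superposition converge ([tame_le_superpose]).  This bounds the integral of
    [|u|] over the box by a multiple of [M], and [multiplier_L1_le] combines the
    pieces.

    The analysis is done for real functions and cosine transforms; the symbol is
    even, so the real and the imaginary part of [phi] are transformed
    separately ([fraclap_multiplier]).  What is used of a test function is
    collected in [tame]; the decay of its transform comes from difference
    operators with steps of half a wave length ([smooth_ctrans_decay]).  The
    scale is parametrized as [r = exp t], which turns [dr / r] into Lebesgue
    measure and dilations of the frequency into translations. *)

Import Order.TTheory GRing.Theory Num.Theory.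
Import numFieldNormedType.Exports.

Local Open Scope classical_set_scope.
Local Open Scope ring_scope.

Set Implicit Arguments.
Unset Strict Implicit.
Unset Printing Implicit Defensive.

(** * Integration of real-valued functions *)

Section real_integrals.
Context d (T : measurableType d) (R : realType) (mu : {measure set T -> \bar R}).
Implicit Types f g : T -> R.

Lemma dominated_integrable f g : measurable_fun setT f ->
  (forall x, `|f x| <= g x) -> mu.-integrable setT (EFin \o g) ->
  mu.-integrable setT (EFin \o f).
Proof.
move=> mf fg ig; apply: (le_integrable measurableT _ _ ig).
  exact/measurable_EFinP.
move=> x _ /=; rewrite lee_fin (le_trans (fg x))//; exact: ler_norm.
Qed.

Lemma integrable_measurable f :
  mu.-integrable setT (EFin \o f) -> measurable_fun setT f.
Proof. by move/integrableP => [/measurable_EFinP]. Qed.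

Lemma integral_Rintegral f : mu.-integrable setT (EFin \o f) ->
  (\int[mu]_x (f x)%:E)%E = (\int[mu]_x f x)%:E.
Proof. by move=> fi; rewrite /Rintegral fineK//; exact: integrable_fin_num. Qed.

Lemma ge0_integrable f : measurable_fun setT f -> (forall x, 0 <= f x) ->
  (\int[mu]_x (f x)%:E < +oo)%E -> mu.-integrable setT (EFin \o f).
Proof.
move=> mf f0 foo; apply/integrableP; split; first exact/measurable_EFinP.
under eq_integral => x _ do rewrite /= ger0_norm//.
exact: foo.
Qed.

Lemma norm_Rintegral_le f g : measurable_fun setT f ->
  (forall x, `|f x| <= g x) -> mu.-integrable setT (EFin \o g) ->
  `|\int[mu]_x f x| <= \int[mu]_x g x.
Proof.
move=> mf fg ig; have ifi := dominated_integrable mf fg ig.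
apply: (le_trans (le_normr_Rintegral measurableT ifi)).
apply: le_Rintegral => //.
- apply: dominated_integrable ig; first exact: measurableT_comp.
  by move=> x; rewrite normr_id.
Qed.

Lemma abse_Rintegral_le f : measurable_fun setT f ->
  (`|\int[mu]_x f x|%:E <= \int[mu]_x `|f x|%:E)%E.
Proof.
move=> mf; have [oo|noo] := ltP (\int[mu]_x `|f x|%:E)%E +oo%E.
  have ifi : mu.-integrable setT (EFin \o f).
    by apply/integrableP; split => //; exact/measurable_EFinP.
  rewrite integral_Rintegral; last exact: integrable_norm.
  by rewrite lee_fin le_normr_Rintegral.
by rewrite (le_trans _ noo)// leey.
Qed.

Lemma integrableZ c f : mu.-integrable setT (EFin \o f) ->
  mu.-integrable setT (EFin \o (fun x => c * f x)).
Proof. by move=> ifi; exact: (integrableZl measurableT c ifi). Qed.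

Lemma integrable_sub f g : mu.-integrable setT (EFin \o f) ->
  mu.-integrable setT (EFin \o g) ->
  mu.-integrable setT (EFin \o (fun x => f x - g x)).
Proof. by move=> h k; exact: (integrableB measurableT h k). Qed.

Lemma integrable_add f g : mu.-integrable setT (EFin \o f) ->
  mu.-integrable setT (EFin \o g) ->
  mu.-integrable setT (EFin \o (fun x => f x + g x)).
Proof. by move=> h k; exact: (integrableD measurableT h k). Qed.

Lemma ge0_le_integral_EFin f g : measurable_fun setT f ->
  measurable_fun setT g -> (forall x, 0 <= f x) -> (forall x, f x <= g x) ->
  (\int[mu]_x (f x)%:E <= \int[mu]_x (g x)%:E)%E.
Proof.
move=> mf mg f0 fg; apply: ge0_le_integral => //.
- by move=> x _; rewrite lee_fin.
- exact/measurable_EFinP.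
- exact/measurable_EFinP.
- by move=> x _; rewrite lee_fin.
Qed.

Lemma ge0_integralZ c f : measurable_fun setT f -> (forall x, 0 <= f x) ->
  0 <= c -> (\int[mu]_x (c * f x)%:E = c%:E * \int[mu]_x (f x)%:E)%E.
Proof.
move=> mf f0 c0; under eq_integral do rewrite EFinM.
apply: ge0_integralZl_EFin => //; last exact/measurable_EFinP.
by move=> x _; rewrite lee_fin.
Qed.

Lemma ge0_integral_EFinD f g : measurable_fun setT f -> measurable_fun setT g ->
  (forall x, 0 <= f x) -> (forall x, 0 <= g x) ->
  (\int[mu]_x (f x + g x)%:E = \int[mu]_x (f x)%:E + \int[mu]_x (g x)%:E)%E.
Proof.
move=> mf mg f0 g0; under eq_integral do rewrite EFinD.
apply: ge0_integralD => //; try exact/measurable_EFinP.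
  by move=> x _; rewrite lee_fin.
by move=> x _; rewrite lee_fin.
Qed.

Lemma Rintegral_cvg (F : nat -> T -> R) f g :
  (forall k, measurable_fun setT (F k)) -> measurable_fun setT f ->
  (forall x, F k x @[k --> \oo] --> f x) ->
  (forall k x, `|F k x| <= g x) -> mu.-integrable setT (EFin \o g) ->
  \int[mu]_x F k x @[k --> \oo] --> \int[mu]_x f x.
Proof.
move=> mF mf Ff Fg ig.
have cE x : setT x -> (F k x)%:E @[k --> \oo] --> (f x)%:E.
  by move=> _; apply: cvg_EFin; [exact: nearW|exact: Ff].
have [ifi _ cv] := @dominated_convergence _ _ _ mu setT measurableT
  (fun k x => (F k x)%:E) (fun x => (f x)%:E) (fun x => (g x)%:E)
  (fun k => measurableT_comp (@EFin_measurable R setT) (mF k))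
  (measurableT_comp (@EFin_measurable R setT) mf)
  (aeW _ cE) ig (aeW _ (fun x k _ => Fg k x)).
by apply: fine_cvg; rewrite fineK//; exact: integrable_fin_num.
Qed.

End real_integrals.

Section real_fubini.
Context d d' (X : measurableType d) (Y : measurableType d') (R : realType).
Context (m1 : {sigma_finite_measure set X -> \bar R}).
Context (m2 : {sigma_finite_measure set Y -> \bar R}).
Implicit Types f : X -> Y -> R.

Lemma measurable_fun_Rintegral (f : X -> Y -> R) :
  measurable_fun setT (fun z : X * Y => f z.1 z.2) ->
  measurable_fun setT (fun x => \int[m2]_y f x y).
Proof.
move=> mf; have mF : measurable_fun setT (fun z : X * Y => (f z.1 z.2)%:E).
  exact/measurable_EFinP.
apply: (@measurableT_comp _ _ _ _ _ _ fine); first by [].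
rewrite [X in measurable_fun _ X](_ : _ =
  (fun x => \int[m2]_y (fun z : X * Y => (f z.1 z.2)%:E)^\+ (x, y)) \-
  (fun x => \int[m2]_y (fun z : X * Y => (f z.1 z.2)%:E)^\- (x, y)))%E; last first.
  by apply/funext => x; rewrite integralE/=; congr (_ - _)%E;
    apply: eq_integral => y _; rewrite ?funeposE ?funenegE.
apply: emeasurable_funB.
  apply: (measurable_fun_fubini_tonelli_F (fun z : X * Y => (f z.1 z.2)%:E)^\+%E) => //.
  exact: measurable_funepos.
apply: (measurable_fun_fubini_tonelli_F (fun z : X * Y => (f z.1 z.2)%:E)^\-%E) => //.
exact: measurable_funeneg.
Qed.

Lemma measurable_section1 f x :
  measurable_fun setT (fun z : X * Y => f z.1 z.2) -> measurable_fun setT (f x).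
Proof.
move=> mf; apply: (measurableT_comp mf (f := fun z : X * Y => f z.1 z.2) (g := pair x)).
exact: measurable_pair1.
Qed.

Lemma measurable_section2 f y :
  measurable_fun setT (fun z : X * Y => f z.1 z.2) ->
  measurable_fun setT (f ^~ y).
Proof.
move=> mf; apply: (measurableT_comp mf (f := fun z : X * Y => f z.1 z.2) (g := fun x => (x, y))).
exact: measurable_pair2.
Qed.

Lemma tonelli f : measurable_fun setT (fun z : X * Y => f z.1 z.2) ->
  (forall x y, 0 <= f x y) ->
  (\int[m1]_x \int[m2]_y (f x y)%:E = \int[m2]_y \int[m1]_x (f x y)%:E)%E.
Proof.
move=> mf f0.
apply: (@fubini_tonelli _ _ _ _ _ m1 m2 (fun z => (f z.1 z.2)%:E)).
  exact/measurable_EFinP.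
by move=> z; rewrite lee_fin.
Qed.

(** All sections are assumed integrable, not merely almost all, so that the
    iterated integrals can be real-valued. *)
Lemma Rintegral_fubini f : measurable_fun setT (fun z : X * Y => f z.1 z.2) ->
  (forall x, m2.-integrable setT (EFin \o f x)) ->
  (forall y, m1.-integrable setT (EFin \o f ^~ y)) ->
  (\int[m1]_x \int[m2]_y `|f x y|%:E < +oo)%E ->
  m2.-integrable setT (EFin \o (fun y => \int[m1]_x f x y)) /\
  \int[m1]_x \int[m2]_y f x y = \int[m2]_y \int[m1]_x f x y.
Proof.
move=> mf i2 i1 oo.
have mF : measurable_fun setT (fun z : X * Y => (f z.1 z.2)%:E).
  exact/measurable_EFinP.
have iF : (m1 \x m2)%E.-integrable setT (fun z : X * Y => (f z.1 z.2)%:E).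
  exact/integrable12ltyP.
split.
  have iF' : (m2 \x m1)%E.-integrable setT (fun z : Y * X => (f z.2 z.1)%:E).
    apply/integrable21ltyP => //; apply: (measurableT_comp mF (g := fun z : Y * X => (z.2, z.1))).
    exact: measurable_fun_pair.
  apply: eq_integrable (integrable_fubini_F iF') => // y _.
  by rewrite /fubini_F/= -integral_Rintegral//; exact: i1.
rewrite /Rintegral; congr fine.
under eq_integral => x _ do rewrite -/(Rintegral _ _ _) -integral_Rintegral//.
rewrite (Fubini iF)/=; apply: eq_integral => y _.
by rewrite integral_Rintegral//; exact: i1.
Qed.

Lemma tonelli_le_prod f (a : X -> R) (b : Y -> R) :
  measurable_fun setT (fun z : X * Y => f z.1 z.2) ->
  (forall x y, 0 <= f x y) -> (forall x y, f x y <= a x * b y) ->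
  (forall x, 0 <= a x) -> (forall y, 0 <= b y) ->
  m1.-integrable setT (EFin \o a) -> m2.-integrable setT (EFin \o b) ->
  (\int[m1]_x \int[m2]_y (f x y)%:E <=
   ((\int[m2]_y b y) * (\int[m1]_x a x))%:E)%E.
Proof.
move=> mf f0 fab a0 b0 ia ib.
have ma := integrable_measurable ia; have mb := integrable_measurable ib.
apply: (@le_trans _ _ (\int[m1]_x \int[m2]_y (a x * b y)%:E)%E).
  apply: ge0_le_integral => //.
  - by move=> x _; apply: integral_ge0 => y _; rewrite lee_fin.
  - apply: (measurable_fun_fubini_tonelli_F (fun z : X * Y => (f z.1 z.2)%:E)).
      exact/measurable_EFinP.
    by move=> z; rewrite lee_fin.
  - apply: (measurable_fun_fubini_tonelli_F (fun z : X * Y => (a z.1 * b z.2)%:E)).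
      apply/measurable_EFinP; apply: measurable_funM.
        exact: measurableT_comp.
      exact: measurableT_comp.
    by move=> z; rewrite lee_fin mulr_ge0.
  - move=> x _; apply: ge0_le_integral_EFin => //.
      exact: measurable_section1.
    exact: measurable_funM.
under eq_integral => x _ do rewrite ge0_integralZ// integral_Rintegral// -EFinM mulrC.
rewrite ge0_integralZ// ?integral_Rintegral//.
exact: Rintegral_ge0.
Qed.

Lemma Rintegral_fubini_dom f (a : X -> R) (b : Y -> R) :
  measurable_fun setT (fun z : X * Y => f z.1 z.2) ->
  (forall x y, `|f x y| <= a x * b y) ->
  (forall x, 0 <= a x) -> (forall y, 0 <= b y) ->
  m1.-integrable setT (EFin \o a) -> m2.-integrable setT (EFin \o b) ->
  \int[m1]_x \int[m2]_y f x y = \int[m2]_y \int[m1]_x f x y.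
Proof.
move=> mf fab a0 b0 ia ib; apply: (Rintegral_fubini _ _ _ _).2 => //.
- move=> x; apply: (@dominated_integrable _ _ _ _ _ (fun y => a x * b y)) => //.
    exact: measurable_section1.
  exact: integrableZ.
- move=> y; apply: (@dominated_integrable _ _ _ _ _ (fun x => b y * a x)) => //.
    exact: measurable_section2.
    by move=> x; rewrite mulrC.
  exact: integrableZ.
- apply: le_lt_trans (tonelli_le_prod _ _ fab a0 b0 ia ib) _ => //.
    exact: measurableT_comp.
  by rewrite ltry.
Qed.

End real_fubini.

(** A change of variables that scales the integral of every nonnegative
    function by the same factor does so for every integrable function. *)
Section change_of_variables.
Context d (T : measurableType d) (R : realType) (mu : {measure set T -> \bar R}).
Context (phi : T -> T) (k : R).
Hypothesis mphi : measurable_fun setT phi.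
Hypothesis k_gt0 : 0 < k.
Hypothesis phiE : forall f : T -> R, measurable_fun setT f ->
  (forall x, 0 <= f x) ->
  (\int[mu]_x (f x)%:E = k%:E * \int[mu]_x (f (phi x))%:E)%E.

Lemma integrable_change (f : T -> R) : mu.-integrable setT (EFin \o f) ->
  mu.-integrable setT (EFin \o (fun x => f (phi x))).
Proof.
move=> fi; have mf := integrable_measurable fi.
apply/integrableP; split.
  by apply/measurable_EFinP; exact: measurableT_comp mphi.
have /integrableP[_] := fi.
have := @phiE (fun x => `|f x|) (measurableT_comp (@normr_measurable _ setT) mf) (fun x => normr_ge0 _).
rewrite /= => -> koo; rewrite ltNge; apply/negP => h.
move: koo; rewrite (_ : (\int[mu]_x (`|f (phi x)|)%:E)%E = +oo%E) ?gt0_muley ?ltxx//.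
by apply/eqP; rewrite -leye_eq.
Qed.

Lemma Rintegral_change (f : T -> R) : mu.-integrable setT (EFin \o f) ->
  \int[mu]_x f x = k * \int[mu]_x f (phi x).
Proof.
move=> fi; have mf := integrable_measurable fi.
have pos (g : T -> R) : mu.-integrable setT (EFin \o g) -> (forall x, 0 <= g x) ->
    \int[mu]_x g x = k * \int[mu]_x g (phi x).
  move=> gi g0; rewrite {1}/Rintegral phiE//; last exact: integrable_measurable gi.
  by rewrite integral_Rintegral//; exact: integrable_change.
pose p x := (`|f x| + f x) / 2; pose m x := (`|f x| - f x) / 2.
have fp : f = fun x => p x - m x by apply/funext => x; rewrite /p /m; field.
have ip : mu.-integrable setT (EFin \o p).
  rewrite (_ : p = fun x => 2^-1 * (`|f x| + f x)).
    by apply: integrableZ; apply: integrable_add => //; exact: integrable_norm.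
  by apply/funext => x; rewrite mulrC.
have im : mu.-integrable setT (EFin \o m).
  rewrite (_ : m = fun x => 2^-1 * (`|f x| - f x)).
    by apply: integrableZ; apply: integrable_sub => //; exact: integrable_norm.
  by apply/funext => x; rewrite mulrC.
have p0 x : 0 <= p x by rewrite /p; have := ler_norm (- f x); rewrite normrN; lra.
have m0 x : 0 <= m x by rewrite divr_ge0// subr_ge0 ler_norm.
rewrite fp RintegralB// RintegralB//; last 2 first.
- exact: integrable_change ip.
- exact: integrable_change im.
by rewrite mulrBr (pos p)// (pos m).
Qed.

End change_of_variables.

Section line_integrals.
Context {R : realType}.
Local Notation leb := (@lebesgue_measure R).
Implicit Types f : R -> R.

Let affine (b c : R) : measurableTypeR R -> measurableTypeR R :=
  fun x => b + c * x.

Let measurable_affine b c : measurable_fun setT (affine b c).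
Proof. by apply: measurable_funD => //; exact: measurable_funM. Qed.

Lemma lebesgue_affine (b c : R) A : c != 0 -> measurable A ->
  (`|c|%:E * pushforward leb (affine b c) A)%E = leb A.
Proof.
move=> c0 mA.
pose c' : {nonneg R} := NngNum (normr_ge0 c).
unshelve refine (esym (@lebesgue_measure_unique R
  (mscale c' (pushforward leb (affine b c))) _ A mA)).
  exact: measurable_affine.
move=> _ [[u v]] _ <- /=.
rewrite /mscale /= /pushforward.
have [cpos|cneg] := ltP 0 c.
- rewrite (_ : _ @^-1` _ = `](u - b) / c, (v - b) / c]%classic); last first.
    apply/seteqP; split => x /=; rewrite !in_itv/= /affine;
      rewrite ltr_pdivrMr// ler_pdivlMr// ltrBlDl lerBrDl (mulrC x);
      by [].
  rewrite !lebesgue_measure_itv/= !lte_fin ltr_pM2r ?invr_gt0// ltrD2r.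
  case: ifPn => _; last by rewrite mule0.
  rewrite -!EFinB -EFinM; congr EFin.
  by rewrite gtr0_norm//; field.
- have {cneg}cneg : c < 0 by rewrite lt_neqAle c0.
  rewrite (_ : _ @^-1` _ = `[(v - b) / c, (u - b) / c[%classic); last first.
    apply/seteqP; split => x /=; rewrite !in_itv/= /affine;
      rewrite ler_ndivrMr// ltr_ndivlMr// lerBrDl ltrBlDl (mulrC x) andbC;
      by [].
  rewrite !lebesgue_measure_itv/= !lte_fin ltr_nM2r ?invr_lt0// ltrD2r.
  case: ifPn => _; last by rewrite mule0.
  rewrite -!EFinB -EFinM; congr EFin.
  by rewrite ltr0_norm//; field.
Qed.

Lemma ge0_integral_affine (b c : R) (f : R -> \bar R) : c != 0 ->
  measurable_fun setT f -> (forall x, 0 <= f x)%E ->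
  (\int[leb]_x f x = `|c|%:E * \int[leb]_x f (b + c * x)%R)%E.
Proof.
move=> c0 mf f0.
pose c' : {nonneg R} := NngNum (normr_ge0 c).
unshelve refine (etrans (@eq_measure_integral _ _ _ setT
  (mscale c' (pushforward leb (affine b c))) leb _ _) _).
- exact: measurable_affine.
- by move=> A mA _; apply/esym; exact: lebesgue_affine.
rewrite ge0_integral_mscale//.
congr (_ * _)%E.
by rewrite ge0_integral_pushforward.
Qed.

Lemma ge0_integral_affine_EFin (b c : R) f : c != 0 -> measurable_fun setT f ->
  (forall x, 0 <= f x) ->
  (\int[leb]_x (f x)%:E = `|c|%:E * \int[leb]_x (f (b + c * x))%:E)%E.
Proof.
move=> c0 mf f0; apply: (ge0_integral_affine b c0 (f := EFin \o f)).
  exact/measurable_EFinP.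
by move=> x; rewrite lee_fin.
Qed.

Lemma integrable_oneDsqrV : leb.-integrable setT (EFin \o (fun x => (1 + x ^+ 2)^-1)).
Proof.
have c : continuous (fun x : R => (1 + x ^+ 2)^-1).
  by move=> x; exact: continuous_oneDsqrV.
have p x : 0 <= (1 + x ^+ 2)^-1 :> R.
  by rewrite invr_ge0 addr_ge0// sqr_ge0.
apply: ge0_integrable => //.
  exact: continuous_measurable_fun.
rewrite ge0_symfun_integralT//=; last by move=> x /=; rewrite sqrrN.
rewrite (_ : [set x | _] = `[0, +oo[%classic); last first.
  by apply/seteqP; split => x/=; rewrite in_itv/= andbT.
have := @integral0y_oneDsqr R.
rewrite /oneDsqr => ->.
by rewrite -EFinM ltry.
Qed.

End line_integrals.

(** * The Gaussian on the line *)

Section gauss_line.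
Context {R : realType}.
Local Notation leb := (@lebesgue_measure R).

Definition gauss1 (x : R) : R := expR (- (pi * x ^+ 2)).

Lemma gauss1_ge0 x : 0 <= gauss1 x. Proof. exact: expR_ge0. Qed.

Lemma measurable_gauss1 : measurable_fun setT gauss1.
Proof.
apply: measurableT_comp => //; apply: measurableT_comp => //.
by apply: measurable_funM => //; exact: measurable_funX.
Qed.

Lemma integral_gauss1 : (\int[leb]_x (gauss1 x)%:E)%E = 1%E.
Proof.
have sp : 0 < Num.sqrt pi :> R by rewrite sqrtr_gt0 pi_gt0.
have := @ge0_integral_affine_EFin R 0 (Num.sqrt pi) gauss_fun (lt0r_neq0 sp)
  measurable_gauss_fun gauss_fun_ge0.
rewrite integralT_gauss gtr0_norm//.
under eq_integral => x _ do rewrite add0r /gauss_fun exprMn sqr_sqrtr ?pi_ge0//.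
rewrite -/gauss1 => h.
have f : (\int[leb]_x (gauss1 x)%:E)%E \is a fin_num.
  rewrite ge0_fin_numE; last by apply: integral_ge0 => x _; rewrite lee_fin gauss1_ge0.
  rewrite ltNge leye_eq; apply/negP => /eqP e; move: h; rewrite e.
  by rewrite gt0_muley// lte_fin.
rewrite -(fineK f) -EFinM in h *.
by case: h => h; congr EFin; apply: (mulfI (lt0r_neq0 sp)); rewrite -h mulr1.
Qed.

Lemma integrable_gauss1 : leb.-integrable setT (EFin \o gauss1).
Proof.
apply: ge0_integrable; [exact: measurable_gauss1|exact: gauss1_ge0|].
by rewrite integral_gauss1 ltry.
Qed.

(** The function [1 / (1 + x ^ 2)] serves as the common integrable majorant
    on the line; two powers of it are available because [2 <= pi]. *)
Lemma gauss1_le x : gauss1 x * (1 + x ^+ 2) ^+ 2 <= 1.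
Proof.
have h : (1 + x ^+ 2) ^+ 2 <= expR (pi * x ^+ 2).
  have : (1 + x ^+ 2) ^+ 2 <= expR (x ^+ 2) ^+ 2.
    by rewrite lerXn2r// ?nnegrE ?addr_ge0 ?sqr_ge0 ?expR_ge0// expR_ge1Dx.
  move=> /le_trans; apply.
  rewrite expr2 -expRD ler_expR -mulr2n -mulr_natl ler_wpM2r ?sqr_ge0//.
  exact: pi_ge2.
rewrite /gauss1 expRN mulrC ler_pdivrMr ?mul1r//.
exact: expR_gt0.
Qed.

End gauss_line.

Section gauss_line_fourier.
Context {R : realType}.
Local Notation leb := (@lebesgue_measure R).
Variable alpha : R.

(* [h - i k] is the entire function [exp (- i alpha - pi (x + i xi) ^ 2)].  By
   the Cauchy-Riemann equations the derivative of [h] in [xi] is the derivative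
   of [k] in [x]; it is [l]. *)
Let h (xi x : R) := expR (pi * (xi ^+ 2 - x ^+ 2)) * cos (alpha + 2 * pi * x * xi).
Let k (xi x : R) := expR (pi * (xi ^+ 2 - x ^+ 2)) * sin (alpha + 2 * pi * x * xi).
Let l (xi x : R) := 2 * pi * expR (pi * (xi ^+ 2 - x ^+ 2)) *
  (xi * cos (alpha + 2 * pi * x * xi) - x * sin (alpha + 2 * pi * x * xi)).

Let dh xi x : is_derive (xi : R^o) 1 (fun xi : R^o => h xi x : R^o) (l xi x).
Proof.
rewrite /h.
apply: is_derive_eq; rewrite /l /GRing.scale/=.
ring.
Qed.

Let dk xi x : is_derive (x : R^o) 1 (fun x : R^o => k xi x : R^o) (l xi x).
Proof.
rewrite /k.
apply: is_derive_eq; rewrite /l /GRing.scale/=.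
ring.
Qed.

Let mh xi : measurable_fun setT (h xi).
Proof.
apply: continuous_measurable_fun => x; apply: differentiable_continuous.
apply/derivable1_diffP.
by apply: ex_derive; rewrite /h.
Qed.

Let mk xi : measurable_fun setT (k xi).
Proof.
apply: continuous_measurable_fun => x; apply: differentiable_continuous.
apply/derivable1_diffP.
exact: (@ex_derive _ _ _ _ _ _ _ (dk xi x)).
Qed.

Let expE (xi x : R) : expR (pi * (xi ^+ 2 - x ^+ 2)) = expR (pi * xi ^+ 2) * gauss1 x.
Proof. by rewrite /gauss1 -expRD mulrBr. Qed.

Let h_le (xi x : R) : `|h xi x| <= expR (pi * xi ^+ 2) * gauss1 x.
Proof.
rewrite /h normrM expE ger0_norm ?mulr_ge0 ?expR_ge0//.
by rewrite ler_piMr ?mulr_ge0 ?expR_ge0// cos_max.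
Qed.

Let k_le (xi x : R) : `|k xi x| <= expR (pi * xi ^+ 2) * gauss1 x.
Proof.
rewrite /k normrM expE ger0_norm ?mulr_ge0 ?expR_ge0//.
by rewrite ler_piMr ?mulr_ge0 ?expR_ge0// sin_max.
Qed.

Let ih xi : leb.-integrable setT (EFin \o h xi).
Proof.
refine (@dominated_integrable _ _ R leb _ _ (mh xi) (h_le xi) _).
by apply: integrableZ; exact: integrable_gauss1.
Qed.

Let ik xi : leb.-integrable setT (EFin \o k xi).
Proof.
refine (@dominated_integrable _ _ R leb _ _ (mk xi) (k_le xi) _).
by apply: integrableZ; exact: integrable_gauss1.
Qed.

(* A majorant of [l] in [x] that is uniform for [|xi| <= L]. *)
Let C (L : R) := 2 * pi * expR (pi * L ^+ 2) * (L + 1).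

Let C_ge0 L : 0 <= L -> 0 <= C L.
Proof. by move=> L0; rewrite /C !mulr_ge0 ?expR_ge0 ?pi_ge0// addr_ge0. Qed.

Let D_ge0 (L x : R) : 0 <= L -> 0 <= C L * (1 + x ^+ 2)^-1.
Proof.
by move=> L0; apply: mulr_ge0; [exact: C_ge0|rewrite invr_ge0 addr_ge0 ?sqr_ge0].
Qed.

Let l_le (L xi x : R) : `|xi| <= L -> `|l xi x| <= C L * (1 + x ^+ 2)^-1.
Proof.
move=> xiL; have L0 : 0 <= L by exact: le_trans xiL.
have d0 : 0 < 1 + x ^+ 2 :> R by rewrite ltr_pwDl// sqr_ge0.
rewrite ler_pdivlMr// /l expE !normrM.
rewrite (ger0_norm (ltW (pi_gt0 R))) (ger0_norm (expR_ge0 _)).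
rewrite (ger0_norm (gauss1_ge0 x)) ger0_norm//.
set t := `|_ - _|.
have tle : t <= (L + 1) * (1 + x ^+ 2).
  apply: (@le_trans _ _ (`|xi| + `|x|)).
    rewrite /t (le_trans (ler_normB _ _))// lerD// normrM.
      by rewrite ler_piMr// cos_max.
    by rewrite ler_piMr// sin_max.
  have : `|x| <= 1 + x ^+ 2.
    by rewrite -(normr_id x) -real_normK ?num_real// normr_id; have := sqr_ge0 (`|x| - 1); nra.
  have := sqr_ge0 x; nra.
have gle : gauss1 x * (1 + x ^+ 2) ^+ 2 <= 1 by exact: gauss1_le.
have ele : expR (pi * xi ^+ 2) <= expR (pi * L ^+ 2).
  rewrite ler_expR ler_wpM2l ?pi_ge0// -(real_normK (num_real xi)).
  by rewrite lerXn2r// nnegrE.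
rewrite (_ : 2 * pi * (expR (pi * xi ^+ 2) * gauss1 x) * t * (1 + x ^+ 2) =
  2 * pi * expR (pi * xi ^+ 2) * ((gauss1 x * (1 + x ^+ 2)) * t)); last by ring.
rewrite /C; apply: ler_pM.
- by rewrite !mulr_ge0 ?expR_ge0 ?pi_ge0.
- by rewrite !mulr_ge0 ?gauss1_ge0 ?(ltW d0)// /t.
- by rewrite ler_wpM2l// mulr_ge0// pi_ge0.
apply: (@le_trans _ _ ((L + 1) * (gauss1 x * (1 + x ^+ 2) ^+ 2))).
  rewrite (_ : (L + 1) * _ = (gauss1 x * (1 + x ^+ 2)) * ((L + 1) * (1 + x ^+ 2))); last by ring.
  by rewrite ler_wpM2l// mulr_ge0 ?gauss1_ge0// ltW.
by rewrite ler_piMr// addr_ge0.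
Qed.

(* [l] is an [x]-derivative, and the integral of [k] does not change when its
   argument is translated. *)
Let int_l xi : \int[leb]_x l xi x = 0.
Proof.
pose f (a x : R) := k xi (a + 1 * x).
have fa a : \int[leb]_x f a x = \int[leb]_x k xi x.
  rewrite [RHS](@Rintegral_change _ _ _ leb (fun x => a + 1 * x) 1)//.
  - by rewrite mul1r.
  - by apply: measurable_funD => //; exact: measurable_funM.
  - by move=> g mg g0; rewrite (ge0_integral_affine_EFin a (@oner_neq0 R))// normr1.
have if_ a : leb.-integrable setT (EFin \o f a).
  apply: (@integrable_change _ _ _ leb (fun x => a + 1 * x) 1) => //.
  - by apply: measurable_funD => //; exact: measurable_funM.
  - by move=> g mg g0; rewrite (ge0_integral_affine_EFin a (@oner_neq0 R))// normr1.
have df a x : is_derive (a : R^o) 1 (fun a : R^o => f a x : R^o) (l xi (a + x)).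
  have dg : is_derive a 1 (fun a : R => a + 1 * x) 1.
    by apply: is_derive_eq; rewrite addr0.
  have := @is_derive1_comp R (k xi) (fun a => a + 1 * x) a _ _ (dk xi _) dg.
  by rewrite /f mulr1 mul1r.
have [_ d0] : is_derive (0 : R^o) 1 (fun a : R^o => \int[leb]_x f a x : R^o) 0.
  rewrite (_ : (fun _ => _) = cst (\int[leb]_x k xi x)).
    exact: is_derive_cst.
  by apply/funext => a; rewrite fa.
have dF := @differentiation_under_integral R _ _ leb f setT measurableT 0 (-1) 1.
have <- : derive1 (fun a : R => \int[leb]_x f a x : R^o) 0 = 0 by rewrite derive1E.
rewrite (dF _ _ _ (fun x => C `|xi| * (3 * (1 + x ^+ 2)^-1))).
- by apply: eq_Rintegral => x _; rewrite partial1of2E; have [_ ->] := df 0 x; rewrite add0r.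
- by rewrite /= in_itv/=; apply/andP; split; lra.
- by move=> a _; exact: if_.
- by move=> a x _ _; have [] := df a x.
- by move=> x; rewrite mulrCA mulr_ge0// D_ge0.
- apply: integrableZ; apply: integrableZ; exact: integrable_oneDsqrV.
- move=> a x; rewrite /= in_itv/= => /andP[a1 a2] _.
  rewrite partial1of2E; have [_ ->] := df a x.
  apply: (le_trans (l_le _ (lexx _))).
  rewrite ler_wpM2l ?C_ge0//.
  (* the 3 covers the translations by [|a| <= 1]: 1 + x ^ 2 <= 3 (1 + (a + x) ^ 2) *)
  have p y : 0 < 1 + y ^+ 2 :> R by rewrite ltr_pwDl// sqr_ge0.
  rewrite -[leLHS]mul1r ler_pdivrMr// mulrAC ler_pdivlMr//.
  by have := sqr_ge0 (a + x); have := sqr_ge0 (x + 2 * a); nra.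
Qed.

Lemma gauss1_fourier_shift xi : \int[leb]_x h xi x = cos alpha.
Proof.
have dH (y : R) : is_derive (y : R^o) 1 (fun xi : R^o => \int[leb]_x h xi x : R^o) 0.
  have G0 x : 0 <= C (`|y| + 1) * (1 + x ^+ 2)^-1.
    by rewrite D_ge0// addr_ge0.
  have yI : `]y - 1, y + 1[%classic y by rewrite /= in_itv/=; apply/andP; split; lra.
  have ihI x : `]y - 1, y + 1[%classic x -> leb.-integrable setT (EFin \o h x) by [].
  have dh1 x t : `]y - 1, y + 1[%classic x -> setT t -> derivable (h ^~ t) x 1.
    by move=> _ _; have [] := dh x t.
  have iG : leb.-integrable setT (EFin \o (fun x => C (`|y| + 1) * (1 + x ^+ 2)^-1)).
    by apply: integrableZ; exact: integrable_oneDsqrV.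
  have Gub x t : `]y - 1, y + 1[%classic x -> setT t ->
      `|(partial1of2 h) x t| <= C (`|y| + 1) * (1 + t ^+ 2)^-1.
    rewrite /= in_itv/= => /andP[x1 x2] _.
    rewrite partial1of2E; have [_ ->] := dh x t; apply: l_le.
    rewrite -[x](subrK y) addrC (le_trans (ler_normD _ _))// lerD2l.
    by rewrite ler_norml; apply/andP; split; lra.
  have dF := differentiation_under_integral measurableT yI ihI dh1 G0 iG Gub.
  have eF := derivable_under_integral measurableT yI ihI dh1 G0 iG Gub.
  split => //; rewrite -derive1E dF -[RHS](int_l y).
  by apply: eq_Rintegral => x _; rewrite partial1of2E; have [_ ->] := dh y x.
rewrite (@is_derive_0_is_cst R (fun y => \int[leb]_x h y x) xi 0 dH).
rewrite /h; under eq_Rintegral => x _ do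
  rewrite mulr0 addr0 expr0n sub0r mulrN -/(gauss1 x) mulrC.
rewrite RintegralZl//; last exact: integrable_gauss1.
by rewrite {1}/Rintegral integral_gauss1 mulr1.
Qed.

End gauss_line_fourier.

(** The Gaussian is its own Fourier transform: moving the line of integration
    of [exp (- pi (x + i xi) ^ 2)] does not change the integral.  A free phase
    covers the cosine and the sine transform at once. *)
Lemma gauss1_fourier (R : realType) (alpha xi : R) :
  \int[lebesgue_measure]_x (gauss1 x * cos (alpha + 2 * pi * (x * xi))) =
  cos alpha * gauss1 xi.
Proof.
have := gauss1_fourier_shift alpha xi.
under eq_Rintegral => x _ do rewrite mulrBr expRD -/(gauss1 x) -mulrA -(mulrA (2 * pi)).
rewrite RintegralZl//=; first last.
  apply: (@dominated_integrable _ _ R lebesgue_measure _ gauss1).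
  - apply: measurable_funM; first exact: measurable_gauss1.
    apply: (measurableT_comp (f := @cos R)).
      by apply: continuous_measurable_fun; exact: continuous_cos.
    apply: measurable_funD => //.
    by apply: measurable_funM => //; exact: measurable_funM.
  - move=> x; rewrite normrM ger0_norm ?gauss1_ge0// ler_piMr ?gauss1_ge0//.
    exact: cos_max.
  - exact: integrable_gauss1.
have e : expR (pi * xi ^+ 2) * gauss1 xi = 1 by rewrite /gauss1 -expRD subrr expR0.
by move=> <-; rewrite mulrAC e mul1r.
Qed.

(** * Euclidean space as a space of tuples *)

Section tuple_space.
Context {R : realType}.
Local Notation X n := (n.-tuple (measurableTypeR R)).

Definition taff n (x : X n) (c : R) (z : X n) : X n :=
  [tuple tnth x i + c * tnth z i | i < n].

Definition dot n (x y : X n) : R := \sum_(i < n) tnth x i * tnth y i.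

(** Products of one-dimensional kernels are chosen as majorants because they
    are integrated one coordinate at a time. *)
Definition majorant n (x : X n) : R := \prod_(i < n) (1 + tnth x i ^+ 2)^-1.

Definition gauss n (x : X n) : R := expR (- (pi * dot x x)).

Lemma tnth_taff n (x : X n) c z i :
  tnth (taff x c z) i = tnth x i + c * tnth z i.
Proof. by rewrite tnth_mktuple. Qed.

Lemma tnth_cons0 n x (t : X n) : tnth (tuple_cons (x, t)) ord0 = x.
Proof. by rewrite /tuple_cons/= tnth0. Qed.

Lemma tnth_consS n x (t : X n) i : tnth (tuple_cons (x, t)) (lift ord0 i) = tnth t i.
Proof. by rewrite /tuple_cons/= tnthS. Qed.

Lemma tuple_cons_eta n (t : X n.+1) : exists x u, t = tuple_cons (x, u).
Proof.
exists (thead t), [tuple of behead t].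
by rewrite [LHS]tuple_eta; apply: val_inj.
Qed.

Lemma taff_cons n x (t : X n) c z u :
  taff (tuple_cons (x, t)) c (tuple_cons (z, u)) =
  tuple_cons (x + c * z, taff t c u).
Proof.
apply: eq_from_tnth => i; rewrite tnth_taff.
case: (unliftP ord0 i) => [j ->|->]; first by rewrite !tnth_consS tnth_taff.
by rewrite !tnth_cons0.
Qed.

Lemma dot_cons n x (t : X n) y u :
  dot (tuple_cons (x, t)) (tuple_cons (y, u)) = x * y + dot t u.
Proof.
rewrite /dot big_ord_recl !tnth_cons0; congr (_ + _).
by apply: eq_bigr => i _; rewrite !tnth_consS.
Qed.

Lemma majorant_cons n x (t : X n) :
  majorant (tuple_cons (x, t)) = (1 + x ^+ 2)^-1 * majorant t.
Proof.
rewrite /majorant big_ord_recl !tnth_cons0; congr (_ * _).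
by apply: eq_bigr => i _; rewrite !tnth_consS.
Qed.

Lemma gauss_cons n x (t : X n) :
  gauss (tuple_cons (x, t)) = gauss1 x * gauss t.
Proof. by rewrite /gauss dot_cons mulrDr opprD expRD -expr2. Qed.

Lemma dotC n (x y : X n) : dot x y = dot y x.
Proof. by apply: eq_bigr => i _; rewrite mulrC. Qed.

Lemma dot_taffl n (x z y : X n) c : dot (taff x c z) y = dot x y + c * dot z y.
Proof.
rewrite /dot mulr_sumr -big_split; apply: eq_bigr => i _ /=.
by rewrite tnth_taff mulrDl mulrA.
Qed.

Lemma dot_taffr n (x z y : X n) c : dot y (taff x c z) = dot y x + c * dot y z.
Proof. by rewrite dotC dot_taffl !(dotC y). Qed.

Lemma dot_ge0 n (x : X n) : 0 <= dot x x.
Proof. by apply: sumr_ge0 => i _; rewrite -expr2 sqr_ge0. Qed.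

Lemma sqr_tnth_le n (x : X n) i : tnth x i ^+ 2 <= dot x x.
Proof.
rewrite /dot (bigD1 i)//= -expr2 lerDl.
by apply: sumr_ge0 => j _; rewrite -expr2 sqr_ge0.
Qed.

Lemma majorant_gt0 n (x : X n) : 0 < majorant x.
Proof. by apply: prodr_gt0 => i _; rewrite invr_gt0 ltr_pwDl// sqr_ge0. Qed.

Lemma majorant_ge0 n (x : X n) : 0 <= majorant x.
Proof. exact/ltW/majorant_gt0. Qed.

Lemma majorant_le1 n (x : X n) : majorant x <= 1.
Proof.
apply: (@le_trans _ _ (\prod_(i < n) 1)); last by rewrite big1.
apply: ler_prod => i _; rewrite invr_ge0 invf_le1 ?addr_ge0 ?sqr_ge0//=.
  by rewrite lerDl sqr_ge0.
by rewrite ltr_pwDl// sqr_ge0.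
Qed.

Lemma oneDdot_le n (x : X n) : 1 + dot x x <= (majorant x)^-1.
Proof.
rewrite /majorant prodfV invrK; elim: n x => [|n IH] x.
  by rewrite /dot !big_ord0 addr0.
have [y [t ->]] := tuple_cons_eta x; have IHt := IH t; have t0 := dot_ge0 t.
rewrite dot_cons big_ord_recl tnth_cons0.
rewrite (eq_bigr (fun i => 1 + tnth t i ^+ 2)); last by move=> i _; rewrite tnth_consS.
by have := sqr_ge0 y; rewrite !expr2; nra.
Qed.

Lemma gauss_ge0 n (x : X n) : 0 <= gauss x. Proof. exact: expR_ge0. Qed.

Lemma gauss_le1 n (x : X n) : gauss x <= 1.
Proof. by rewrite -expR0 ler_expR oppr_le0 mulr_ge0 ?pi_ge0 ?dot_ge0. Qed.

(** Both factors are at most [expR (dot x x)], and [2 <= pi]. *)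
Lemma gauss_le_majorant n (x : X n) : gauss x * (1 + dot x x) <= majorant x.
Proof.
have -> : majorant x = (\prod_(i < n) (1 + tnth x i ^+ 2))^-1 by rewrite /majorant prodfV.
have p0 : 0 < \prod_(i < n) (1 + tnth x i ^+ 2) :> R.
  by apply: prodr_gt0 => i _; rewrite ltr_pwDl// sqr_ge0.
rewrite -[leRHS]mul1r ler_pdivlMr// /gauss expRN -mulrA mulrC ler_pdivrMr ?expR_gt0// mul1r.
apply: (@le_trans _ _ (expR (dot x x) * expR (dot x x))).
  apply: ler_pM; rewrite ?(ltW p0) ?addr_ge0 ?dot_ge0 ?expR_ge1Dx//.
  rewrite /dot expR_sum; apply: ler_prod => i _.
  by rewrite addr_ge0 ?sqr_ge0//= -expr2 expR_ge1Dx.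
rewrite -expRD ler_expR -mulr2n -mulr_natl ler_wpM2r ?dot_ge0//.
exact: pi_ge2.
Qed.

Lemma gauss_le_majorant1 n (x : X n) : gauss x <= majorant x.
Proof.
apply: le_trans (gauss_le_majorant x); rewrite ler_peMr ?gauss_ge0//.
by rewrite lerDl dot_ge0.
Qed.

Section measurability.
Context d (T : measurableType d) (n : nat).
Implicit Types f g : T -> X n.

Lemma measurable_tnth_comp f i : measurable_fun setT f ->
  measurable_fun setT (fun w => tnth (f w) i : R).
Proof. by move=> mf; exact: measurableT_comp (measurable_tnth i) mf. Qed.

Lemma measurable_taff f (c : T -> R) g : measurable_fun setT f ->
  measurable_fun setT c -> measurable_fun setT g ->
  measurable_fun setT (fun w => taff (f w) (c w) (g w)).
Proof.
move=> mf mc mg; apply/measurable_fun_tnthP => i.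
rewrite (_ : _ \o _ = fun w => tnth (f w) i + c w * tnth (g w) i : R); last first.
  by apply/funext => w /=; rewrite tnth_taff.
by apply: measurable_funD; [|apply: measurable_funM => //]; exact: measurable_tnth_comp.
Qed.

Lemma measurable_dot f g : measurable_fun setT f ->
  measurable_fun setT g -> measurable_fun setT (fun w => dot (f w) (g w)).
Proof.
move=> mf mg; rewrite /dot; apply: measurable_sum => i.
exact: (measurable_funM (measurable_tnth_comp i mf) (measurable_tnth_comp i mg)).
Qed.

Lemma measurable_gauss f : measurable_fun setT f ->
  measurable_fun setT (fun w => gauss (f w)).
Proof.
move=> mf; apply: (measurableT_comp (f := fun a : R => expR (- (pi * a)))).
  apply: continuous_measurable_fun => a; apply: (continuous_comp (f := fun a => - (pi * a))).
    by apply: cvgN; apply: cvgMr; exact: cvg_id.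
  exact: continuous_expR.
exact: measurable_dot.
Qed.

Lemma measurable_majorant f : measurable_fun setT f ->
  measurable_fun setT (fun w => majorant (f w)).
Proof.
move=> mf; apply: measurable_prod => i _.
apply: (measurableT_comp (f := fun x : R => (1 + x ^+ 2)^-1)).
  by apply: continuous_measurable_fun => x; exact: continuous_oneDsqrV.
exact: measurable_tnth_comp.
Qed.

Lemma measurable_cos (a : T -> R) : measurable_fun setT a ->
  measurable_fun setT (fun w => cos (a w)).
Proof.
apply: measurableT_comp.
by apply: continuous_measurable_fun; exact: continuous_cos.
Qed.

End measurability.

Lemma measurable_taff1 n (x : X n) c : measurable_fun setT (taff x c).
Proof.
exact: (@measurable_taff _ _ n (cst x) (cst c) id (measurable_cst _)
  (measurable_cst _) (@measurable_id _ _ setT)).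
Qed.

End tuple_space.

Section tuple_integrals.
Context {R : realType}.
Local Notation leb := (@lebesgue_measure R).
Local Notation X n := (n.-tuple (measurableTypeR R)).
Local Notation lam n := (lebesgue_tuple R n).

Lemma ge0_integral_cons n (f : X n.+1 -> R) : measurable_fun setT f ->
  (forall t, 0 <= f t) ->
  (\int[lam n.+1]_t (f t)%:E =
   \int[leb]_x \int[lam n]_t (f (tuple_cons (x, t)))%:E)%E.
Proof.
move=> mf f0; rewrite /= /lebesgue_step.
have mfE : measurable_fun setT (EFin \o f) by exact/measurable_EFinP.
rewrite ge0_integral_pushforward//=.
- rewrite preimage_setT.
  rewrite (@fubini_tonelli1 _ _ _ _ _ _ (lam n) (fun z => (f (tuple_cons z))%:E))//;
    last by move=> z; rewrite lee_fin.
  apply/measurable_EFinP; exact: (measurableT_comp mf (@measurable_tuple_cons R n)).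
- exact: (@measurable_tuple_cons R n).
- by move=> x _; rewrite lee_fin.
Qed.

Lemma ge0_integral_tuple0 (f : X 0 -> R) : measurable_fun setT f ->
  (\int[lam 0]_t (f t)%:E = (f [tuple])%:E)%E.
Proof.
by move=> mf; rewrite integral_dirac ?diracT ?mul1e//; exact/measurable_EFinP.
Qed.

Lemma measurable_cons_pair n (f : X n.+1 -> R) : measurable_fun setT f ->
  measurable_fun setT (fun z : measurableTypeR R * X n => f (tuple_cons (z.1, z.2))).
Proof.
move=> mf; rewrite (_ : (fun _ => _) = f \o (@tuple_cons R n)).
  exact: (measurableT_comp mf (@measurable_tuple_cons R n)).
by apply/funext => -[].
Qed.

Lemma integrable_majorant n : (lam n).-integrable setT (EFin \o @majorant R n).
Proof.
have mE m : measurable_fun setT (@majorant R m).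
  exact: (@measurable_majorant R _ _ m id (@measurable_id _ _ setT)).
apply: ge0_integrable; [exact: mE|exact: majorant_ge0|].
elim: n => [|n IH].
  by rewrite ge0_integral_tuple0 ?ltry.
have iE := ge0_integrable (mE n) (@majorant_ge0 R n) IH.
rewrite ge0_integral_cons//; last exact: majorant_ge0.
rewrite (_ : (\int[leb]_x _)%E = (\int[leb]_x
    ((\int[lam n]_t majorant t) * (1 + x ^+ 2)^-1)%:E)%E).
  rewrite ge0_integralZ.
  - by rewrite integral_Rintegral ?ltry//; exact: integrable_oneDsqrV.
  - by apply: continuous_measurable_fun => x; exact: continuous_oneDsqrV.
  - by move=> x; rewrite invr_ge0 addr_ge0 ?sqr_ge0.
  - by apply: Rintegral_ge0 => t _; exact: majorant_ge0.
apply: eq_integral => x _.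
under eq_integral do rewrite majorant_cons.
rewrite ge0_integralZ//; last 2 first.
  exact: majorant_ge0.
  by rewrite invr_ge0 addr_ge0 ?sqr_ge0.
by rewrite integral_Rintegral// -EFinM mulrC.
exact: mE.
Qed.

Lemma integrable_gauss n : (lam n).-integrable setT (EFin \o @gauss R n).
Proof.
apply: dominated_integrable (integrable_majorant n).
  exact: (@measurable_gauss R _ _ _ id (@measurable_id _ _ setT)).
by move=> x; rewrite ger0_norm ?gauss_ge0// gauss_le_majorant1.
Qed.

(** The product bound makes every section integrable, so that the inner
    integral can be real-valued. *)
Lemma Rintegral_cons n (f : X n.+1 -> R) (a : R -> R) (b : X n -> R) :
  measurable_fun setT f -> (forall x t, `|f (tuple_cons (x, t))| <= a x * b t) ->
  leb.-integrable setT (EFin \o a) -> (lam n).-integrable setT (EFin \o b) ->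
  (lam n.+1).-integrable setT (EFin \o f) ->
  \int[lam n.+1]_t f t = \int[leb]_x \int[lam n]_t f (tuple_cons (x, t)).
Proof.
move=> mf fab ia ib ifi.
have mfE : measurable_fun setT (EFin \o f) by exact/measurable_EFinP.
have mg : measurable_fun setT
    (fun z : measurableTypeR R * X n => (f (tuple_cons z))%:E).
  by apply/measurable_EFinP; exact: (measurableT_comp mf (@measurable_tuple_cons R n)).
have ig : (leb \x (lam n))%E.-integrable setT
    (fun z : measurableTypeR R * X n => (f (tuple_cons z))%:E).
  apply/integrable12ltyP => //.
  have /integrableP[_] := ifi.
  rewrite /= (@ge0_integral_cons n (fun t => `|f t|))//.
  exact: measurableT_comp.
rewrite /Rintegral /= /lebesgue_step; congr fine.
rewrite integral_pushforward//=; last exact: (@measurable_tuple_cons R n).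
rewrite preimage_setT -(integral12_prod_meas1 ig); apply: eq_integral => x _.
rewrite -integral_Rintegral//.
apply: (@dominated_integrable _ _ _ _ _ (fun t => a x * b t)) => //.
  exact: (@measurable_section1 _ _ _ _ _ (fun x t => f (tuple_cons (x, t))) x (measurable_cons_pair mf)).
exact: integrableZ.
Qed.

(** One coordinate at a time: the phase of the remaining coordinates enters
    the one-dimensional formula as its free constant. *)
Lemma gauss_fourier n (alpha : R) (xi : X n) :
  \int[lam n]_z (gauss z * cos (alpha + 2 * pi * dot z xi)) = cos alpha * gauss xi.
Proof.
have mg m (b : R) (y : X m) : measurable_fun setT (fun z : X m => gauss z * cos (b + 2 * pi * dot z y)).
  apply: measurable_funM; first exact: (@measurable_gauss R _ _ _ id (@measurable_id _ _ setT)).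
  apply: measurable_cos; apply: measurable_funD => //; apply: measurable_funM => //.
  by apply: measurable_dot.
have gle m (b : R) (y z : X m) : `|gauss z * cos (b + 2 * pi * dot z y)| <= gauss z.
  by rewrite normrM ger0_norm ?gauss_ge0// ler_piMr ?gauss_ge0// cos_max.
elim: n alpha xi => [|n IH] alpha xi.
  rewrite /Rintegral ge0_integral_tuple0//= {1}/dot big_ord0 mulr0 addr0 mulrC.
  by congr (_ * gauss _); apply: eq_from_tnth => -[].
have [y [u ->]] := tuple_cons_eta xi.
rewrite (@Rintegral_cons _ _ (@gauss1 R) (@gauss R n))//; last 4 first.
- by move=> x t; rewrite -gauss_cons.
- exact: integrable_gauss1.
- exact: integrable_gauss.
- by apply: dominated_integrable (integrable_gauss n.+1); [exact: mg|exact: gle].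
under eq_Rintegral => x _.
  under eq_Rintegral => t _.
    rewrite gauss_cons dot_cons mulrDr addrA -mulrA.
    over.
  rewrite RintegralZl//; last first.
    by apply: dominated_integrable (integrable_gauss n); [exact: mg|exact: gle].
  rewrite IH mulrA mulrC.
  over.
rewrite RintegralZl//; last first.
  apply: (@dominated_integrable _ _ R leb _ (@gauss1 R)).
  - apply: measurable_funM; first exact: measurable_gauss1.
    apply: measurable_cos; apply: measurable_funD => //.
    by apply: measurable_funM => //; exact: measurable_funM.
  - move=> x; rewrite normrM ger0_norm ?gauss1_ge0// ler_piMr ?gauss1_ge0//.
    exact: cos_max.
  - exact: integrable_gauss1.
by rewrite gauss1_fourier gauss_cons mulrC -mulrA.
Qed.

(** The Fourier integral at the origin. *)
Lemma Rintegral_gauss n : \int[lam n]_z gauss z = 1.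
Proof.
have := gauss_fourier 0 ([tuple (0 : R) | i < n] : X n).
rewrite cos0 mul1r.
have d0 (z : X n) : dot z [tuple (0 : R) | i < n] = 0.
  by apply: big1 => i _; rewrite tnth_mktuple mulr0.
under eq_Rintegral do rewrite d0 mulr0 addr0 cos0 mulr1.
by move=> ->; rewrite /gauss d0 mulr0 oppr0 expR0.
Qed.

(** An affine map with the same ratio [c] in all coordinates changes variables
    in each factor of the product measure separately. *)
Lemma ge0_integral_taff n (x : X n) (c : R) (f : X n -> R) : c != 0 ->
  measurable_fun setT f -> (forall t, 0 <= f t) ->
  (\int[lam n]_t (f t)%:E =
   (`|c| ^+ n)%:E * \int[lam n]_t (f (taff x c t))%:E)%E.
Proof.
move=> c0; elim: n x f => [|n IH] x f mf f0.
  rewrite expr0 mul1e !ge0_integral_tuple0//.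
    by congr (_ _)%:E; apply: eq_from_tnth => -[].
  apply: (measurableT_comp mf).
  exact: measurable_taff1.
have [y [u ->]] := tuple_cons_eta x.
have mft : measurable_fun setT (fun t => f (taff (tuple_cons (y, u)) c t)).
  apply: (measurableT_comp mf).
  exact: measurable_taff1.
rewrite !ge0_integral_cons//.
pose F (v : R) := (\int[lam n]_t (f (tuple_cons (v, t)))%:E)%E.
have mF : measurable_fun setT F.
  apply: (@measurable_fun_fubini_tonelli_F _ _ _ _ _ (lam n)
    (fun z : measurableTypeR R * X n => (f (tuple_cons (z.1, z.2)))%:E)).
    by apply/measurable_EFinP; exact: measurable_cons_pair.
  by move=> z; rewrite lee_fin.
have F0 v : (0 <= F v)%E by apply: integral_ge0 => t _; rewrite lee_fin.
rewrite -/(F) [LHS](ge0_integral_affine y c0 mF F0).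
rewrite exprS EFinM -muleA; congr (_ * _)%E.
pose G (v : R) := (\int[lam n]_t (f (taff (tuple_cons (y, u)) c (tuple_cons (v, t))))%:E)%E.
have mG : measurable_fun setT G.
  apply: (@measurable_fun_fubini_tonelli_F _ _ _ _ _ (lam n)
    (fun z : measurableTypeR R * X n =>
      (f (taff (tuple_cons (y, u)) c (tuple_cons (z.1, z.2))))%:E)).
    by apply/measurable_EFinP; exact: (measurable_cons_pair mft).
  by move=> z; rewrite lee_fin.
have G0 v : setT v -> (0 <= G v)%E.
  by move=> _; apply: integral_ge0 => t _; rewrite lee_fin.
rewrite -(@ge0_integralZl_EFin _ _ R leb _ measurableT G G0 mG)//.
apply: eq_integral => v _; rewrite /F (IH u)//; last first.
  exact: (@measurable_section1 _ _ _ _ _ (fun x t => f (tuple_cons (x, t))) _ (measurable_cons_pair mf)).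
by congr (_ * _)%E; apply: eq_integral => t _; rewrite taff_cons.
Qed.

End tuple_integrals.

Section fourier_heat.
Context {R : realType} {n : nat}.
Local Notation X := (n.-tuple (measurableTypeR R)).
Local Notation lam := (lebesgue_tuple R n).
Implicit Types (u : X -> R) (x y z xi : X).

Definition origin : X := [tuple (0 : R) | i < n].

Lemma tnth_origin i : tnth origin i = 0.
Proof. by rewrite tnth_mktuple. Qed.

Lemma Rintegral_taff x (c : R) (f : X -> R) : c != 0 ->
  lam.-integrable setT (EFin \o f) ->
  \int[lam]_t f t = `|c| ^+ n * \int[lam]_t f (taff x c t).
Proof.
move=> c0 fi; apply: (@Rintegral_change _ _ _ lam (taff x c)) => //.
- exact: measurable_taff1.
- by rewrite exprn_gt0// normr_gt0.
- by move=> g mg g0; exact: ge0_integral_taff.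
Qed.

Lemma integrable_taff x (c : R) (f : X -> R) : c != 0 ->
  lam.-integrable setT (EFin \o f) ->
  lam.-integrable setT (EFin \o (fun t => f (taff x c t))).
Proof.
move=> c0; apply: (@integrable_change _ _ _ lam (taff x c) (`|c| ^+ n)).
- exact: measurable_taff1.
- by rewrite exprn_gt0// normr_gt0.
- by move=> g mg g0; exact: ge0_integral_taff.
Qed.

Lemma Rintegral_translate_tuple x (f : X -> R) :
  lam.-integrable setT (EFin \o f) ->
  \int[lam]_t f t = \int[lam]_t f (taff x 1 t).
Proof.
by move=> fi; rewrite [LHS](Rintegral_taff x (@oner_neq0 R) fi) normr1 expr1n mul1r.
Qed.

Lemma ge0_integral_translate x (f : X -> R) :
  measurable_fun setT f -> (forall t, 0 <= f t) ->
  (\int[lam]_t (f (taff t 1 x))%:E = \int[lam]_t (f t)%:E)%E.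
Proof.
move=> mf f0; rewrite [RHS](ge0_integral_taff x (@oner_neq0 R))// normr1 expr1n mul1e.
apply: eq_integral => t _; congr (f _)%:E; apply: eq_from_tnth => i.
by rewrite !tnth_taff !mul1r addrC.
Qed.

Definition dil (r : R) xi : X := taff origin r xi.

Lemma tnth_dil r xi i : tnth (dil r xi) i = r * tnth xi i.
Proof. by rewrite tnth_taff tnth_origin add0r. Qed.

Lemma dot_originl xi : dot origin xi = 0.
Proof. by rewrite /dot big1// => i _; rewrite tnth_origin mul0r. Qed.

Lemma dot_dill r x y : dot (dil r x) y = r * dot x y.
Proof.
by rewrite dot_taffl dot_originl add0r.
Qed.

Lemma dot_dil r x : dot (dil r x) (dil r x) = r ^+ 2 * dot x x.
Proof. by rewrite dot_dill dotC dot_dill mulrA. Qed.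

Lemma gauss_dil r x : gauss (dil r x) = expR (- (pi * (r ^+ 2 * dot x x))).
Proof. by rewrite /gauss dot_dil. Qed.

Lemma gauss_dilN r x : gauss (dil (- r) x) = gauss (dil r x).
Proof. by rewrite !gauss_dil sqrrN. Qed.

Lemma measurable_dil d (T : measurableType d) (r : T -> R) (f : T -> X) :
  measurable_fun setT r -> measurable_fun setT f ->
  measurable_fun setT (fun w => dil (r w) (f w)).
Proof. by move=> mr mf; apply: measurable_taff. Qed.

Lemma gauss_fourier_dil (a r : R) (w : X) : 0 < r ->
  r ^+ n * \int[lam]_xi (gauss (dil r xi) * cos (a + 2 * pi * dot w xi)) =
  cos a * gauss (dil r^-1 w).
Proof.
move=> r0; rewrite -gauss_fourier.
rewrite [RHS](Rintegral_taff origin (lt0r_neq0 r0)); last first.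
  apply: dominated_integrable (integrable_gauss n).
    apply: measurable_funM; first exact: (@measurable_gauss R _ _ _ id (@measurable_id _ _ setT)).
    apply: measurable_cos; apply: measurable_funD => //; apply: measurable_funM => //.
    by apply: measurable_dot.
  by move=> z; rewrite normrM ger0_norm ?gauss_ge0// ler_piMr ?gauss_ge0// cos_max.
rewrite gtr0_norm//; congr (_ * _); apply: eq_Rintegral => xi _.
by rewrite -/(dil r xi) dot_dill [dot xi _]dotC dot_dill mulVKf ?lt0r_neq0.
Qed.

(** The cosine transform of [u] centred at [x], with a phase [a]; for [a = 0]
    it is the real part of the Fourier transform times [exp (2 i pi x . xi)]. *)
Definition ctrans u (a : R) x xi : R :=
  \int[lam]_y (u y * cos (a + 2 * pi * dot (taff x (-1) y) xi)).

(** The Gaussian average of [u] at scale [r], that is the heat semigroup at a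
    time proportional to [r ^ 2]. *)
Definition heat (r : R) u x : R := \int[lam]_z (gauss z * u (taff x (- r) z)).

(** What is used of a test function; the decay in [xi] comes from smoothness
    and absorbs the symbol, which grows at most like [1 + |xi| ^ 2]. *)
Record tame (rho : R) u : Prop := Tame {
  tame_measurable : measurable_fun setT u ;
  tame_bound : exists2 B, 0 <= B & forall y, `|u y| <= B * majorant y ;
  tame_support : forall y, u y != 0 -> forall i, `|tnth y i| <= rho ;
  tame_continuous : forall x z, u (taff x (- k.+1%:R^-1) z) @[k --> \oo] --> u x ;
  tame_decay : exists2 D, 0 <= D & forall a x xi,
    `|ctrans u a x xi| * (1 + dot xi xi) <= D * majorant xi }.

Section tame_theory.
Variables (rho : R) (u : X -> R).
Hypothesis ut : tame rho u.
Let mu := tame_measurable ut.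

Lemma tame_integrable : lam.-integrable setT (EFin \o u).
Proof.
have [B B0 uB] := tame_bound ut.
by apply: (dominated_integrable mu uB); apply: integrableZ; exact: integrable_majorant.
Qed.

Lemma tame_norm_integrable : lam.-integrable setT (EFin \o (fun y => `|u y|)).
Proof. exact: integrable_norm tame_integrable. Qed.

Lemma measurable_phase d (T : measurableType d) (a : T -> R) (f g h : T -> X) :
  measurable_fun setT a -> measurable_fun setT f -> measurable_fun setT g ->
  measurable_fun setT h ->
  measurable_fun setT (fun w => cos (a w + 2 * pi * dot (taff (f w) (-1) (g w)) (h w))).
Proof.
move=> ma mf mg mh; apply: measurable_cos; apply: measurable_funD => //.
apply: measurable_funM => //; apply: measurable_dot => //.
by apply: measurable_taff.
Qed.

Lemma measurable_ctrans a :
  measurable_fun setT (fun w : X * X => ctrans u a w.1 w.2).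
Proof.
apply: (@measurable_fun_Rintegral _ _ _ _ _ lam (fun (w : X * X) y =>
  u y * cos (a + 2 * pi * dot (taff w.1 (-1) y) w.2))) => /=.
apply: measurable_funM; first exact: (measurableT_comp mu).
by apply: measurable_phase => //; exact: (measurableT_comp (f := fst) (g := fst)) || exact: (measurableT_comp (f := snd) (g := fst)).
Qed.

Lemma ctrans_decay : exists2 D, 0 <= D & forall a x xi,
  `|ctrans u a x xi| <= D * majorant xi.
Proof.
have [D D0 uD] := tame_decay ut; exists D => // a x xi.
by apply: le_trans (uD a x xi); rewrite ler_peMr// lerDl dot_ge0.
Qed.

Lemma integrable_ctrans a x : lam.-integrable setT (EFin \o ctrans u a x).
Proof.
have [D D0 uD] := ctrans_decay.
apply: (dominated_integrable _ (uD a x)).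
  exact: measurable_section1 (measurable_ctrans a).
by apply: integrableZ; exact: integrable_majorant.
Qed.

(** The rescaled Gaussian is the Fourier transform of the averaging kernel, by
    [gauss_fourier_dil]; the integrals in [y] and [xi] are exchanged. *)
Lemma heat_ctrans r x : 0 < r ->
  heat r u x = \int[lam]_xi (gauss (dil r xi) * ctrans u 0 x xi).
Proof.
move=> r0.
have rn0 : r ^+ n != 0 by rewrite expf_neq0 ?lt0r_neq0.
have ig : lam.-integrable setT (EFin \o (fun xi => gauss (dil r xi))).
  by apply: (@integrable_taff origin r (@gauss R n)); rewrite ?lt0r_neq0//; exact: integrable_gauss.
apply: (mulfI rn0).
have -> : \int[lam]_xi (gauss (dil r xi) * ctrans u 0 x xi) =
    \int[lam]_xi \int[lam]_y (gauss (dil r xi) *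
      (u y * cos (0 + 2 * pi * dot (taff x (-1) y) xi))).
  apply: eq_Rintegral => xi _; rewrite RintegralZl//.
  apply: dominated_integrable tame_norm_integrable.
    apply: measurable_funM => //; apply: measurable_phase => //.
  by move=> y; rewrite normrM ler_piMr ?cos_max.
rewrite (@Rintegral_fubini_dom _ _ _ _ _ _ _ _ (fun xi => gauss (dil r xi)) (fun y => `|u y|))//; first last.
- exact: tame_norm_integrable.
- by move=> xi; rewrite gauss_ge0.
- move=> xi y; rewrite normrM ger0_norm ?gauss_ge0// ler_wpM2l ?gauss_ge0//.
  by rewrite normrM ler_piMr ?cos_max.
- apply: measurable_funM.
    by apply: measurable_gauss; apply: measurable_dil.
  apply: measurable_funM; first exact: (measurableT_comp mu).
  by apply: measurable_phase.
have iu : lam.-integrable setT (EFin \o (fun y => u y * gauss (dil r^-1 (taff x (-1) y)))).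
  apply: dominated_integrable tame_norm_integrable.
    apply: measurable_funM => //; apply: measurable_gauss.
    by apply: measurable_dil => //; exact: measurable_taff1.
  by move=> y; rewrite normrM ler_piMr// ger0_norm ?gauss_ge0 ?gauss_le1.
rewrite /heat.
have -> : r ^+ n * \int[lam]_y \int[lam]_xi (gauss (dil r xi) *
      (u y * cos (0 + 2 * pi * dot (taff x (-1) y) xi))) =
    \int[lam]_y (u y * gauss (dil r^-1 (taff x (-1) y))).
  rewrite (_ : \int[lam]_y _ = \int[lam]_y ((r ^+ n)^-1 *
      (u y * gauss (dil r^-1 (taff x (-1) y))))).
    by rewrite RintegralZl// mulrA divff// mul1r.
  apply: eq_Rintegral => y _.
  under eq_Rintegral => xi _ do rewrite mulrCA.
  rewrite RintegralZl//; last first.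
    apply: dominated_integrable ig.
      apply: measurable_funM; first by apply: measurable_gauss; apply: measurable_dil.
      by apply: measurable_phase.
    by move=> xi; rewrite normrM ger0_norm ?gauss_ge0// ler_piMr ?gauss_ge0 ?cos_max.
  have := gauss_fourier_dil 0 (taff x (-1) y) r0.
  rewrite cos0 mul1r => <-.
  by rewrite [RHS]mulrCA mulKf.
have nr0 : - r != 0 by rewrite oppr_eq0 lt0r_neq0.
rewrite [RHS](Rintegral_taff x nr0 iu) normrN gtr0_norm//.
congr (_ * _); apply: eq_Rintegral => z _; rewrite mulrC; congr (_ * gauss _).
apply: eq_from_tnth => i; rewrite tnth_dil !tnth_taff.
by field; rewrite lt0r_neq0.
Qed.

(** Letting the heat flow run for a short time on both sides of
    [heat_ctrans]; integrability of the transform is what makes the limit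
    pass under the integral. *)
Lemma ctrans_inversion x : u x = \int[lam]_xi ctrans u 0 x xi.
Proof.
pose r (k : nat) : R := k.+1%:R^-1.
have r0 k : 0 < r k by rewrite invr_gt0.
have [B B0 uB] := tame_bound ut.
have mg : measurable_fun setT (@gauss R n).
  exact: (@measurable_gauss R _ _ _ id (@measurable_id _ _ setT)).
have l1 : heat (r k) u x @[k --> \oo] --> u x.
  have -> : u x = \int[lam]_z (gauss z * u x).
    under eq_Rintegral do rewrite mulrC.
    by rewrite RintegralZl ?Rintegral_gauss ?mulr1//; exact: integrable_gauss.
  apply: (@Rintegral_cvg _ _ _ lam _ _ (fun z => B * gauss z)).
  - move=> k; apply: measurable_funM => //.
    by apply: (measurableT_comp mu); exact: measurable_taff1.
  - exact: measurable_funM.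
  - by move=> z; apply: cvgMr; exact: (tame_continuous ut).
  - move=> k z; rewrite normrM ger0_norm ?gauss_ge0// mulrC ler_wpM2r ?gauss_ge0//.
    by rewrite (le_trans (uB _))// ler_piMr// majorant_le1.
  - by apply: integrableZ; exact: integrable_gauss.
have l2 : heat (r k) u x @[k --> \oo] --> \int[lam]_xi ctrans u 0 x xi.
  under eq_fun do rewrite heat_ctrans//.
  have [D D0 uD] := ctrans_decay.
  apply: (@Rintegral_cvg _ _ _ lam _ _ (fun z => D * majorant z)).
  - move=> k; apply: measurable_funM.
      by apply: (measurableT_comp mg); exact: measurable_taff1.
    exact: measurable_section1 (measurable_ctrans 0).
  - exact: measurable_section1 (measurable_ctrans 0).
  - move=> xi.
    have c0 : r k @[k --> \oo] --> (0 : R) by exact: cvg_harmonic.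
    have c1 : r k * r k * dot xi xi @[k --> \oo] --> (0 : R).
      rewrite (_ : (0 : R) = 0 * 0 * dot xi xi); last by rewrite !mul0r.
      exact: cvgM (cvgM c0 c0) (cvg_cst (dot xi xi)).
    have c2 : expR (- (pi * (r k * r k * dot xi xi))) @[k --> \oo] --> (1 : R).
      have cE : {for (0 : R), continuous (fun a : R => expR (- (pi * a)))}.
        apply: (continuous_comp (f := fun a => - (pi * a))).
          by apply: cvgN; apply: cvgMr; exact: cvg_id.
        exact: continuous_expR.
      have := cvg_comp _ _ c1 cE.
      by rewrite mulr0 oppr0 expR0.
    under eq_fun do rewrite gauss_dil expr2.
    have := cvgM c2 (cvg_cst (ctrans u 0 x xi)); rewrite mul1r; exact.
  - move=> k xi; apply: le_trans (uD 0 x xi).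
    by rewrite normrM ler_piMl// ger0_norm ?gauss_ge0// gauss_le1.
  - by apply: integrableZ; exact: integrable_majorant.
exact: (cvg_unique _ l1 l2).
Qed.

(** The heat flow acts on every plane wave by a scalar. *)
Lemma heat_plane_wave r a x xi :
  \int[lam]_z (gauss z * ctrans u a (taff x (- r) z) xi) =
  gauss (dil r xi) * ctrans u a x xi.
Proof.
have phaseE z y : dot (taff (taff x (- r) z) (-1) y) xi =
    dot (taff x (-1) y) xi + dot z (dil (- r) xi).
  by rewrite [dot z _]dotC dot_dill !dot_taffl [dot xi z]dotC; ring.
have mz : measurable_fun setT (fun w : X * X => gauss w.1 *
    (u w.2 * cos (a + 2 * pi * dot (taff (taff x (- r) w.1) (-1) w.2) xi))).
  apply: measurable_funM; first exact: measurable_gauss.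
  apply: measurable_funM; first exact: (measurableT_comp mu).
  by apply: measurable_phase => //; apply: measurable_taff.
have -> : \int[lam]_z (gauss z * ctrans u a (taff x (- r) z) xi) =
    \int[lam]_z \int[lam]_y (gauss z *
    (u y * cos (a + 2 * pi * dot (taff (taff x (- r) z) (-1) y) xi))).
  apply: eq_Rintegral => z _; rewrite RintegralZl//.
  apply: dominated_integrable tame_norm_integrable.
    by apply: measurable_funM => //; apply: measurable_phase.
  by move=> y; rewrite normrM ler_piMr ?cos_max.
rewrite (@Rintegral_fubini_dom _ _ _ _ _ _ _ _ (@gauss R n) (fun y => `|u y|))//; first last.
- exact: tame_norm_integrable.
- exact: integrable_gauss.
- by move=> xi'; rewrite gauss_ge0.
- move=> z y; rewrite normrM ger0_norm ?gauss_ge0// ler_wpM2l ?gauss_ge0//.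
  by rewrite normrM ler_piMr ?cos_max.
rewrite -RintegralZl//; last first.
  apply: dominated_integrable tame_norm_integrable.
    by apply: measurable_funM => //; apply: measurable_phase.
  by move=> y; rewrite normrM ler_piMr ?cos_max.
apply: eq_Rintegral => y _.
under eq_Rintegral => z _ do rewrite phaseE mulrDr addrA mulrCA.
rewrite RintegralZl//; last first.
  apply: dominated_integrable (integrable_gauss n).
    apply: measurable_funM; first exact: (@measurable_gauss R _ _ _ id (@measurable_id _ _ setT)).
    apply: measurable_cos; apply: measurable_funD => //; apply: measurable_funM => //.
    by apply: measurable_dot.
  by move=> z; rewrite normrM ger0_norm ?gauss_ge0// ler_piMr ?gauss_ge0 ?cos_max.
by rewrite gauss_fourier gauss_dilN [RHS]mulrCA mulrC -mulrA mulrC [gauss _ * _]mulrC.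
Qed.

Section multiplier.
Variables (m : X -> R) (cm : R).
Hypothesis mm : measurable_fun setT m.
Hypothesis cm_ge0 : 0 <= cm.
Hypothesis m_ge0 : forall xi, 0 <= m xi.
Hypothesis m_le : forall xi, m xi <= cm * (1 + dot xi xi).

(** The Fourier multiplier with symbol [m], for an even [m]: then the inversion
    integral has no sine part. *)
Definition multiplier x : R := \int[lam]_xi (m xi * ctrans u 0 x xi).

Lemma multiplier_decay : exists2 D, 0 <= D & forall a x xi,
  `|m xi * ctrans u a x xi| <= D * majorant xi.
Proof.
have [D D0 uD] := tame_decay ut; exists (cm * D); first exact: mulr_ge0.
move=> a x xi; rewrite normrM ger0_norm// -mulrA.
apply: (@le_trans _ _ (cm * (1 + dot xi xi) * `|ctrans u a x xi|)).
  by rewrite ler_wpM2r.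
by rewrite -mulrA ler_wpM2l// mulrC.
Qed.

Lemma measurable_multiplier_integrand a :
  measurable_fun setT (fun w : X * X => m w.2 * ctrans u a w.1 w.2).
Proof.
apply: measurable_funM; first exact: (measurableT_comp mm).
exact: measurable_ctrans.
Qed.

Lemma integrable_multiplier a x :
  lam.-integrable setT (EFin \o (fun xi => m xi * ctrans u a x xi)).
Proof.
have [D D0 uD] := multiplier_decay.
apply: (dominated_integrable _ (uD a x)).
  exact: (@measurable_section1 _ _ _ _ _ (fun x xi => m xi * ctrans u a x xi) x
    (measurable_multiplier_integrand a)).
by apply: integrableZ; exact: integrable_majorant.
Qed.

Lemma measurable_multiplier : measurable_fun setT multiplier.
Proof.
apply: (@measurable_fun_Rintegral _ _ _ _ _ lam (fun x xi => m xi * ctrans u 0 x xi)).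
exact: measurable_multiplier_integrand.
Qed.

Lemma multiplier_bounded : exists2 B, 0 <= B & forall x, `|multiplier x| <= B.
Proof.
have [D D0 uD] := multiplier_decay.
exists (\int[lam]_xi (D * majorant xi)).
  by apply: Rintegral_ge0 => xi _; rewrite mulr_ge0 ?majorant_ge0.
move=> x; apply: norm_Rintegral_le => //.
  exact: integrable_measurable (integrable_multiplier 0 x).
by apply: integrableZ; exact: integrable_majorant.
Qed.

Lemma heat_multiplier r x :
  heat r multiplier x = \int[lam]_xi (gauss (dil r xi) * (m xi * ctrans u 0 x xi)).
Proof.
have [D D0 uD] := multiplier_decay.
have -> : heat r multiplier x = \int[lam]_z \int[lam]_xi (gauss z *
    (m xi * ctrans u 0 (taff x (- r) z) xi)).
  apply: eq_Rintegral => z _; rewrite RintegralZl//; exact: integrable_multiplier.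
rewrite (@Rintegral_fubini_dom _ _ _ _ _ _ _ _ (@gauss R n) (fun xi => D * majorant xi))//; first last.
- by apply: integrableZ; exact: integrable_majorant.
- exact: integrable_gauss.
- by move=> y; rewrite mulr_ge0 ?majorant_ge0.
- by move=> y; rewrite gauss_ge0.
- by move=> z xi; rewrite normrM ger0_norm ?gauss_ge0// ler_wpM2l ?gauss_ge0.
- apply: measurable_funM; first exact: measurable_gauss.
  apply: (measurableT_comp (measurable_multiplier_integrand 0)
    (g := fun w : X * X => (taff x (- r) w.1, w.2))).
  by apply: measurable_fun_pair => //; apply: measurable_taff.
apply: eq_Rintegral => xi _.
under eq_Rintegral do rewrite mulrCA.
rewrite RintegralZl//; last first.
  have [D' D'0 uD'] := ctrans_decay.
  apply: (@dominated_integrable _ _ _ _ _ (fun z => D' * gauss z)).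
  - apply: measurable_funM; first exact: (@measurable_gauss R _ _ _ id (@measurable_id _ _ setT)).
    apply: (measurableT_comp (measurable_ctrans 0)
      (g := fun z : X => (taff x (- r) z, xi))).
    by apply: measurable_fun_pair => //; exact: measurable_taff1.
  - move=> z; rewrite normrM ger0_norm ?gauss_ge0// mulrC ler_wpM2r ?gauss_ge0//.
    by rewrite (le_trans (uD' _ _ _))// ler_piMr// majorant_le1.
  - by apply: integrableZ; exact: integrable_gauss.
by rewrite heat_plane_wave mulrCA.
Qed.

End multiplier.
End tame_theory.
End fourier_heat.

(** * Subordination to the heat flow *)

Section exponential_weights.
Context {R : realType}.
Local Notation leb := (@lebesgue_measure R).

Lemma integrable_exp_abs (a : R) : 0 < a ->
  leb.-integrable setT (EFin \o (fun t => expR (- (a * `|t|)))).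
Proof.
move=> a0.
apply: (@dominated_integrable _ _ R leb _ (fun t => (1 + 2 / a ^+ 2) * (1 + t ^+ 2)^-1)).
- apply: continuous_measurable_fun => t; apply: (continuous_comp (f := fun t : R => - (a * `|t|))).
    by apply: cvgN; apply: cvgMr; exact: norm_continuous.
  exact: continuous_expR.
- move=> t; rewrite ger0_norm ?expR_ge0//.
  have d0 : 0 < 1 + t ^+ 2 by rewrite ltr_pwDl// sqr_ge0.
  rewrite ler_pdivlMr// expRN mulrC ler_pdivrMr ?expR_gt0//.
  have a20 : 0 < a ^+ 2 by rewrite exprn_gt0.
  set e := expR _.
  have e1 : 1 <= e by rewrite -expR0 ler_expR mulr_ge0// ltW.
  have e2 : (a * `|t|) ^+ 2 / 2 <= e.
    apply: le_trans (expR_ge1Dxn 1 _); last by rewrite mulr_ge0// ltW.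
    by rewrite lerDr.
  have -> : t ^+ 2 = 2 / a ^+ 2 * ((a * `|t|) ^+ 2 / 2).
    by rewrite exprMn real_normK ?num_real//; field; rewrite gt_eqF.
  by rewrite [leRHS]mulrDl mul1r lerD// ler_wpM2l ?divr_ge0 ?(ltW a20).
- exact: (@integrableZ _ _ R leb _ (fun t => (1 + t ^+ 2)^-1) integrable_oneDsqrV).
Qed.

Lemma integrable_weight (a : R) (w : R -> R) (C : R) : 0 < a ->
  measurable_fun setT w -> (forall t, `|w t| <= C * expR (- (a * `|t|))) ->
  leb.-integrable setT (EFin \o w).
Proof.
move=> a0 mw wC; apply: (@dominated_integrable _ _ R leb _ _ mw wC).
exact: (@integrableZ _ _ R leb _ (fun t => expR (- (a * `|t|))) (integrable_exp_abs a0)).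
Qed.

Lemma Rintegral_gt0_on01 (w : R -> R) (c : R) : 0 < c ->
  leb.-integrable setT (EFin \o w) -> (forall t, 0 <= w t) ->
  (forall t, 0 <= t <= 1 -> c <= w t) -> 0 < \int[leb]_t w t.
Proof.
move=> c0 iw w0 wc.
have iI : leb.-integrable setT (EFin \o \1_(`[(0 : R), 1]%classic : set R)).
  exact: integrable_indic_itv.
apply: (@lt_le_trans _ _ (\int[leb]_t (c * \1_(`[(0 : R), 1]%classic) t))).
  rewrite RintegralZl//.
  rewrite /Rintegral integral_indic// setIT.
  have := @lebesgue_measure_itv R `[0, 1]; rewrite /= lte_fin ltr01 => ->.
  by rewrite -EFinB/= subr0 mulr1.
apply: le_Rintegral => //; first exact: integrableZ.
move=> t _; rewrite indicE; case: (boolP (_ \in _)) => [|_]; last by rewrite mulr0.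
by rewrite inE/= in_itv/= mulr1 => /wc.
Qed.

Lemma Rintegral_translate (b : R) (w : R -> R) : leb.-integrable setT (EFin \o w) ->
  leb.-integrable setT (EFin \o (fun t => w (b + 1 * t))) /\
  \int[leb]_t w (b + 1 * t) = \int[leb]_t w t.
Proof.
move=> iw.
have mphi : measurable_fun setT (fun t : R => b + 1 * t).
  by apply: measurable_funD => //; exact: measurable_funM.
have phiE (g : R -> R) : measurable_fun setT g -> (forall t, 0 <= g t) ->
    (\int[leb]_t (g t)%:E = 1%:E * \int[leb]_t (g (b + 1 * t))%:E)%E.
  by move=> mg g0; rewrite (ge0_integral_affine_EFin b (@oner_neq0 R))// normr1.
split; first exact: (@integrable_change _ _ _ leb _ 1 mphi).
by rewrite [RHS](@Rintegral_change _ _ _ leb (fun t => b + 1 * t) 1)// mul1r.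
Qed.

Variable s : R.
Hypotheses (s_gt0 : 0 < s) (s_lt1 : s < 1).

(** With [t = ln r], the weights [r ^ (- s) min(1, r ^ 2)] and
    [r ^ s min(1, 1 / r)] decay at this exponential rate at both ends. *)
Definition rate : R := Num.min s (1 - s).

Lemma rate_gt0 : 0 < rate.
Proof. by rewrite lt_min s_gt0 subr_gt0. Qed.

Lemma weight_low (t : R) :
  expR (- s * t) * Num.min 1 (expR (2 * t)) <= expR (- (rate * `|t|)).
Proof.
have r1 : rate <= s by rewrite ge_min lexx.
have r2 : rate <= 1 - s by rewrite ge_min lexx orbT.
have [t0|t0] := leP 0 t.
  rewrite ger0_norm// (@le_trans _ _ (expR (- s * t)))//.
    by rewrite ler_piMr ?expR_ge0// ge_min lexx.
  by rewrite ler_expR mulNr lerN2 ler_wpM2r.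
rewrite ltr0_norm// (@le_trans _ _ (expR (- s * t) * expR (2 * t)))//.
  by rewrite ler_wpM2l ?expR_ge0// ge_min lexx orbT.
rewrite -expRD ler_expR mulrN opprK -mulrDl.
by rewrite ler_nM2r//; lra.
Qed.

Lemma weight_high (t : R) :
  expR (s * t) * Num.min 1 (expR (- t)) <= expR (- (rate * `|t|)).
Proof.
have r1 : rate <= s by rewrite ge_min lexx.
have r2 : rate <= 1 - s by rewrite ge_min lexx orbT.
have [t0|t0] := leP 0 t.
  rewrite ger0_norm// (@le_trans _ _ (expR (s * t) * expR (- t)))//.
    by rewrite ler_wpM2l ?expR_ge0// ge_min lexx orbT.
  rewrite -expRD ler_expR; nra.
rewrite ltr0_norm// (@le_trans _ _ (expR (s * t)))//.
  by rewrite ler_piMr ?expR_ge0// ge_min lexx.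
rewrite ler_expR mulrN opprK; nra.
Qed.

Lemma one_sub_expRN_le (y : R) : 0 <= y -> 1 - expR (- (pi * y)) <= pi * Num.min 1 y.
Proof.
move=> y0; have p1 := pi_ge2 R.
have := expR_ge1Dx (- (pi * y)); have := expR_gt0 (- (pi * y)).
by rewrite minEle; case: ifP => _; lra.
Qed.

Lemma expRN_le (y : R) : 0 < y -> expR (- (pi * y ^+ 2)) <= Num.min 1 (y^-1).
Proof.
move=> y0; rewrite le_min; apply/andP; split.
  by rewrite -expR0 ler_expR oppr_le0 mulr_ge0 ?pi_ge0 ?sqr_ge0.
rewrite expRN lef_pV2 ?posrE ?expR_gt0//.
apply: le_trans (expR_ge1Dx _).
have : 2 * y ^+ 2 <= pi * y ^+ 2 by rewrite ler_wpM2r ?sqr_ge0 ?pi_ge2.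
have := sqr_ge0 (y - 1); rewrite !expr2; nra.
Qed.

(** With [r = exp t] these are [r ^ (- s) (1 - exp (- pi r ^ 2))] and
    [r ^ s exp (- pi r ^ 2)], to be integrated against [dr / r]. *)
Definition low_kernel (t : R) : R :=
  expR (- s * t) * (1 - expR (- (pi * expR (2 * t)))).

Definition high_kernel (t : R) : R :=
  expR (s * t) * expR (- (pi * expR (2 * t))).

Lemma expR2M (t : R) : expR (2 * t) = expR t ^+ 2.
Proof. by rewrite expRM_natl. Qed.

Lemma low_kernel_ge0 t : 0 <= low_kernel t.
Proof.
rewrite mulr_ge0 ?expR_ge0// subr_ge0 -expR0 ler_expR oppr_le0.
by rewrite mulr_ge0 ?pi_ge0 ?expR_ge0.
Qed.

Lemma high_kernel_ge0 t : 0 <= high_kernel t.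
Proof. by rewrite mulr_ge0 ?expR_ge0. Qed.

Let mexp (c : R) : measurable_fun setT (fun t : R => expR (c * t)).
Proof. by apply: measurableT_comp => //; exact: measurable_funM. Qed.

Let mexpexp : measurable_fun setT (fun t : R => expR (- (pi * expR (2 * t)))).
Proof.
apply: (measurableT_comp (f := fun a : R => expR (- (pi * a)))) (mexp 2).
apply: continuous_measurable_fun => a; apply: (continuous_comp (f := fun a => - (pi * a))).
  by apply: cvgN; apply: cvgMr; exact: cvg_id.
exact: continuous_expR.
Qed.

Lemma integrable_low_kernel : leb.-integrable setT (EFin \o low_kernel).
Proof.
apply: (integrable_weight (C := pi) rate_gt0).
  by apply: measurable_funM => //; exact: measurable_funB.
move=> t; rewrite ger0_norm ?low_kernel_ge0//.
apply: (@le_trans _ _ (pi * (expR (- s * t) * Num.min 1 (expR (2 * t))))).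
  by rewrite mulrCA ler_wpM2l ?expR_ge0// one_sub_expRN_le// expR_ge0.
by rewrite ler_wpM2l ?pi_ge0// weight_low.
Qed.

Lemma integrable_high_kernel : leb.-integrable setT (EFin \o high_kernel).
Proof.
apply: (integrable_weight (C := 1) rate_gt0).
  exact: measurable_funM.
move=> t; rewrite mul1r ger0_norm ?high_kernel_ge0//.
apply: le_trans (weight_high t).
by rewrite ler_wpM2l ?expR_ge0// expR2M (expRN t) expRN_le ?expR_gt0.
Qed.

Definition low_const : R := \int[leb]_t low_kernel t.
Definition high_const : R := \int[leb]_t high_kernel t.

Lemma low_const_gt0 : 0 < low_const.
Proof.
apply: (@Rintegral_gt0_on01 _ (expR (- s) * (1 - expR (- pi)))).
- by rewrite mulr_gt0 ?expR_gt0// subr_gt0 -expR0 ltr_expR oppr_lt0 pi_gt0.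
- exact: integrable_low_kernel.
- exact: low_kernel_ge0.
- move=> t /andP[t0 t1]; apply: ler_pM.
  + exact: expR_ge0.
  + by rewrite subr_ge0 -expR0 ler_expR oppr_le0 pi_ge0.
  + by rewrite ler_expR mulNr lerN2 ler_piMr// ltW.
  + rewrite lerD2l lerN2 ler_expR lerN2 -[leLHS]mulr1 ler_wpM2l ?pi_ge0//.
    by rewrite -expR0 ler_expR mulr_ge0.
Qed.

Lemma high_const_gt0 : 0 < high_const.
Proof.
apply: (@Rintegral_gt0_on01 _ (expR (- (pi * expR 2)))).
- exact: expR_gt0.
- exact: integrable_high_kernel.
- exact: high_kernel_ge0.
- move=> t /andP[t0 t1]; rewrite -[leLHS]mul1r; apply: ler_pM => //.
  + by rewrite -expR0 ler_expR mulr_ge0// ltW.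
  + rewrite ler_expR lerN2 ler_wpM2l ?pi_ge0// ler_expR; lra.
Qed.

End exponential_weights.

Section subordination.
Context {R : realType} {n : nat}.
Local Notation X := (n.+1.-tuple (measurableTypeR R)).
Local Notation lam := (lebesgue_tuple R n.+1).
Local Notation leb := (@lebesgue_measure R).
Variables (s c : R).
Hypotheses (s_gt0 : 0 < s) (s_lt1 : s < 1) (c_gt0 : 0 < c).
Implicit Types (x z xi : X) (t : R).

Definition symbol xi : R := c * dot xi xi `^ (s / 2).

Lemma symbol_ge0 xi : 0 <= symbol xi.
Proof. by rewrite mulr_ge0 ?powR_ge0// ltW. Qed.

Lemma symbol_le xi : symbol xi <= c * (1 + dot xi xi).
Proof.
rewrite ler_wpM2l ?(ltW c_gt0)//; set q := dot xi xi.
have q0 : 0 <= q by exact: dot_ge0.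
have [q1|q1] := leP q 1.
  have : q `^ (s / 2) <= 1 `^ (s / 2) by apply: ge0_ler_powR; rewrite ?nnegrE ?divr_ge0 ?(ltW s_gt0).
  by rewrite powR1; move: (q `^ _) => v; lra.
have : q `^ (s / 2) <= q.
  apply: ler1_powR; first exact: ltW.
  by rewrite ler_pdivrMr// mul1r (le_trans (ltW s_lt1))// ler1n.
move: (q `^ _) => v; lra.
Qed.

Lemma measurable_symbol : measurable_fun setT symbol.
Proof.
apply: measurable_funM => //.
apply: (measurableT_comp (f := fun a : R => a `^ (s / 2))).
  exact: measurable_powR.
by apply: measurable_dot.
Qed.

Lemma gauss_dil_expR t xi : 0 < dot xi xi ->
  gauss (dil (expR t) xi) =
  expR (- (pi * expR (2 * (ln (dot xi xi) / 2 + 1 * t)))).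
Proof.
move=> q0; rewrite gauss_dil mul1r.
rewrite (_ : 2 * (_ + t) = ln (dot xi xi) + 2 * t); last by field.
by rewrite expRD expR2M lnK// [_ * expR t ^+ 2]mulrC.
Qed.

Lemma dot_expR_ln xi (a : R) : 0 < dot xi xi ->
  expR (a * (ln (dot xi xi) / 2)) = dot xi xi `^ (a / 2).
Proof. by move=> q0; rewrite /powR gt_eqF//; congr expR; field. Qed.

(** The kernels of the heat flow at the frequency [xi].  On the logarithmic
    scale replacing [r] by [r |xi|] is a translation by
    [ln |xi| = ln (dot xi xi) / 2], which produces the powers of [|xi|]. *)
Definition low_wave xi t : R := expR (- s * t) * (1 - gauss (dil (expR t) xi)).
Definition high_wave xi t : R := expR (s * t) * gauss (dil (expR t) xi).

Lemma low_waveE xi t : 0 < dot xi xi ->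
  low_wave xi t = dot xi xi `^ (s / 2) * low_kernel s (ln (dot xi xi) / 2 + 1 * t).
Proof.
move=> q0; rewrite /low_wave /low_kernel gauss_dil_expR// mulrA; congr (_ * _).
rewrite -dot_expR_ln// -expRD; congr expR; ring.
Qed.

Lemma high_waveE xi t : 0 < dot xi xi ->
  dot xi xi `^ (s / 2) * high_wave xi t = high_kernel s (ln (dot xi xi) / 2 + 1 * t).
Proof.
move=> q0; rewrite /high_wave /high_kernel gauss_dil_expR// mulrA; congr (_ * _).
rewrite -dot_expR_ln// -expRD; congr expR; ring.
Qed.

Lemma low_wave_null xi t : dot xi xi = 0 -> low_wave xi t = 0.
Proof. by move=> q0; rewrite /low_wave gauss_dil q0 !mulr0 oppr0 expR0 subrr mulr0. Qed.

Lemma dot_eq0_or_gt0 xi : dot xi xi = 0 \/ 0 < dot xi xi.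
Proof.
case: (eqVneq (dot xi xi) 0) => [|q0]; [by left|right].
by rewrite lt_neqAle eq_sym q0 dot_ge0.
Qed.

Lemma integral_low_wave xi : leb.-integrable setT (EFin \o low_wave xi) /\
  \int[leb]_t low_wave xi t = dot xi xi `^ (s / 2) * low_const s.
Proof.
case: (dot_eq0_or_gt0 xi) => q0.
  rewrite (_ : low_wave xi = cst 0); last by apply/funext => t; rewrite low_wave_null.
  split; first by exact: integrable0.
  by rewrite q0 powR0 ?mul0r ?Rintegral_cst ?mul0r// gt_eqF// divr_gt0.
have -> : low_wave xi = fun t => dot xi xi `^ (s / 2) *
    low_kernel s (ln (dot xi xi) / 2 + 1 * t).
  by apply/funext => t; exact: low_waveE.
have [it e] := Rintegral_translate (ln (dot xi xi) / 2) (integrable_low_kernel s_gt0 s_lt1).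
split; first exact: (@integrableZ _ _ R leb _ _ it).
by rewrite (RintegralZl _ measurableT it) e.
Qed.

Lemma integral_high_wave xi : 0 < dot xi xi ->
  leb.-integrable setT (EFin \o (fun t => symbol xi * high_wave xi t)) /\
  \int[leb]_t (symbol xi * high_wave xi t) = c * high_const s.
Proof.
move=> q0.
have -> : (fun t => symbol xi * high_wave xi t) = fun t => c *
    high_kernel s (ln (dot xi xi) / 2 + 1 * t).
  by apply/funext => t; rewrite -high_waveE// mulrA.
have [it e] := Rintegral_translate (ln (dot xi xi) / 2) (integrable_high_kernel s_gt0 s_lt1).
split; first exact: (@integrableZ _ _ R leb _ _ it).
by rewrite (RintegralZl _ measurableT it) e.
Qed.

Lemma low_wave_ge0 xi t : 0 <= low_wave xi t.
Proof. by rewrite mulr_ge0 ?expR_ge0// subr_ge0 gauss_le1. Qed.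

Lemma high_wave_ge0 xi t : 0 <= high_wave xi t.
Proof. by rewrite mulr_ge0 ?expR_ge0 ?gauss_ge0. Qed.

Lemma measurable_expZ (a : R) d (T : measurableType d) (f : T -> R) :
  measurable_fun setT f -> measurable_fun setT (fun w => expR (a * f w)).
Proof.
move=> mf; apply: (measurableT_comp (f := fun b : R => expR (a * b))) mf.
by apply: measurableT_comp => //; exact: measurable_funM.
Qed.

Lemma measurable_gauss_wave :
  measurable_fun setT (fun w : X * measurableTypeR R => gauss (dil (expR w.2) w.1)).
Proof.
apply: measurable_gauss; apply: measurable_dil => //.
exact: measurableT_comp.
Qed.

Lemma measurable_low_wave :
  measurable_fun setT (fun w : X * measurableTypeR R => low_wave w.1 w.2).
Proof.
apply: measurable_funM; first exact: measurable_expZ.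
by apply: measurable_funB => //; exact: measurable_gauss_wave.
Qed.

Lemma measurable_high_wave :
  measurable_fun setT (fun w : X * measurableTypeR R => high_wave w.1 w.2).
Proof.
apply: measurable_funM; first exact: measurable_expZ.
exact: measurable_gauss_wave.
Qed.

(** [integral_high_wave] holds off the origin, hence almost everywhere. *)
Lemma negligible_dot_eq0 : lam.-negligible [set xi | ~ 0 < dot xi xi].
Proof.
exists [set xi : X | tnth xi ord0 = 0 :> R]; split.
- rewrite (_ : mkset _ = (fun xi : X => tnth xi ord0) @^-1` [set (0 : R)]); last first.
    by apply/seteqP; split.
  by rewrite -[X in measurable X]setTI; apply: measurable_tnth.
- rewrite /= /lebesgue_step /pushforward.
  rewrite (_ : _ @^-1` _ = [set (0 : R)] `*` setT); last first.
    apply/seteqP; split => -[y v] /=; first by rewrite tnth_cons0.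
    by move=> [-> _]; rewrite tnth_cons0.
  by rewrite product_measure1E//= lebesgue_measure_set1 mul0e.
- move=> xi /= /negP; rewrite -leNgt => q0.
  have := le_trans (sqr_tnth_le xi ord0) q0.
  by move=> h; apply/eqP; rewrite -sqrf_eq0 eq_le h sqr_ge0.
Qed.

Variables (rho : R) (u : X -> R).
Hypothesis ut : tame rho u.

Local Notation Tu := (multiplier u symbol).

(** [|xi| ^ s] is a superposition of [1 - exp (- pi r ^ 2 |xi| ^ 2)] with the
    weight [r ^ (- s) dr / r]; transformed back, the image of [u] is the same
    superposition of [u - heat r u]. *)
Lemma low_representation x :
  low_const s * Tu x = c * \int[leb]_t (expR (- s * t) * (u x - heat (expR t) u x)).
Proof.
have ic := integrable_ctrans ut 0 x.
have mc := integrable_measurable ic.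
have im := integrable_multiplier ut measurable_symbol (ltW c_gt0) symbol_ge0 symbol_le 0 x.
have mw : measurable_fun setT (fun w : X * measurableTypeR R =>
    low_wave w.1 w.2 * ctrans u 0 x w.1).
  by apply: measurable_funM; [exact: measurable_low_wave|exact: (measurableT_comp mc)].
have sec t : lam.-integrable setT (EFin \o (fun xi => low_wave xi t * ctrans u 0 x xi)).
  apply: (@dominated_integrable _ _ _ _ _ (fun xi => expR (- s * t) * `|ctrans u 0 x xi|)).
  - exact: (@measurable_section2 _ _ _ _ _ (fun xi t => low_wave xi t * ctrans u 0 x xi) t mw).
  - move=> xi; rewrite normrM ger0_norm ?low_wave_ge0// ler_wpM2r//.
    by rewrite /low_wave ler_piMr ?expR_ge0// gerBl gauss_ge0.
  - by apply: integrableZ; exact: integrable_norm.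
rewrite /multiplier -RintegralZl//.
have -> : \int[lam]_xi (low_const s * (symbol xi * ctrans u 0 x xi)) =
    c * \int[lam]_xi \int[leb]_t (low_wave xi t * ctrans u 0 x xi).
  have e xi : \int[leb]_t (low_wave xi t * ctrans u 0 x xi) =
      c^-1 * low_const s * (symbol xi * ctrans u 0 x xi).
    have [il el] := integral_low_wave xi.
    by rewrite RintegralZr// el /symbol; field; rewrite gt_eqF.
  rewrite -RintegralZl//; last first.
    rewrite (_ : (fun xi => _) = fun xi => c^-1 * low_const s * (symbol xi * ctrans u 0 x xi)).
      exact: integrableZ.
    by apply/funext => xi; exact: e.
  by apply: eq_Rintegral => xi _; rewrite e; field; rewrite gt_eqF.
congr (_ * _).
rewrite (Rintegral_fubini (m1 := lam) (m2 := leb) (f := fun xi t => low_wave xi t * ctrans u 0 x xi) _ _ _ _).2//; last 2 first.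
- move=> xi; have [il _] := integral_low_wave xi.
  rewrite (_ : (fun t => _) = fun t => ctrans u 0 x xi * low_wave xi t).
    exact: (@integrableZ _ _ R leb _ _ il).
  by apply/funext => t; rewrite mulrC.
- rewrite (_ : (\int[lam]_xi _)%E = (\int[lam]_xi ((c^-1 * low_const s) * `|symbol xi * ctrans u 0 x xi|)%:E)%E).
    by rewrite integral_Rintegral ?ltry//; apply: integrableZ; exact: integrable_norm.
  apply: eq_integral => xi _; have [il el] := integral_low_wave xi.
  under eq_integral => t _ do rewrite normrM mulrC.
  rewrite ge0_integralZ//; last exact: measurableT_comp (integrable_measurable il).
  under eq_integral => t _ do rewrite ger0_norm ?low_wave_ge0//.
  rewrite integral_Rintegral// el -EFinM normrM (ger0_norm (symbol_ge0 _)) /symbol.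
  by congr EFin; field; rewrite gt_eqF.
apply: eq_Rintegral => t _.
under eq_Rintegral => xi _ do rewrite /low_wave -mulrA mulrBl mul1r.
have ig : lam.-integrable setT (EFin \o (fun xi => gauss (dil (expR t) xi) * ctrans u 0 x xi)).
  apply: dominated_integrable (integrable_norm ic).
    apply: measurable_funM => //; apply: measurable_gauss.
    by apply: measurable_dil.
  by move=> xi; rewrite /= normrM ger0_norm ?gauss_ge0// ler_piMl ?gauss_le1.
rewrite RintegralZl//; last exact: integrable_sub.
by rewrite RintegralB// -(ctrans_inversion ut) -(heat_ctrans ut) ?expR_gt0.
Qed.

(** Inverting the symbol: for [xi] different from [0] the product of [|xi| ^ s]
    with [r ^ s exp (- pi r ^ 2 |xi| ^ 2)], integrated against [dr / r], is a
    constant; transformed back, [u] is a superposition of the heat flow of its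
    image. *)
Lemma high_representation x :
  leb.-integrable setT (EFin \o (fun t => expR (s * t) * heat (expR t) Tu x)) /\
  c * high_const s * u x = \int[leb]_t (expR (s * t) * heat (expR t) Tu x).
Proof.
have ic := integrable_ctrans ut 0 x.
have mc := integrable_measurable ic.
have im := integrable_multiplier ut measurable_symbol (ltW c_gt0) symbol_ge0 symbol_le 0 x.
pose f xi t := symbol xi * high_wave xi t * ctrans u 0 x xi.
have mf : measurable_fun setT (fun w : X * measurableTypeR R => f w.1 w.2).
  apply: measurable_funM; last exact: (measurableT_comp mc).
  apply: measurable_funM; last exact: measurable_high_wave.
  exact: (measurableT_comp measurable_symbol).
have f0 xi t : dot xi xi = 0 -> f xi t = 0.
  by move=> q0; rewrite /f /symbol q0 powR0 ?mulr0 ?mul0r// gt_eqF// divr_gt0.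
have sec t : lam.-integrable setT (EFin \o f ^~ t).
  apply: (@dominated_integrable _ _ _ _ _ (fun xi => expR (s * t) * `|symbol xi * ctrans u 0 x xi|)).
  - exact: (measurable_section2 t mf).
  - move=> xi; rewrite /f -mulrA mulrCA normrM ger0_norm ?high_wave_ge0// ler_wpM2r//.
    by rewrite /high_wave ler_piMr ?expR_ge0// gauss_le1.
  - by apply: integrableZ; exact: integrable_norm.
have secxi xi : leb.-integrable setT (EFin \o f xi).
  have [q0|q0] := dot_eq0_or_gt0 xi.
    rewrite (_ : f xi = cst 0); first by exact: integrable0.
    by apply/funext => t; rewrite f0.
  have [ih _] := integral_high_wave q0.
  rewrite (_ : f xi = fun t => ctrans u 0 x xi * (symbol xi * high_wave xi t)).
    exact: (@integrableZ _ _ R leb _ _ ih).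
  by apply/funext => t; rewrite mulrC.
have e xi : 0 < dot xi xi -> \int[leb]_t f xi t = c * high_const s * ctrans u 0 x xi.
  by move=> q0; have [ih eh] := integral_high_wave q0; rewrite RintegralZr// eh.
have foo : (\int[lam]_xi \int[leb]_t `|f xi t|%:E < +oo)%E.
  have hc := high_const_gt0 s_gt0 s_lt1.
  apply: (@le_lt_trans _ _ (\int[lam]_xi ((c * high_const s) * `|ctrans u 0 x xi|)%:E)%E).
    apply: ge0_le_integral => //.
    + by move=> xi _; apply: integral_ge0 => t _; rewrite lee_fin.
    + apply: (measurable_fun_fubini_tonelli_F (fun z : X * measurableTypeR R => `|f z.1 z.2|%:E)) => //.
      by apply/measurable_EFinP; exact: measurableT_comp.
    + by apply/measurable_EFinP; apply: measurable_funM => //; exact: measurableT_comp.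
    + move=> xi _; have [q0|q0] := dot_eq0_or_gt0 xi.
        under eq_integral do rewrite f0// normr0.
        by rewrite integral0 lee_fin mulr_ge0// mulr_ge0 ?ltW.
      have [ih eh] := integral_high_wave q0.
      have p0 t : 0 <= symbol xi * high_wave xi t.
        by rewrite mulr_ge0 ?symbol_ge0 ?high_wave_ge0.
      under eq_integral => t _ do rewrite /f normrM mulrC (ger0_norm (p0 t)).
      rewrite (ge0_integralZ leb (integrable_measurable ih) p0)//.
      by rewrite integral_Rintegral// eh -EFinM mulrC.
  by rewrite integral_Rintegral ?ltry//; apply: integrableZ; exact: integrable_norm.
have [iG eG] := Rintegral_fubini mf secxi sec foo.
have -> : (fun t => expR (s * t) * heat (expR t) Tu x) = fun t => \int[lam]_xi f xi t.
  apply/funext => t.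
  rewrite (heat_multiplier ut measurable_symbol (ltW c_gt0) symbol_ge0 symbol_le).
  rewrite -RintegralZl//; last first.
    apply: dominated_integrable (integrable_norm im).
      apply: measurable_funM; last exact: integrable_measurable im.
      by apply: measurable_gauss; apply: measurable_dil.
    by move=> xi; rewrite /= normrM ger0_norm ?gauss_ge0// ler_piMl ?gauss_le1.
  by apply: eq_Rintegral => xi _; rewrite /f /high_wave; ring.
split => //; rewrite -eG {1}(ctrans_inversion ut x) -RintegralZl//.
have mF : measurable_fun setT (fun xi => \int[leb]_t f xi t).
  exact: measurable_fun_Rintegral.
rewrite -[LHS]/(fine _) -[RHS]/(fine _); congr fine; apply: ae_eq_integral => //.
- by apply/measurable_EFinP; exact: measurable_funM.
- exact/measurable_EFinP.
- move: negligible_dot_eq0; apply: negligibleS => xi /= h q0.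
  by apply: h => _; rewrite e.
Qed.

End subordination.

(** * The two estimates *)

Section boxes.
Context {R : realType} {n : nat}.
Local Notation X := (n.-tuple (measurableTypeR R)).
Local Notation lam := (lebesgue_tuple R n).

Definition inbox (rho : R) (x : X) : bool := [forall i, `|tnth x i| <= rho].

Lemma inbox_prod rho x : (inbox rho x)%:R = \prod_(i < n) ((`|tnth x i : R| <= rho)%R : bool)%:R :> R.
Proof.
rewrite /inbox; case: forallP => [h|/forallP].
  by rewrite big1// => i _; rewrite h.
by rewrite negb_forall => /existsP[i /negbTE h]; rewrite (bigD1 i)//= h mul0r.
Qed.

Lemma measurable_inbox rho : measurable_fun setT (fun x : X => (inbox rho x)%:R : R).
Proof.
under eq_fun do rewrite inbox_prod.
apply: measurable_prod => i _.
have mf : measurable_fun setT (fun a : R => ((`|a| <= rho)%R : bool)%:R : R).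
  rewrite (_ : (fun _ => _) = \1_(`[- rho, rho]%classic : set R)).
    exact: measurable_indic.
  apply/funext => a; rewrite indicE; congr (_%:R); congr nat_of_bool.
  apply/idP/idP; first by rewrite ler_norml inE/= in_itv.
  by rewrite inE/= in_itv/= ler_norml.
exact: (measurableT_comp mf (measurable_tnth i)).
Qed.

Lemma inbox_le_majorant rho x : (inbox rho x)%:R <= (1 + rho ^+ 2) ^+ n * majorant x.
Proof.
rewrite inbox_prod /majorant -[X in X * _](_ : \prod_(i < n) (1 + rho ^+ 2) = _); last first.
  by rewrite prodr_const card_ord.
rewrite -big_split; apply: ler_prod => i _ /=; rewrite ler0n/=.
have d0 : 0 < 1 + tnth x i ^+ 2 :> R by rewrite ltr_pwDl// sqr_ge0.
rewrite ler_pdivlMr//; case: (leP `|tnth x i : R| rho) => h /=.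
  rewrite mulr1n mul1r lerD2l -(real_normK (num_real (tnth x i))) lerXn2r ?nnegrE//.
  exact: le_trans h.
by rewrite mulr0n mul0r addr_ge0// sqr_ge0.
Qed.

Lemma integrable_inbox rho : lam.-integrable setT (EFin \o (fun x => (inbox rho x)%:R : R)).
Proof.
apply: (@dominated_integrable _ _ _ _ _ (fun x => (1 + rho ^+ 2) ^+ n * majorant x)).
- exact: measurable_inbox.
- by move=> x; rewrite ger0_norm// inbox_le_majorant.
- by apply: integrableZ; exact: integrable_majorant.
Qed.

End boxes.

Section gauss_translation.
Context {R : realType} {n : nat}.
Local Notation X := (n.-tuple (measurableTypeR R)).
Local Notation lam := (lebesgue_tuple R n).

(** From [exp (- A) - exp (- B) <= (B - A) * exp (- A)]: the exponent changes
    by a factor of order [b], and the polynomial loss is absorbed by the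
    Gaussian. *)
Lemma gauss_translate_le (a : X) (b : R) (z : X) : 0 < b ->
  `|gauss z - gauss (taff z b a)| <=
  Num.min 1 b * (pi * (1 + 2 * dot a a)) * (majorant z + majorant (taff z b a)).
Proof.
move=> b0; set z' := taff z b a; set q := dot a a.
have q0 : 0 <= q by exact: dot_ge0.
have p2 := pi_ge2 R.
have E0 := majorant_ge0 z; have E0' := majorant_ge0 z'.
have K1 : 1 <= pi * (1 + 2 * q) by nra.
rewrite [Num.min 1 b]minEle; case: ifP => b1.
  apply: (@le_trans _ _ (majorant z + majorant z')).
    rewrite (le_trans (ler_normB _ _))//.
    by rewrite !ger0_norm ?gauss_ge0// lerD// gauss_le_majorant1.
  by rewrite mul1r ler_peMl// addr_ge0.
have {}b1 : b < 1 by rewrite ltNge b1.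
have main (y y' : X) : `|dot y y - dot y' y'| <= b * (dot y y + 2 * q) ->
    gauss y - gauss y' <= b * (pi * (1 + 2 * q)) * majorant y.
  move=> h; have gy := gauss_le_majorant y; have g0 := gauss_ge0 y.
  have s0 := dot_ge0 y.
  have step : gauss y - gauss y' <= gauss y * (pi * (dot y' y' - dot y y)).
    have -> : gauss y' = gauss y * expR (- (pi * (dot y' y' - dot y y))).
      by rewrite /gauss -expRD; congr expR; ring.
    rewrite -[X in X - _]mulr1 -mulrBr ler_wpM2l//.
    by have := expR_ge1Dx (- (pi * (dot y' y' - dot y y))); lra.
  apply: (le_trans step).
  have h' : dot y' y' - dot y y <= b * (dot y y + 2 * q).
    by apply: le_trans h; rewrite distrC ler_norm.
  have h2 : dot y y + 2 * q <= (1 + 2 * q) * (1 + dot y y) by nra.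
  apply: (@le_trans _ _ (gauss y * (pi * (b * ((1 + 2 * q) * (1 + dot y y)))))).
    rewrite ler_wpM2l// ler_wpM2l ?pi_ge0// (le_trans h')//.
    by rewrite ler_wpM2l// ltW.
  rewrite (_ : gauss y * _ = b * (pi * (1 + 2 * q)) * (gauss y * (1 + dot y y))); last by ring.
  by rewrite ler_wpM2l// !mulr_ge0 ?pi_ge0 ?(ltW b0)//; lra.
have zz : dot z' z' = dot z z + 2 * b * dot z a + b ^+ 2 * q.
  by rewrite /z' dot_taffl !dot_taffr [dot a z]dotC /q; ring.
have za : dot z' a = dot z a + b * q by rewrite /z' dot_taffl.
clearbody z'.
(* 2 |z . a| <= |z| ^ 2 + |a| ^ 2, at both end points *)
have cs1 : 0 <= dot z z + q + 2 * dot z a.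
  have := dot_ge0 (taff z 1 a); rewrite dot_taffl !dot_taffr [dot a z]dotC -/q; lra.
have cs2 : 0 <= dot z z + q - 2 * dot z a.
  have := dot_ge0 (taff z (-1) a); rewrite dot_taffl !dot_taffr [dot a z]dotC -/q; lra.
have cs1' : 0 <= dot z' z' + q + 2 * dot z' a.
  have := dot_ge0 (taff z' 1 a); rewrite dot_taffl !dot_taffr [dot a z']dotC -/q; lra.
have cs2' : 0 <= dot z' z' + q - 2 * dot z' a.
  have := dot_ge0 (taff z' (-1) a); rewrite dot_taffl !dot_taffr [dot a z']dotC -/q; lra.
have b0' := ltW b0.
have f1 := mulr_ge0 b0' cs1; have f2 := mulr_ge0 b0' cs2.
have f3 := mulr_ge0 b0' cs1'; have f4 := mulr_ge0 b0' cs2'.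
have f5 : 0 <= b * q * (1 - b) by rewrite !mulr_ge0// subr_ge0 ltW.
have f6 : 0 <= b ^+ 2 * q by rewrite mulr_ge0// sqr_ge0.
rewrite mulrDr ler_norml; apply/andP; split.
  have : gauss z' - gauss z <= b * (pi * (1 + 2 * q)) * majorant z'.
    by apply: main; rewrite ler_norml zz; apply/andP; split; move: f1 f2 f3 f4 f5 f6; rewrite ?zz za; lra.
  have : 0 <= b * (pi * (1 + 2 * q)) * majorant z by rewrite !mulr_ge0 ?pi_ge0 ?(ltW b0)//; lra.
  lra.
have : gauss z - gauss z' <= b * (pi * (1 + 2 * q)) * majorant z.
  by apply: main; rewrite ler_norml zz; apply/andP; split; move: f1 f2 f3 f4 f5 f6; rewrite ?zz za; lra.
have : 0 <= b * (pi * (1 + 2 * q)) * majorant z' by rewrite !mulr_ge0 ?pi_ge0 ?(ltW b0)//; lra.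
lra.
Qed.

(** The two majorants have the same integral, by translation invariance. *)
Lemma integral_gauss_translate_le (a : X) (b : R) : 0 < b ->
  (\int[lam]_z (`|gauss z - gauss (taff z b a)|)%:E <=
   (Num.min 1 b * (pi * (1 + 2 * dot a a) * (2 * \int[lam]_z majorant z)))%:E)%E.
Proof.
move=> b0.
have mE : measurable_fun setT (@majorant R n).
  exact: (@measurable_majorant R _ _ n id (@measurable_id _ _ setT)).
have mg : measurable_fun setT (@gauss R n).
  exact: (@measurable_gauss R _ _ n id (@measurable_id _ _ setT)).
have mt : measurable_fun setT (fun z : X => taff z b a) by apply: measurable_taff.
have mgt : measurable_fun setT (fun z => gauss (taff z b a)) := measurableT_comp mg mt.
have mEt : measurable_fun setT (fun z => majorant (taff z b a)) := measurableT_comp mE mt.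
have k0 : 0 <= Num.min 1 b * (pi * (1 + 2 * dot a a)).
  rewrite mulr_ge0 ?le_min ?ler01 ?(ltW b0)// mulr_ge0 ?pi_ge0//.
  by rewrite addr_ge0// mulr_ge0// dot_ge0.
apply: (@le_trans _ _ (\int[lam]_z ((Num.min 1 b * (pi * (1 + 2 * dot a a))) *
    (majorant z + majorant (taff z b a)))%:E)%E).
  apply: ge0_le_integral_EFin => //.
  - by apply: measurableT_comp => //; exact: measurable_funB.
  - by apply: measurable_funM => //; exact: measurable_funD.
  - by move=> z; exact: gauss_translate_le.
have E0 z : 0 <= majorant z + majorant (taff z b a) by rewrite addr_ge0 ?majorant_ge0.
rewrite (ge0_integralZ lam _ E0 k0); last exact: measurable_funD.
rewrite ge0_integral_EFinD//; last 2 first.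
- exact: majorant_ge0.
- by move=> z; exact: majorant_ge0.
have -> : (\int[lam]_z (majorant (taff z b a))%:E = \int[lam]_z (majorant z)%:E)%E.
  rewrite -(ge0_integral_translate (dil b a) mE (@majorant_ge0 R n)).
  apply: eq_integral => z _; congr (majorant _)%:E; apply: eq_from_tnth => i.
  by rewrite !tnth_taff tnth_origin add0r mul1r.
rewrite integral_Rintegral; last exact: integrable_majorant.
rewrite -EFinD -EFinM lee_fin le_eqVlt; apply/orP; left; apply/eqP; ring.
Qed.

End gauss_translation.

Section superposition.
Context {R : realType} {n : nat}.
Local Notation X := (n.-tuple (measurableTypeR R)).
Local Notation lam := (lebesgue_tuple R n).
Local Notation leb := (@lebesgue_measure R).
Variables (K : R -> X -> R) (h : X -> R).
Hypothesis mK : measurable_fun setT (fun w : measurableTypeR R * X => K w.1 w.2).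
Hypothesis K0 : forall t z, 0 <= K t z.
Hypothesis mh : measurable_fun setT h.
Hypothesis h0 : forall x, 0 <= h x.

(** A superposition over the scales [exp t] of weighted averages of translates
    of [h]. *)
Definition superpose (x : X) : \bar R :=
  (\int[leb]_t \int[lam]_z (K t z * h (taff x (- expR t) z))%:E)%E.

Let mint : measurable_fun setT (fun w : (X * measurableTypeR R) * X =>
  K w.1.2 w.2 * h (taff w.1.1 (- expR w.1.2) w.2)).
Proof.
have m12 : measurable_fun setT (fun w : (X * measurableTypeR R) * X => w.1.2).
  exact: (measurableT_comp (f := snd) (g := fst)).
have m11 : measurable_fun setT (fun w : (X * measurableTypeR R) * X => w.1.1).
  exact: (measurableT_comp (f := fst) (g := fst)).
apply: measurable_funM.
  apply: (measurableT_comp mK (g := fun w : (X * measurableTypeR R) * X => (w.1.2, w.2))).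
  exact: measurable_fun_pair.
apply: (measurableT_comp mh); apply: measurable_taff => //.
by apply: measurableT_comp => //; apply: measurableT_comp.
Qed.

Let inner (x : X) (t : R) : \bar R :=
  (\int[lam]_z (K t z * h (taff x (- expR t) z))%:E)%E.

Let inner0 x t : (0 <= inner x t)%E.
Proof. by apply: integral_ge0 => z _; rewrite lee_fin mulr_ge0. Qed.

Let minner : measurable_fun setT (fun w : X * measurableTypeR R => inner w.1 w.2).
Proof.
apply: (@measurable_fun_fubini_tonelli_F _ _ _ _ _ lam (fun w : (X * measurableTypeR R) * X =>
  (K w.1.2 w.2 * h (taff w.1.1 (- expR w.1.2) w.2))%:E)).
  exact/measurable_EFinP.
by move=> w; rewrite lee_fin mulr_ge0.
Qed.

Lemma superpose_ge0 x : (0 <= superpose x)%E.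
Proof. by apply: integral_ge0 => t _; exact: inner0. Qed.

Lemma measurable_superpose_inner x : measurable_fun setT
  (fun t : R => (\int[lam]_z (K t z * h (taff x (- expR t) z))%:E)%E).
Proof.
exact: (measurableT_comp minner (measurable_pair1 x)).
Qed.

Lemma measurable_superpose : measurable_fun setT superpose.
Proof.
apply: (@measurable_fun_fubini_tonelli_F _ _ _ _ _ leb
  (fun w : X * measurableTypeR R => inner w.1 w.2)) => //.
Qed.

(** Superpositions of translates of [h] are integrated by Tonelli, the
    integral of [h] being invariant under translation. *)
Lemma integral_superpose :
  (\int[lam]_x superpose x =
   (\int[leb]_t \int[lam]_z (K t z)%:E) * \int[lam]_x (h x)%:E)%E.
Proof.
rewrite /superpose.
rewrite (@fubini_tonelli _ _ _ _ _ lam leb (fun w : X * measurableTypeR R => inner w.1 w.2))//.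
rewrite -ge0_integralZr//=; last 3 first.
- apply: (@measurable_fun_fubini_tonelli_F _ _ _ _ _ lam (fun w : measurableTypeR R * X => (K w.1 w.2)%:E)).
    exact/measurable_EFinP.
  by move=> w; rewrite lee_fin.
- by move=> t _; apply: integral_ge0 => z _; rewrite lee_fin.
- by apply: integral_ge0 => z _; rewrite lee_fin.
apply: eq_integral => t _; rewrite /inner.
rewrite (@tonelli _ _ _ _ _ lam lam (fun x z => K t z * h (taff x (- expR t) z))); last 2 first.
- apply: (measurableT_comp mint (g := fun w : X * X => ((w.1, t), w.2))).
  by apply: measurable_fun_pair => //; apply: measurable_fun_pair.
- by move=> x z; rewrite mulr_ge0.
have mKt : measurable_fun setT (K t) by exact: (measurable_section1 t mK).
rewrite -ge0_integralZr//=; last 3 first.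
- exact/measurable_EFinP.
- by move=> z _; rewrite lee_fin.
- by apply: integral_ge0 => z _; rewrite lee_fin.
apply: eq_integral => z _.
rewrite ge0_integralZ//; last first.
  by apply: (measurableT_comp mh); apply: measurable_taff.
congr (_ * _)%E; rewrite -(ge0_integral_translate (dil (- expR t) z) mh h0).
apply: eq_integral => x _; congr (h _)%:E; apply: eq_from_tnth => i.
by rewrite !tnth_taff tnth_origin add0r mul1r.
Qed.

End superposition.

Section multiplier_estimates.
Context {R : realType} {n : nat}.
Local Notation X := (n.+1.-tuple (measurableTypeR R)).
Local Notation lam := (lebesgue_tuple R n.+1).
Local Notation leb := (@lebesgue_measure R).
Variables (s c rho : R).
Hypotheses (s_gt0 : 0 < s) (s_lt1 : s < 1) (c_gt0 : 0 < c).
Implicit Types (x z : X) (t : R) (u : X -> R).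

Local Notation T u := (multiplier u (symbol s c)).

Let mT u : tame rho u -> measurable_fun setT (T u).
Proof.
by move=> ut; exact: (measurable_multiplier ut (measurable_symbol s c)).
Qed.

Let bT u : tame rho u -> exists2 B, 0 <= B & forall x, `|T u x| <= B.
Proof.
move=> ut; exact: (multiplier_bounded ut (measurable_symbol s c) (ltW c_gt0)
  (symbol_ge0 s c_gt0) (symbol_le s_gt0 s_lt1 c_gt0)).
Qed.

Let measurable_gaussX : measurable_fun setT (@gauss R n.+1).
Proof. exact: (@measurable_gauss R _ _ _ id (@measurable_id _ _ setT)). Qed.

Lemma measurable_heat u x : measurable_fun setT u ->
  measurable_fun setT (fun t : R => heat (expR t) u x).
Proof.
move=> mu; apply: (@measurable_fun_Rintegral _ _ (measurableTypeR R) _ _ lam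
  (fun t z => gauss z * u (taff x (- expR t) z))).
apply: measurable_funM; first exact: (measurableT_comp measurable_gaussX).
apply: (measurableT_comp mu); apply: measurable_taff => //.
by apply: measurableT_comp => //; apply: measurableT_comp.
Qed.

(** A majorant of [r ^ (- s) gauss z] on [1 <= r |z|], where
    [1 <= min(1, r ^ 2) (1 + |z| ^ 2)], that is integrable in [(t, z)]. *)
Definition tail_kernel t z : R :=
  expR (- s * t) * Num.min 1 (expR (2 * t)) * (gauss z * (1 + dot z z)).

Lemma tail_kernel_ge0 t z : 0 <= tail_kernel t z.
Proof.
by rewrite !mulr_ge0 ?expR_ge0 ?gauss_ge0 ?addr_ge0 ?dot_ge0.
Qed.

Lemma measurable_tail_kernel :
  measurable_fun setT (fun w : measurableTypeR R * X => tail_kernel w.1 w.2).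
Proof.
have m2 : measurable_fun setT (fun w : measurableTypeR R * X => w.2) by exact: measurable_snd.
apply: measurable_funM.
  apply: measurable_funM; first exact: measurable_expZ.
  by apply: measurable_minr => //; exact: measurable_expZ.
apply: measurable_funM; first exact: (measurableT_comp measurable_gaussX).
by apply: measurable_funD => //; apply: measurable_dot.
Qed.

Lemma integral_tail_kernel :
  exists2 A : R, 0 <= A & (\int[leb]_t \int[lam]_z (tail_kernel t z)%:E <= A%:E)%E.
Proof.
pose a t := expR (- (rate s * `|t|)).
exists ((\int[lam]_z majorant z) * (\int[leb]_t a t)).
  apply: mulr_ge0; apply: Rintegral_ge0 => z _; first exact: majorant_ge0.
  exact: expR_ge0.
apply: (@tonelli_le_prod _ _ _ _ _ leb lam tail_kernel a (@majorant R n.+1)).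
- exact: measurable_tail_kernel.
- exact: tail_kernel_ge0.
- move=> t z; apply: ler_pM.
  + by rewrite mulr_ge0 ?expR_ge0// le_min ler01 expR_ge0.
  + by rewrite mulr_ge0 ?gauss_ge0// addr_ge0 ?dot_ge0.
  + exact: weight_low.
  + exact: gauss_le_majorant.
- by move=> t; exact: expR_ge0.
- exact: majorant_ge0.
- exact: (integrable_exp_abs (rate_gt0 s_gt0 s_lt1)).
- exact: integrable_majorant.
Qed.

(** Away from the support only points at distance at least one contribute,
    which removes the singularity of the kernel. *)
Lemma multiplier_far_le u x : tame rho u -> ~~ inbox (rho + 1) x ->
  ((low_const s * `|T u x|)%:E <=
   c%:E * superpose tail_kernel (fun y => `|u y|%R) x)%E.
Proof.
move=> ut xout.
have mu := tame_measurable ut.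
have ux0 : u x = 0.
  apply/eqP; apply: contraNT xout => ux; apply/forallP => i.
  by rewrite (le_trans (tame_support ut ux i))// lerDl.
have := low_representation s_gt0 s_lt1 c_gt0 ut x.
have hc := low_const_gt0 s_gt0 s_lt1.
rewrite -{2}(gtr0_norm hc) -normrM => ->; rewrite normrM gtr0_norm// EFinM.
rewrite lee_pmul2l//.
under eq_Rintegral do rewrite ux0 sub0r mulrN.
have mE (a : R) : measurable_fun setT (fun t : R => expR (a * t)) by exact: measurable_expZ.
have mheat : measurable_fun setT (fun t : R => - (expR (- s * t) * heat (expR t) u x)).
  by apply: measurableT_comp => //; apply: measurable_funM => //; exact: measurable_heat.
apply: (le_trans (abse_Rintegral_le leb mheat)).
have mabs : measurable_fun setT (fun y => `|u y|) by exact: measurableT_comp.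
have mtaff t : measurable_fun setT (fun z : X => taff x (- expR t) z) by exact: measurable_taff1.
apply: ge0_le_integral => //.
- by apply/measurable_EFinP; exact: measurableT_comp.
- exact: (measurable_superpose_inner measurable_tail_kernel tail_kernel_ge0 mabs
    (fun y => normr_ge0 _)).
move=> t _; rewrite normrN normrM (ger0_norm (expR_ge0 _)) EFinM.
have mi : measurable_fun setT (fun z => gauss z * u (taff x (- expR t) z)).
  by apply: measurable_funM => //; exact: (measurableT_comp mu (mtaff t)).
apply: (@le_trans _ _ ((expR (- s * t))%:E *
    \int[lam]_z (`|gauss z * u (taff x (- expR t) z)|)%:E)%E).
  by rewrite lee_pmul2l ?lte_fin ?expR_gt0//; exact: abse_Rintegral_le.
rewrite -ge0_integralZ ?expR_ge0//; last exact: measurableT_comp.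
apply: ge0_le_integral_EFin.
- by apply: measurable_funM => //; exact: measurableT_comp.
- apply: measurable_funM; last exact: (measurableT_comp mabs (mtaff t)).
  exact: (measurable_section1 t measurable_tail_kernel).
- by move=> z; rewrite mulr_ge0 ?expR_ge0.
move=> z; rewrite normrM ger0_norm ?gauss_ge0// /tail_kernel/=.
have [->|uy0] := eqVneq (u (taff x (- expR t) z)) 0; first by rewrite normr0 !mulr0.
rewrite [leLHS]mulrA; apply: ler_wpM2r; first exact: normr_ge0.
rewrite -[leRHS]mulrA ler_wpM2l ?expR_ge0// [leRHS]mulrCA.
rewrite ler_peMr ?gauss_ge0//.
have d0 := dot_ge0 z.
(* [x - r z] lies in the support and [x] is at distance one from it, so
   1 <= r |z| *)
suff : 1 <= expR (2 * t) * dot z z.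
  by have := expR_gt0 (2 * t); rewrite minEle; case: ifP => _; nra.
have /forallPn[i xi] := xout; rewrite -ltNge in xi.
have := tame_support ut uy0 i; rewrite tnth_taff => yi.
have e0 := expR_gt0 t.
have : 1 <= expR t * `|tnth z i : R|.
  have e : (tnth x i : R) = (tnth x i + - expR t * tnth z i) + expR t * tnth z i.
    by ring.
  have := ler_normD (tnth x i + - expR t * tnth z i : R) (expR t * (tnth z i : R)).
  by rewrite -e normrM (gtr0_norm e0); lra.
move=> h; apply: (@le_trans _ _ ((expR t * `|tnth z i : R|) ^+ 2)).
  by rewrite -[leLHS](expr1n _ 2) lerXn2r ?nnegrE// (le_trans ler01).
rewrite exprMn real_normK ?num_real// expR2M ler_wpM2l ?sqr_ge0//.
exact: sqr_tnth_le.
Qed.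

Lemma multiplier_far_L1 : exists2 A : R, 0 <= A & forall u, tame rho u ->
  (\int[lam]_x ((~~ inbox (rho + 1) x)%:R * `|T u x|)%:E <=
   A%:E * \int[lam]_x (`|u x|)%:E)%E.
Proof.
have [A A0 hA] := integral_tail_kernel.
have hc := low_const_gt0 s_gt0 s_lt1.
exists ((low_const s)^-1 * (c * A)).
  by rewrite !mulr_ge0 ?invr_ge0 ?(ltW hc) ?(ltW c_gt0).
move=> u ut.
have mu := tame_measurable ut.
have mabs : measurable_fun setT (fun y => `|u y|) by exact: measurableT_comp.
have n0 (y : X) : 0 <= `|u y| by [].
have mS := measurable_superpose measurable_tail_kernel tail_kernel_ge0 mabs n0.
have S0 := superpose_ge0 tail_kernel_ge0 n0.
have mf : measurable_fun setT (fun x => (~~ inbox (rho + 1) x)%:R * `|T u x| : R).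
  apply: measurable_funM; last exact: (measurableT_comp _ (mT ut)).
  rewrite (_ : (fun _ => _) = fun x => 1 - (inbox (rho + 1) x)%:R : R).
    by apply: measurable_funB => //; exact: measurable_inbox.
  by apply/funext => x; case: inbox; rewrite /= ?subrr ?subr0.
have f0 x : 0 <= (~~ inbox (rho + 1) x)%:R * `|T u x| by rewrite mulr_ge0.
rewrite EFinM -muleA -lee_pdivrMl ?invr_gt0// invrK.
rewrite -(ge0_integralZ lam mf f0 (ltW hc)).
apply: (@le_trans _ _ (\int[lam]_x (c%:E * superpose tail_kernel (fun y => `|u y|%R) x))%E).
  apply: ge0_le_integral => //.
  - by move=> x _; rewrite lee_fin mulr_ge0// ltW.
  - by apply/measurable_EFinP; exact: measurable_funM.
  - exact: measurable_funeM.
  move=> x _; have [xin|xout] := boolP (inbox (rho + 1) x).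
    by rewrite mul0r mulr0 mule_ge0// lee_fin ltW.
  by rewrite mul1r; exact: multiplier_far_le.
rewrite ge0_integralZl//; last by rewrite lee_fin ltW.
rewrite EFinM -muleA lee_pmul2l//.
rewrite (integral_superpose measurable_tail_kernel tail_kernel_ge0 mabs n0).
by rewrite lee_wpmul2r// integral_ge0// => x _; rewrite lee_fin.
Qed.

(** Translation by this vector carries the box of half-width [rho] off itself. *)
Definition offset : X := [tuple if i == ord0 then 2 * rho + 1 else 0 | i < n.+1].

Definition translation_kernel t z : R :=
  expR (s * t) * `|gauss z - gauss (taff z (expR (- 1 * t)) offset)|.

Lemma translation_kernel_ge0 t z : 0 <= translation_kernel t z.
Proof. by rewrite mulr_ge0 ?expR_ge0. Qed.

Lemma measurable_translation_kernel :
  measurable_fun setT (fun w : measurableTypeR R * X => translation_kernel w.1 w.2).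
Proof.
have m2 : measurable_fun setT (fun w : measurableTypeR R * X => w.2) by exact: measurable_snd.
apply: measurable_funM; first exact: measurable_expZ.
apply: measurableT_comp => //; apply: measurable_funB.
  exact: (measurableT_comp measurable_gaussX).
apply: (measurableT_comp measurable_gaussX); apply: measurable_taff => //.
exact: measurable_expZ.
Qed.

(** The translation gains a factor [exp (- t)] for large [t]; the weight
    [exp (s * t)] remains integrable because [s < 1]. *)
Lemma integral_translation_kernel :
  exists2 A : R, 0 <= A & (\int[leb]_t \int[lam]_z (translation_kernel t z)%:E <= A%:E)%E.
Proof.
set B := pi * (1 + 2 * dot offset offset) * (2 * \int[lam]_z majorant z).
have B0 : 0 <= B.
  rewrite !mulr_ge0 ?pi_ge0 ?addr_ge0 ?mulr_ge0 ?dot_ge0//.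
  by apply: Rintegral_ge0 => z _; exact: majorant_ge0.
exists (B * \int[leb]_t expR (- (rate s * `|t|))).
  by apply: mulr_ge0 => //; apply: Rintegral_ge0 => t _; exact: expR_ge0.
have ie := integrable_exp_abs (rate_gt0 s_gt0 s_lt1).
have me := integrable_measurable ie.
rewrite EFinM -integral_Rintegral// -(ge0_integralZ leb me (fun t => expR_ge0 _) B0).
apply: ge0_le_integral => //.
- by move=> t _; apply: integral_ge0 => z _; rewrite lee_fin translation_kernel_ge0.
- apply: (@measurable_fun_fubini_tonelli_F _ _ _ _ _ lam
    (fun w : measurableTypeR R * X => (translation_kernel w.1 w.2)%:E)).
    by apply/measurable_EFinP; exact: measurable_translation_kernel.
  by move=> w; rewrite lee_fin translation_kernel_ge0.
- by apply/measurable_EFinP; exact: measurable_funM.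
move=> t _; rewrite ge0_integralZ ?expR_ge0//; last first.
  apply: measurableT_comp => //; apply: measurable_funB => //.
  by apply: (measurableT_comp measurable_gaussX); apply: measurable_taff.
apply: (@le_trans _ _ ((expR (s * t))%:E * (Num.min 1 (expR (-1 * t)) * B)%:E)%E).
  rewrite lee_pmul2l ?lte_fin ?expR_gt0//.
  by apply: integral_gauss_translate_le; exact: expR_gt0.
rewrite -EFinM lee_fin mulrA [leRHS]mulrC ler_wpM2r// mulN1r.
exact: weight_high.
Qed.

Lemma tame_offset u x : tame rho u -> inbox rho x -> u (taff x 1 offset) = 0.
Proof.
move=> ut /forallP/(_ ord0) xin; apply/eqP; apply: contraT => ux.
have := tame_support ut ux ord0; rewrite tnth_taff tnth_mktuple eqxx mul1r.
move: xin; rewrite !ler_norml => /andP[h1 h2] /andP[h3 h4]; lra.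
Qed.

(** The translation of the argument is moved onto the Gaussian by a change of
    variables, where it is divided by the scale. *)
Lemma heat_offset_le u t x : tame rho u ->
  (`|expR (s * t) * (heat (expR t) (T u) x - heat (expR t) (T u) (taff x 1 offset))|%:E <=
   \int[lam]_z (translation_kernel t z * `|T u (taff x (- expR t) z)|)%:E)%E.
Proof.
move=> ut; have [B B0 uB] := bT ut.
have mt r (y : X) : measurable_fun setT (fun z : X => taff y r z) by exact: measurable_taff1.
have mw y : measurable_fun setT (fun z => gauss z * T u (taff y (- expR t) z)).
  by apply: measurable_funM => //; exact: (measurableT_comp (mT ut) (mt _ _)).
have iw y : lam.-integrable setT (EFin \o (fun z => gauss z * T u (taff y (- expR t) z))).
  apply: (@dominated_integrable _ _ _ _ _ (fun z => B * gauss z)) => //.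
    by move=> z; rewrite normrM ger0_norm ?gauss_ge0// mulrC ler_wpM2r ?gauss_ge0.
  by apply: integrableZ; exact: integrable_gauss.
have e0 : expR t != 0 by rewrite gt_eqF// expR_gt0.
pose d := dil (expR (-1 * t)) offset.
pose w z := gauss z * T u (taff (taff x 1 offset) (- expR t) z).
have wE : (fun z => w (taff d 1 z)) =
    (fun z => gauss (taff z (expR (-1 * t)) offset) * T u (taff x (- expR t) z)).
  apply/funext => z; rewrite /w; congr (gauss _ * T u _); apply: eq_from_tnth => i.
    by rewrite !tnth_taff tnth_origin add0r mul1r addrC.
  rewrite !tnth_taff tnth_origin add0r !mul1r mulN1r expRN.
  by field.
have eh : heat (expR t) (T u) (taff x 1 offset) =
    \int[lam]_z (gauss (taff z (expR (-1 * t)) offset) * T u (taff x (- expR t) z)).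
  rewrite -wE; exact: (Rintegral_translate_tuple d (iw (taff x 1 offset))).
have is_ : lam.-integrable setT (EFin \o
    (fun z => gauss (taff z (expR (-1 * t)) offset) * T u (taff x (- expR t) z))).
  by rewrite -wE; exact: (integrable_taff d (@oner_neq0 R) (iw (taff x 1 offset))).
pose v z := gauss z * T u (taff x (- expR t) z) -
  gauss (taff z (expR (-1 * t)) offset) * T u (taff x (- expR t) z).
have ev : heat (expR t) (T u) x - heat (expR t) (T u) (taff x 1 offset) = \int[lam]_z v z.
  by rewrite eh; exact: (esym (RintegralB measurableT (iw x) is_)).
have iv : lam.-integrable setT (EFin \o v) by exact: (integrable_sub (iw x) is_).
rewrite ev -(RintegralZl _ measurableT iv).
have mv : measurable_fun setT (fun z => expR (s * t) * v z).
  exact: (measurable_funM (measurable_cst _) (integrable_measurable iv)).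
apply: (le_trans (abse_Rintegral_le lam mv)).
apply: ge0_le_integral_EFin.
- exact: (measurableT_comp (@normr_measurable R setT) mv).
- apply: measurable_funM; first exact: (measurable_section1 t measurable_translation_kernel).
  exact: (measurableT_comp (@normr_measurable R setT) (measurableT_comp (mT ut) (mt (- expR t) x))).
- by move=> z.
- by move=> z; rewrite /v -mulrBl !normrM (ger0_norm (expR_ge0 _)) mulrA.
Qed.

(** The function is recovered from differences of the heat flow of its image,
    since it vanishes at the shifted point. *)
Lemma tame_le_superpose u x : tame rho u -> inbox rho x ->
  ((c * high_const s * `|u x|)%:E <=
   superpose translation_kernel (fun y => `|T u y|%R) x)%E.
Proof.
move=> ut xin.
have hc := mulr_gt0 c_gt0 (high_const_gt0 s_gt0 s_lt1).
have [i1 e1] := high_representation s_gt0 s_lt1 c_gt0 ut x.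
have [i2 e2] := high_representation s_gt0 s_lt1 c_gt0 ut (taff x 1 offset).
have e : c * high_const s * u x = \int[leb]_t (expR (s * t) *
    (heat (expR t) (T u) x - heat (expR t) (T u) (taff x 1 offset))).
  rewrite (tame_offset ut xin) mulr0 in e2.
  refine (etrans e1 (etrans (esym (subr0 _)) (etrans (congr1 (fun v => _ - v) e2) _))).
  refine (etrans (esym (RintegralB measurableT i1 i2)) _).
  by apply: eq_Rintegral => t _; rewrite mulrBr.
rewrite -{1}(gtr0_norm hc) -normrM e.
have mh y : measurable_fun setT (fun t : R => heat (expR t) (T u) y).
  by apply: measurable_heat; exact: mT.
have mi : measurable_fun setT (fun t : R => expR (s * t) *
    (heat (expR t) (T u) x - heat (expR t) (T u) (taff x 1 offset))).
  apply: measurable_funM; first exact: measurable_expZ.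
  exact: measurable_funB.
apply: (le_trans (abse_Rintegral_le leb mi)).
apply: ge0_le_integral => //.
- by apply/measurable_EFinP; exact: measurableT_comp.
- apply: (measurable_superpose_inner measurable_translation_kernel translation_kernel_ge0 _
    (fun y => normr_ge0 _)).
  by apply: measurableT_comp => //; exact: mT.
by move=> t _; exact: heat_offset_le.
Qed.

End multiplier_estimates.

(** * The bound for the exponent one *)

(** At heights above [M] the power [p] dominates the first power. *)
Lemma le_add_powR (R : realType) (y M p : R) : 0 <= y -> 0 < M -> 1 <= p ->
  y <= M + M / M `^ p * y `^ p.
Proof.
move=> y0 M0 p1.
have k0 : 0 <= M / M `^ p * y `^ p.
  by rewrite mulr_ge0 ?powR_ge0// divr_ge0 ?powR_ge0// ltW.
have [yM|My] := leP y M; first by rewrite (le_trans yM)// lerDl.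
have b1 : 1 <= y / M by rewrite ler_pdivlMr// mul1r ltW.
have yb : y = M * (y / M) by rewrite mulrCA divff ?mulr1// gt_eqF.
rewrite {1}yb; apply: (@le_trans _ _ (M * (y / M) `^ p)).
  by rewrite ler_wpM2l ?(ltW M0)// le1r_powR.
rewrite powRM ?invr_ge0 ?(ltW M0)// -powR_inv1 ?(ltW M0)// -powRrM mulN1r powRN.
by rewrite [X in M * X]mulrC mulrA lerDr ltW.
Qed.

Section combination.
Context {R : realType} {n : nat}.
Local Notation X := (n.+1.-tuple (measurableTypeR R)).
Local Notation lam := (lebesgue_tuple R n.+1).
Local Notation leb := (@lebesgue_measure R).
Variables (s c rho p : R).
Hypotheses (s_gt0 : 0 < s) (s_lt1 : s < 1) (c_gt0 : 0 < c).
Hypothesis p_ge1 : 1 <= p.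

Local Notation T u := (multiplier u (symbol s c)).

Lemma superpose_affine (K : R -> X -> R) (h : X -> R) (M : R) x :
  measurable_fun setT (fun w : measurableTypeR R * X => K w.1 w.2) ->
  (forall t z, 0 <= K t z) -> measurable_fun setT h -> (forall y, 0 <= h y) ->
  0 <= M ->
  superpose K (fun y => M + h y) x =
  (M%:E * (\int[leb]_t \int[lam]_z (K t z)%:E) + superpose K h x)%E.
Proof.
move=> mK K0 mh h0 M0.
have mI : measurable_fun setT (fun t : R => (\int[lam]_z (K t z)%:E)%E).
  apply: (@measurable_fun_fubini_tonelli_F _ _ _ _ _ lam
    (fun w : measurableTypeR R * X => (K w.1 w.2)%:E)).
    exact/measurable_EFinP.
  by move=> w; rewrite lee_fin.
have I0 t : (0 <= \int[lam]_z (K t z)%:E)%E.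
  by apply: integral_ge0 => z _; rewrite lee_fin.
rewrite /superpose -ge0_integralZl//.
rewrite -ge0_integralD//.
- apply: eq_integral => t _.
  have mKt : measurable_fun setT (K t) by exact: (measurable_section1 t mK).
  have mht : measurable_fun setT (fun z => h (taff x (- expR t) z)).
    by apply: (measurableT_comp mh); exact: measurable_taff1.
  rewrite -(ge0_integralZ lam mKt (K0 t) M0) -ge0_integral_EFinD.
  + by apply: eq_integral => z _; rewrite mulrDr [K t z * M]mulrC.
  + exact: (measurable_funM (measurable_cst _) mKt).
  + exact: measurable_funM.
  + by move=> z; rewrite mulr_ge0.
  + by move=> z; rewrite mulr_ge0.
- by move=> t _; rewrite mule_ge0// lee_fin.
- exact: measurable_funeM.
- by move=> t _; apply: integral_ge0 => z _; rewrite lee_fin mulr_ge0.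
- exact: (measurable_superpose_inner mK K0 mh h0).
Qed.

Lemma superpose_le (K : R -> X -> R) (h1 h2 : X -> R) x :
  measurable_fun setT (fun w : measurableTypeR R * X => K w.1 w.2) ->
  (forall t z, 0 <= K t z) -> measurable_fun setT h1 -> (forall y, 0 <= h1 y) ->
  measurable_fun setT h2 -> (forall y, h1 y <= h2 y) ->
  (superpose K h1 x <= superpose K h2 x)%E.
Proof.
move=> mK K0 m1 h10 m2 h12.
have h20 y : 0 <= h2 y by exact: le_trans (h10 y) (h12 y).
apply: ge0_le_integral.
- by [].
- by move=> t _; apply: integral_ge0 => z _; rewrite lee_fin mulr_ge0.
- exact: (measurable_superpose_inner mK K0 m1 h10).
- exact: (measurable_superpose_inner mK K0 m2 h20).
move=> t _.
have mKt : measurable_fun setT (K t) by exact: (measurable_section1 t mK).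
have mt : measurable_fun setT (fun z : X => taff x (- expR t) z) by exact: measurable_taff1.
apply: ge0_le_integral_EFin.
- exact: (measurable_funM mKt (measurableT_comp m1 mt)).
- exact: (measurable_funM mKt (measurableT_comp m2 mt)).
- by move=> z; rewrite mulr_ge0.
- by move=> z; rewrite ler_wpM2l.
Qed.

(** By [le_add_powR] the image of [u] is at most [M + h] with [h] of integral at
    most [M].  Inserted in [tame_le_superpose] this bounds the [L^1] norm of [u]
    by a multiple of [M]: the constant [M] is integrated over the box only, and
    [h] over the whole space.  The [L^1] norm of the image follows, from
    [M + h] on the enlarged box and from [multiplier_far_L1] outside. *)
Lemma multiplier_L1_le : exists2 C : R, 0 <= C & forall (u : X -> R) (M : R),
  tame rho u -> 0 < M ->
  (\int[lam]_x (`|T u x| `^ p)%:E <= (M `^ p)%:E)%E ->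
  (\int[lam]_x (`|T u x|)%:E <= (C * M)%:E)%E.
Proof.
have hc := mulr_gt0 c_gt0 (high_const_gt0 s_gt0 s_lt1).
have [A A0 hA] := @integral_translation_kernel R n s rho s_gt0 s_lt1.
have [A' A'0 hA'] := @multiplier_far_L1 R n s c rho s_gt0 s_lt1 c_gt0.
pose J r := \int[lam]_x (inbox r x)%:R : R.
have J0 r : 0 <= J r by apply: Rintegral_ge0.
have JE r : (\int[lam]_x ((inbox r x)%:R)%:E)%E = (J r)%:E.
  by rewrite (integral_Rintegral (integrable_inbox r)).
pose C1 := (c * high_const s)^-1 * (A * (J rho + 1)).
have C10 : 0 <= C1 by rewrite !mulr_ge0 ?invr_ge0 ?(ltW hc)// addr_ge0.
exists (J (rho + 1) + 1 + A' * C1).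
  apply: addr_ge0; last exact: (mulr_ge0 A'0 C10).
  exact: (addr_ge0 (J0 _) ler01).
move=> u M ut M0 hM.
pose g x := `|T u x|.
have g0 x : 0 <= g x by exact: normr_ge0.
have mg : measurable_fun setT g.
  exact: (measurableT_comp (@normr_measurable R setT)
    (measurable_multiplier ut (measurable_symbol s c))).
have mu := tame_measurable ut.
have mau : measurable_fun setT (fun x => `|u x|).
  exact: (measurableT_comp (@normr_measurable R setT) mu).
pose k := M / M `^ p.
have k0 : 0 <= k by rewrite divr_ge0 ?powR_ge0// ltW.
have kM : k * M `^ p = M by rewrite /k divfK// gt_eqF// powR_gt0.
pose h x := k * g x `^ p.
have h0 x : 0 <= h x by rewrite mulr_ge0// powR_ge0.
have mgp : measurable_fun setT (fun x => g x `^ p).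
  exact: (measurableT_comp (measurable_powR p) mg).
have mh : measurable_fun setT h by exact: (measurable_funM (measurable_cst _) mgp).
have gh x : g x <= M + h x by exact: le_add_powR.
have ih : (\int[lam]_x (h x)%:E <= M%:E)%E.
  rewrite (ge0_integralZ lam mgp (fun x => powR_ge0 _ _) k0) -kM (EFinM k).
  by apply: lee_wpmul2l => //; rewrite lee_fin.
have mb r : measurable_fun setT (fun x : X => (inbox r x)%:R : R) by exact: measurable_inbox.
have iu : (\int[lam]_x (`|u x|)%:E <= (C1 * M)%:E)%E.
  rewrite /C1 -mulrA EFinM -lee_pdivrMl ?invr_gt0// invrK.
  rewrite -(ge0_integralZ lam mau (fun x => normr_ge0 _) (ltW hc)).
  pose W x := ((M * A * (inbox rho x)%:R)%:E + superpose (translation_kernel s rho) h x)%E.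
  have mfar := @measurable_translation_kernel R n s rho.
  have far0 := @translation_kernel_ge0 R n s rho.
  have mS := measurable_superpose mfar far0 mh h0.
  have S0 := superpose_ge0 far0 h0.
  have MA0 : 0 <= M * A by rewrite mulr_ge0// ltW.
  apply: (@le_trans _ _ (\int[lam]_x W x)%E).
    apply: ge0_le_integral.
    - by [].
    - by move=> x _; rewrite lee_fin mulr_ge0// ltW.
    - by apply/measurable_EFinP; exact: (measurable_funM (measurable_cst _) mau).
    - apply: emeasurable_funD => //; apply/measurable_EFinP.
      exact: (measurable_funM (measurable_cst _) (mb rho)).
    move=> x _; rewrite /W; have [xin|xout] := boolP (inbox rho x); last first.
      have -> : u x = 0.
        apply/eqP; apply: contraNT xout => ux; apply/forallP.
        exact: (tame_support ut ux).
      by rewrite normr0 !mulr0 add0e.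
    apply: (le_trans (tame_le_superpose s_gt0 s_lt1 c_gt0 ut xin)).
    apply: (@le_trans _ _ (superpose (translation_kernel s rho) (fun y => M + h y) x)).
      apply: superpose_le => //.
      exact: (measurable_funD (measurable_cst _) mh).
    rewrite superpose_affine// ?(ltW M0)// mulr1 EFinM leeD2r//.
    by apply: lee_wpmul2l => //; rewrite lee_fin ltW.
  rewrite ge0_integralD//; last 2 first.
  - by move=> x _; rewrite lee_fin mulr_ge0.
  - by apply/measurable_EFinP; exact: (measurable_funM (measurable_cst _) (mb rho)).
  rewrite (ge0_integralZ lam (mb rho) _ MA0)// JE (integral_superpose mfar far0 mh h0).
  apply: (@le_trans _ _ ((M * A * J rho)%:E + A%:E * M%:E)%E).
    rewrite EFinM leeD2l//; apply: lee_pmul => //.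
      by apply: integral_ge0 => t _; apply: integral_ge0 => z _; rewrite lee_fin.
    by apply: integral_ge0 => x _; rewrite lee_fin.
  rewrite -EFinM -EFinD lee_fin le_eqVlt; apply/orP; left; apply/eqP; ring.
have split_g : (\int[lam]_x (g x)%:E = \int[lam]_x ((inbox (rho + 1) x)%:R * g x)%:E +
    \int[lam]_x ((~~ inbox (rho + 1) x)%:R * g x)%:E)%E.
  have mnb : measurable_fun setT (fun x : X => (~~ inbox (rho + 1) x)%:R : R).
    rewrite (_ : (fun _ => _) = fun x => 1 - (inbox (rho + 1) x)%:R : R).
      exact: (measurable_funB (measurable_cst _) (mb _)).
    by apply/funext => x; case: inbox; rewrite /= ?subrr ?subr0.
  rewrite -ge0_integral_EFinD.
  - by apply: eq_integral => x _; case: inbox; rewrite /= ?mul1r ?mul0r ?addr0 ?add0r.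
  - exact: (measurable_funM (mb _) mg).
  - exact: (measurable_funM mnb mg).
  - by move=> x; rewrite mulr_ge0.
  - by move=> x; rewrite mulr_ge0.
rewrite split_g mulrDl EFinD; apply: leeD; last first.
  apply: (le_trans (hA' u ut)); rewrite -mulrA EFinM.
  by apply: lee_wpmul2l => //; rewrite lee_fin.
apply: (@le_trans _ _ (\int[lam]_x (M * (inbox (rho + 1) x)%:R + h x)%:E)%E).
  apply: ge0_le_integral_EFin.
  - exact: (measurable_funM (mb _) mg).
  - exact: (measurable_funD (measurable_funM (measurable_cst _) (mb _)) mh).
  - by move=> x; rewrite mulr_ge0.
  - move=> x; case: inbox; rewrite /= ?mul1r ?mulr1//.
    by rewrite mul0r mulr0 add0r.
rewrite ge0_integral_EFinD//; last 2 first.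
- exact: (measurable_funM (measurable_cst _) (mb _)).
- by move=> x; rewrite mulr_ge0// ltW.
rewrite (ge0_integralZ lam (mb _) _ (ltW M0))// JE mulrDl mul1r EFinD.
by apply: leeD => //; rewrite -EFinM mulrC.
Qed.

End combination.

(** * Test functions are tame *)

Section borel.
Context {R : realType} {n : nat}.
Local Notation X := (n.-tuple (measurableTypeR R)).

Let box (q : n.-tuple rat * nat) : set X :=
  [set t | forall i, `|tnth t i - ratr (tnth q.1 i) : R| < q.2.+1%:R^-1].

Let measurable_box q : measurable (box q).
Proof.
rewrite (_ : box q = \bigcap_(i in [set: 'I_n])
    [set t : X | `|tnth t i - ratr (tnth q.1 i) : R| < q.2.+1%:R^-1]).
  apply: fin_bigcap_measurable => // i _.
  have mf : measurable_fun setT (fun t : X => `|(tnth t i : R) - ratr (tnth q.1 i)|).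
    apply: measurableT_comp => //; apply: measurable_funB => //.
    exact: measurable_tnth.
  have := mf measurableT `]-oo, (q.2.+1%:R^-1 : R)[%classic (measurable_itv _).
  by rewrite setTI; congr measurable; apply/seteqP; split => t /=; rewrite in_itv.
by apply/seteqP; split => t /= h i; [move=> _; exact: h|exact: (h i I)].
Qed.

(** The sigma-algebra of tuples is generated by coordinates; boxes with
    rational centre and radius [1 / (k + 1)] reach every open set. *)
Lemma measurable_open_row (O : set 'rV[R]_n) : open O ->
  measurable [set t : X | O (row_of_tuple t)].
Proof.
move=> oO; pose A := [set t : X | O (row_of_tuple t)].
pose F (m : nat) : set X := match choice.unpickle m with
  | Some q => if `[< box q `<=` A >] then box q else set0 | None => set0 end.
have -> : [set t : X | O (row_of_tuple t)] = \bigcup_m F m.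
  apply/seteqP; split => t /=; last first.
    move=> [m _]; rewrite /F; case: choice.unpickle => // q.
    by case: asboolP => // h; exact: h.
  move=> Ot; have /nbhs_ballP[e /= e0 be] : nbhs (row_of_tuple t) O by exact: open_nbhs_nbhs.
  have [k ke] : exists k : nat, k.+1%:R^-1 < e / 2.
    have e20 : 0 < e / 2 by rewrite divr_gt0.
    have := @near_infty_natSinv_lt R (PosNum e20).
    by case=> k _ /(_ k (leqnn k)) h; exists k.
  have aq (i : 'I_n) : exists q : rat, `|tnth t i - ratr q : R| < k.+1%:R^-1.
    have k0 : (0 : R) < k.+1%:R^-1 by rewrite invr_gt0.
    move: (k.+1%:R^-1 : R) k0 => d d0.
    have /rat_in_itvoo[q] : (tnth t i : R) - d < tnth t i + d by lra.
    rewrite in_itv/= => /andP[q1 q2]; exists q.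
    by rewrite ltr_norml; apply/andP; split; lra.
  have [q hq] := boolp.choice aq.
  exists (choice.pickle ([tuple q i | i < n], k)) => //.
  rewrite /F choice.pickleK; case: asboolP => [_|[]] /=.
    by move=> i /=; rewrite tnth_mktuple.
  move=> t' /= ht'; apply: be; split => // a i; rewrite /row_of_tuple !mxE.
  have := hq i; have := ht' i; rewrite tnth_mktuple => h1 h2.
  rewrite /ball/= (_ : _ - _ = (tnth t i - ratr (q i) : R) - (tnth t' i - ratr (q i))); last by ring.
  move: (k.+1%:R^-1 : R) ke h1 h2 => d ke h1 h2.
  by rewrite (le_lt_trans (ler_normB _ _))//; lra.
apply: bigcup_measurable => m _; rewrite /F.
case: choice.unpickle => [q|]; last exact: measurable0.
by case: asboolP => _; [exact: measurable_box|exact: measurable0].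
Qed.

Lemma measurable_continuous_row (v : 'rV[R]_n -> R^o) : continuous v ->
  measurable_fun setT (fun t : X => v (row_of_tuple t) : R).
Proof.
move=> /continuousP cv; apply: (measurability _ (RGenOpens.measurableE R)).
move=> _ [_ [a [b ->] <-]]; rewrite setTI.
apply: (@measurable_open_row (v @^-1` `]a, b[%classic)).
exact/cv/interval_open.
Qed.

End borel.

Section normed_domain.
Variables (R : realType) (W : normedModType R).
Implicit Types v : W -> R^o.

Lemma continuous_translate v (b : W) :
  continuous v -> continuous (fun y => v (y + b)).
Proof.
move=> cv x; apply: (@continuous_comp _ _ _ (fun y => y + b) v); last exact: cv.
by apply: cvgD; [exact: cvg_id|exact: cvg_cst].
Qed.

Lemma cvg_along_ray v (x z : W) : continuous v ->
  v (x + (- k.+1%:R^-1) *: z) @[k --> \oo] --> v x.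
Proof.
move=> cv.
have h0 : (- k.+1%:R^-1 : R) @[k --> \oo] --> (0 : R).
  by rewrite -oppr0; apply: cvgN; exact: cvg_harmonic.
have c : x + (- k.+1%:R^-1) *: z @[k --> \oo] --> x.
  by have := cvgD (cvg_cst x) (cvgZ h0 (cvg_cst z)); rewrite scale0r addr0; apply.
exact: (cvg_comp _ _ c (cv x)).
Qed.

Lemma derive_near0 v (x a : W) : (\forall y \near x, v y = 0) ->
  'D_a v x = 0.
Proof.
move=> v0; rewrite -[RHS](derive_cst (0 : R^o) x a).
exact: near_eq_derive.
Qed.

End normed_domain.

Lemma near_coord (R : realType) n (x : 'rV[R]_n) j (r : R) : r < `|x 0 j| ->
  \forall y \near x, r < `|(y : 'rV[R]_n) 0 j|.
Proof.
move=> xj; have c : {for x, continuous (fun y : 'rV[R]_n => `|y 0 j|)}.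
  apply: (@continuous_comp _ _ _ (fun y : 'rV[R]_n => y 0 j) Num.norm).
    exact: coord_continuous.
  exact: norm_continuous.
exact: (cvgr_gt _ c).
Qed.

Section difference_operators.
Context {R : realType} {n : nat}.
Local Notation V := 'rV[R]_n.
Implicit Types (v : V -> R^o) (x : V) (i : 'I_n).

Definition axis i : V := delta_mx 0 i.

Definition difference i (h : R) v : V -> R^o := fun x => v x - v (x + h *: axis i).

Fixpoint differences (l : seq 'I_n) (h : 'I_n -> R) v : V -> R^o :=
  if l is i :: l' then difference i (h i) (differences l' h v) else v.

Lemma derivable_translate v x (b a : V) : derivable v (x + b) a ->
  derivable (fun x : V => v (x + b) : R^o) x a /\
  'D_a (fun x : V => v (x + b) : R^o) x = 'D_a v (x + b).
Proof.
have e : (fun h : R => h^-1 *: (((fun x : V => v (x + b)) \o shift x) (h *: a) - v (x + b))) =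
    (fun h : R => h^-1 *: ((v \o shift (x + b)) (h *: a) - v (x + b))).
  by apply/funext => h; rewrite /shift/= addrA.
by rewrite /derivable /derive e.
Qed.

Lemma is_derive_line v x (a : V) (t : R) : derivable v (x + t *: a) a ->
  is_derive (t : R^o) 1 (fun t : R^o => v (x + t *: a) : R^o) ('D_a v (x + t *: a)).
Proof.
move=> dv.
have e : (fun h : R => h^-1 *: (((fun t : R^o => v (x + t *: a)) \o shift t) (h *: (1 : R^o)) -
      v (x + t *: a))) =
    (fun h : R => h^-1 *: ((v \o shift (x + t *: a)) (h *: a) - v (x + t *: a))).
  apply/funext => h /=; congr (_ *: (v _ - _)).
  by rewrite /shift/= [h *: (1 : R^o)]mulr1 scalerDl addrCA.
by split; rewrite ?/derivable ?/derive e.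
Qed.

Lemma derivable_difference v x a i h : (forall x, derivable v x a) ->
  derivable (difference i h v) x a /\
  'D_a (difference i h v) x = difference i h ('D_a v) x.
Proof.
move=> dv; have [d1 e1] := derivable_translate (dv (x + h *: axis i)).
split; first exact: (derivableB (dv x) d1).
by rewrite [LHS](deriveB (dv x) d1) e1.
Qed.

Lemma derivable_differences l v x a h : (forall x, derivable v x a) ->
  derivable (differences l h v) x a /\
  'D_a (differences l h v) x = differences l h ('D_a v) x.
Proof.
move=> dv; elim: l x => [|i l IH] x /=; first by [].
have [d1 e1] := derivable_difference x i (h i) (fun x => (IH x).1).
by split => //; rewrite e1 /difference !(IH _).2.
Qed.

(** The mean value theorem along a line. *)
Lemma difference_le v x i h B : (forall x, derivable v x (axis i)) ->
  (forall x, `|'D_(axis i) v x| <= B) -> `|difference i h v x| <= `|h| * B.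
Proof.
move=> dv vB.
pose f (t : R) : R := v (x + t *: axis i).
have fd (t : R) : is_derive t 1 f ('D_(axis i) v (x + t *: axis i)).
  exact: is_derive_line.
have fc : continuous f.
  move=> t; apply: differentiable_continuous; apply/derivable1_diffP.
  by have [] := fd t.
have mvt a b : a <= b -> `|f b - f a| <= `|b - a| * B.
  move=> ab; have [|t _ ->] := @MVT_segment R f _ a b ab (fun t _ => fd t).
    exact: continuous_subspaceT.
  by rewrite normrM mulrC ler_wpM2l.
rewrite /difference -/(f h) (_ : v x = f 0); last by rewrite /f scale0r addr0.
have [h0|h0] := leP 0 h.
  by rewrite distrC (le_trans (mvt _ _ h0))// subr0.
by rewrite (le_trans (mvt _ _ (ltW h0)))// sub0r normrN.
Qed.

Lemma smooth_partial v i : smooth v -> smooth ('D_(axis i) v).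
Proof. by move=> sv l; exact: (sv (i :: l)). Qed.

(** Each difference costs one partial derivative and gains a factor [h]. *)
Lemma differences_le l v h B : smooth v -> (forall x, `|partials l v x| <= B) ->
  forall x, `|differences l h v x| <= (\prod_(i <- l) `|h i|) * B.
Proof.
elim: l v => [|i l IH] v sv vB x /=; first by rewrite big_nil mul1r.
rewrite big_cons -mulrA.
have dv y : derivable v y (axis i) by have [_] := sv [::]; exact.
apply: difference_le; first by move=> y; have [] := derivable_differences l y h dv.
move=> y; have [_ ->] := derivable_differences l y h dv.
exact: (IH _ (smooth_partial i sv) vB).
Qed.

End difference_operators.

Section decay.
Context {R : realType} {n : nat}.
Local Notation X := (n.-tuple (measurableTypeR R)).
Local Notation lam := (lebesgue_tuple R n).
Local Notation V := 'rV[R]_n.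
Implicit Types (v : V -> R^o) (i : 'I_n).

Definition on_tuples v (t : X) : R := v (row_of_tuple t).

Definition supported_in (r : R) v := forall x, v x != 0 -> forall i, `|x 0 i| <= r.

Definition bounded_by (B : R) v := forall x, `|v x| <= B.

Lemma row_of_taff (x : X) (c : R) (z : X) :
  row_of_tuple (taff x c z) = row_of_tuple x + c *: row_of_tuple z.
Proof. by apply/rowP => i; rewrite !mxE tnth_taff. Qed.

Lemma supported_difference r v i h : `|h| <= 1 -> supported_in r v ->
  supported_in (r + 1) (difference i h v).
Proof.
move=> h1 vr x; rewrite /difference => vx j.
have [v0|v0] := eqVneq (v x) 0; last first.
  by rewrite (le_trans (vr x v0 j))// lerDl.
have v1 : v (x + h *: axis i) != 0 by move: vx; rewrite v0 sub0r oppr_eq0.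
have := vr _ v1 j; rewrite !mxE eqxx/= => xj.
have hj : `|h * (j == i)%:R| <= 1.
  by rewrite normrM; case: (j == i); rewrite ?normr1 ?mulr1 ?normr0 ?mulr0.
rewrite -[x 0 j](addrK (h * (j == i)%:R)) (le_trans (ler_normB _ _))//.
exact: lerD.
Qed.

Lemma continuous_difference v i h : continuous v -> continuous (difference i h v).
Proof.
move=> cv x; apply: (@continuousB _ _ _ v (fun y => v (y + h *: axis i))).
  exact: cv.
exact: continuous_translate.
Qed.

Lemma continuous_differences l v h : continuous v -> continuous (differences l h v).
Proof.
move=> cv; elim: l => [|i l IH]; first exact: cv.
exact: (@continuous_difference (differences l h v) i (h i) IH).
Qed.

Lemma supported_differences l r v h : (forall i, `|h i| <= 1) -> supported_in r v ->
  supported_in (r + (size l)%:R) (differences l h v).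
Proof.
move=> h1 vr; elim: l => [|i l IH] /=; first by rewrite addr0.
by rewrite -addn1 natrD addrA; exact: supported_difference.
Qed.

Lemma on_tuples_le r B v : supported_in r v -> bounded_by B v ->
  forall t, `|on_tuples v t| <= B * (inbox r t)%:R.
Proof.
move=> vr vB t; rewrite /on_tuples.
have [->|v0] := eqVneq (v (row_of_tuple t)) 0.
  by rewrite normr0 mulr_ge0// (le_trans (normr_ge0 _) (vB (row_of_tuple t))).
have -> : inbox r t by apply/forallP => i; have := vr _ v0 i; rewrite mxE.
by rewrite mulr1.
Qed.

Lemma integrable_on_tuples r B v : continuous v -> supported_in r v ->
  bounded_by B v -> lam.-integrable setT (EFin \o on_tuples v).
Proof.
move=> cv vr vB; apply: (dominated_integrable _ (on_tuples_le vr vB)).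
  exact: measurable_continuous_row.
by apply: integrableZ; exact: integrable_inbox.
Qed.

Definition box_volume (r : R) : R := \int[lam]_t (inbox r t)%:R.

Lemma box_volume_ge0 r : 0 <= box_volume r.
Proof. by apply: Rintegral_ge0. Qed.

Lemma ctrans_on_tuples_le r B v a x xi : continuous v -> supported_in r v ->
  bounded_by B v -> `|ctrans (on_tuples v) a x xi| <= B * box_volume r.
Proof.
move=> cv vr vB.
rewrite /box_volume -RintegralZl//; last exact: integrable_inbox.
apply: norm_Rintegral_le.
- apply: measurable_funM; first exact: measurable_continuous_row.
  by apply: measurable_phase.
- move=> t; rewrite normrM (le_trans _ (on_tuples_le vr vB t))//.
  by rewrite ler_piMr ?cos_max.
- by apply: integrableZ; exact: integrable_inbox.
Qed.

(** Translating by half a wave length changes the sign of the wave, so the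
    difference operator doubles the transform. *)
Lemma ctrans_difference r B v i h a x xi : continuous v -> supported_in r v ->
  bounded_by B v -> 2 * h * tnth xi i = 1 ->
  ctrans (on_tuples (difference i h v)) a x xi = 2 * ctrans (on_tuples v) a x xi.
Proof.
move=> cv vr vB hxi.
pose e : X := [tuple if j == i then h else 0 | j < n].
have re : row_of_tuple e = h *: axis i.
  by apply/rowP => j; rewrite !mxE tnth_mktuple eqxx/=; case: eqP; rewrite ?mulr1 ?mulr0.
have dote : dot e xi = h * tnth xi i.
  rewrite /dot (bigD1 i)//= tnth_mktuple eqxx big1 ?addr0// => j /negbTE ji.
  by rewrite tnth_mktuple ji mul0r.
pose phase (y : X) := cos (a + 2 * pi * dot (taff x (-1) y) xi).
have mphase : measurable_fun setT phase by apply: measurable_phase.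
have iv := integrable_on_tuples cv vr vB.
have iphase (w : X -> R) : lam.-integrable setT (EFin \o w) ->
    lam.-integrable setT (EFin \o (fun y => w y * phase y)).
  move=> iw; apply: (dominated_integrable _ _ (integrable_norm iw)).
    exact: (measurable_funM (integrable_measurable iw) mphase).
  by move=> y; rewrite /= normrM ler_piMr ?cos_max.
have phaseN (y : X) : phase (taff (dil (-1) e) 1 y) = - phase y.
  rewrite /phase -cosDpi; congr cos.
  rewrite !(dot_taffl x) (dot_taffl (dil (-1) e)) dot_dill dote.
  have -> : h * tnth xi i = 2^-1.
    by apply: (@mulfI R 2) => //; rewrite mulrA hxi divff.
  by field.
pose f (y : X) := on_tuples v (taff e 1 y) * phase y.
have ive : lam.-integrable setT (EFin \o (fun y => on_tuples v (taff e 1 y))).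
  exact: (integrable_taff e (@oner_neq0 R) iv).
have i1 := iphase _ iv; have i2 := iphase _ ive.
have shifted : \int[lam]_y f y = - ctrans (on_tuples v) a x xi.
  rewrite (Rintegral_translate_tuple (dil (-1) e) i2).
  refine (etrans _ (etrans (RintegralZl (-1) measurableT i1) (mulN1r _))).
  apply: eq_Rintegral => y _; rewrite phaseN mulrN mulN1r; congr (- (_ * _)).
  congr on_tuples; apply: eq_from_tnth => j.
  by rewrite !tnth_taff tnth_origin; ring.
have eB : ctrans (on_tuples (difference i h v)) a x xi =
    \int[lam]_y (on_tuples v y * phase y - f y).
  apply: eq_Rintegral => y _; rewrite /f -mulrBl; congr (_ * _).
  rewrite /on_tuples /difference; congr (_ - v _).
  by rewrite row_of_taff re scale1r addrC.
have e3 := RintegralB measurableT i1 i2.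
rewrite eB; refine (etrans e3 _).
by rewrite shifted opprK mulr2n mulrDl mul1r.
Qed.

Lemma bounded_difference B v i h : bounded_by B v -> bounded_by (B + B) (difference i h v).
Proof. by move=> vB x; rewrite (le_trans (ler_normB _ _))// lerD. Qed.

Lemma bounded_differences l B v h : bounded_by B v -> exists B', bounded_by B' (differences l h v).
Proof.
move=> vB; elim: l => [|i l [B' IH]] /=; first by exists B.
by exists (B' + B'); exact: bounded_difference.
Qed.

Lemma ctrans_differences l r B v h a x xi : continuous v -> supported_in r v ->
  bounded_by B v -> (forall i, `|h i| <= 1) ->
  (forall i, i \in l -> 2 * h i * tnth xi i = 1) ->
  ctrans (on_tuples (differences l h v)) a x xi =
  2 ^+ size l * ctrans (on_tuples v) a x xi.
Proof.
move=> cv vr vB h1; elim: l => [|i l IH] hl /=; first by rewrite mul1r.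
have [B' vB'] := @bounded_differences l B v h vB.
rewrite (@ctrans_difference _ _ _ i (h i) a x xi (@continuous_differences l v h cv)
  (@supported_differences l r v h h1 vr) vB'); last first.
  by apply: hl; rewrite mem_head.
rewrite IH ?exprS ?mulrA// => j jl; apply: hl.
by rewrite inE jl orbT.
Qed.

Lemma supported_partial r v i : supported_in r v -> supported_in r ('D_(axis i) v).
Proof.
move=> vr x dv j; rewrite leNgt; apply/negP => xj; case/eqP: dv.
apply: derive_near0; near=> y.
have yj : r < `|(y : V) 0 j| by near: y; exact: near_coord.
apply/eqP; apply: contraTT yj => vy; rewrite -leNgt; exact: vr.
Unshelve. all: by end_near. Qed.

Lemma supported_partials r l v : supported_in r v -> supported_in r (partials l v).
Proof.
elim: l v => //= i l IH v vr; apply: IH; exact: supported_partial.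
Qed.

Lemma supported_bounded r v : continuous v -> supported_in r v ->
  exists2 B, 0 <= B & bounded_by B v.
Proof.
move=> cv vr.
pose A := [set x : V | forall i, `[- r, r]%classic (x ord0 i)].
have cA : compact A by apply: (@rV_compact R n (fun=> `[- r, r]%classic)) => i; exact: segment_compact.
have [M [_ hM]] := compact_bounded (continuous_compact (continuous_subspaceT cv) cA).
exists (`|M| + 1); first by rewrite addr_ge0.
move=> x; have [->|v0] := eqVneq (v x) 0; first by rewrite normr0 addr_ge0.
apply: hM; first by rewrite (le_lt_trans (ler_norm M))// ltrDl.
exists x => // i; rewrite /= in_itv/= -ler_norml.
by have := vr x v0 i; rewrite (_ : 0 = ord0).
Qed.

Lemma smooth_bounded_partials r v : smooth v -> supported_in r v ->
  exists B : seq 'I_n -> R, forall l, 0 <= B l /\ bounded_by (B l) (partials l v).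
Proof.
move=> sv vr.
have ex (l : seq 'I_n) : exists B : R, 0 <= B /\ bounded_by B (partials l v).
  have [B B0 hB] := supported_bounded (sv l).1 (@supported_partials r l v vr).
  by exists B.
by have [B hB] := boolp.choice ex; exists B.
Qed.

(** In each direction of [A] four differences are taken: they gain the fourth
    power of the frequency, half of which pays for the factor
    [1 + |xi| ^ 2] while the other half leaves an integrable function. *)
Definition directions (A : {set 'I_n}) : seq 'I_n :=
  enum A ++ enum A ++ enum A ++ enum A.

Lemma prod_directions (A : {set 'I_n}) (f : 'I_n -> R) :
  \prod_(i <- directions A) f i = (\prod_(i in A) f i) ^+ 4.
Proof. by rewrite /directions !big_cat /= !big_enum/=; ring. Qed.

Lemma directions_gain (xi : X) :
  (\prod_(i in [set i | 1 <= `|tnth xi i : R|]%SET) (4 * `|tnth xi i : R|)^-1)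
    ^+ 4 <= 4 ^+ n * majorant xi ^+ 2.
Proof.
rewrite big_mkcond/= /majorant.
rewrite (_ : 4 ^+ n = \prod_(i < n) 4 :> R); last by rewrite prodr_const card_ord.
rewrite -!prodrXl -big_split/=; apply: ler_prod => i _.
have d0 : 0 < 1 + tnth xi i ^+ 2 :> R by rewrite ltr_pwDl// sqr_ge0.
rewrite exprVn ler_pdivlMr ?exprn_gt0//.
rewrite inE; case: ifPn => [x1|]; last first.
  rewrite -ltNge => x1; rewrite expr1n mul1r ler01/=.
  have : tnth xi i ^+ 2 <= 1 :> R.
    by rewrite -(real_normK (num_real (tnth xi i))) expr_le1// ltW.
  by have := sqr_ge0 (tnth xi i : R); nra.
have a0 : 0 < 4 * `|tnth xi i : R| by rewrite mulr_gt0// (lt_le_trans _ x1).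
rewrite exprn_ge0 ?invr_ge0 ?(ltW a0)//= exprVn mulrC ler_pdivrMr ?exprn_gt0//.
have -> : (4 * `|tnth xi i : R|) ^+ 4 = 256 * (tnth xi i ^+ 2) ^+ 2.
  by rewrite -(real_normK (num_real (tnth xi i))); ring.
have : 1 <= tnth xi i ^+ 2 :> R.
  by rewrite -(real_normK (num_real (tnth xi i))) exprn_ege1.
by move: (tnth xi i ^+ 2 : R) => y y1; nra.
Qed.

(** In the directions where the frequency is at least one, differences with
    step half a wave length are applied: they multiply the transform by a power
    of two, and are small because the partial derivatives are bounded.  There
    are finitely many sets of directions, so one constant serves them all. *)
Lemma smooth_ctrans_decay r v : smooth v -> supported_in r v ->
  exists2 D, 0 <= D & forall a x xi,
    `|ctrans (on_tuples v) a x xi| * (1 + dot xi xi) <= D * majorant xi.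
Proof.
move=> sv vr; have cv : continuous v by exact: (sv [::]).1.
have [B0 _ vB0] := supported_bounded cv vr.
have [B hB] := smooth_bounded_partials sv vr.
pose D (A : {set 'I_n}) := B (directions A) * box_volume (r + (size (directions A))%:R).
have D0 A : 0 <= D A by rewrite mulr_ge0 ?box_volume_ge0//; case: (hB (directions A)).
exists ((\sum_A D A) * 4 ^+ n).
  by rewrite mulr_ge0 ?exprn_ge0//; apply: sumr_ge0.
move=> a x xi; pose A := [set i | 1 <= `|tnth xi i : R|]%SET.
(* half a wave length in the direction [i] *)
pose h i : R := if i \in A then (2 * tnth xi i)^-1 else 0.
have xi0 i : i \in A -> (tnth xi i : R) != 0.
  by rewrite inE => xi1; rewrite -normr_gt0 (lt_le_trans _ xi1).
have h1 i : `|h i| <= 1.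
  rewrite /h; case: ifPn => [iA|]; last by rewrite normr0.
  have := iA; rewrite inE => xi1.
  rewrite normfV normrM (gtr0_norm (ltr0Sn _ _)) invf_le1 ?mulr_gt0//; last first.
    by rewrite (lt_le_trans _ xi1).
  by lra.
have hl i : i \in directions A -> 2 * h i * tnth xi i = 1.
  rewrite !mem_cat !mem_enum !orbb => iA; rewrite /h iA.
  by field; exact: xi0.
have eq1 := @ctrans_differences _ _ _ _ h a x xi cv vr vB0 h1 hl.
pose P := \prod_(i <- directions A) `|h i|.
have le1 : `|ctrans (on_tuples (differences (directions A) h v)) a x xi| <= P * D A.
  rewrite /D mulrA; apply: ctrans_on_tuples_le.
  - exact: continuous_differences.
  - exact: supported_differences.
  - by apply: differences_le => //; case: (hB (directions A)).
have P0 : 0 <= P by rewrite /P; apply: prodr_ge0.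
have le2 : `|ctrans (on_tuples v) a x xi| <= (2 ^- size (directions A) * P) * D A.
  rewrite -mulrA ler_pdivlMl ?exprn_gt0//.
  by move: le1; rewrite eq1 normrM ger0_norm ?exprn_ge0.
have eP : 2 ^- size (directions A) * P = (\prod_(i in A) (4 * `|tnth xi i : R|)^-1) ^+ 4.
  rewrite -prod_directions /P -exprVn.
  have -> : 2^-1 ^+ size (directions A) = \prod_(i <- directions A) 2^-1 :> R.
    by rewrite big_const_seq count_predT iter_mulr_1.
  rewrite -big_split/= big_seq [RHS]big_seq; apply: eq_bigr => i.
  rewrite !mem_cat !mem_enum !orbb => iA; rewrite /h iA.
  rewrite normfV normrM (gtr0_norm (ltr0Sn _ _)).
  by field; rewrite normr_eq0; exact: xi0.
have q0 := majorant_gt0 xi.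
have le3 : `|ctrans (on_tuples v) a x xi| <= (4 ^+ n * majorant xi ^+ 2) * \sum_A D A.
  apply: (le_trans le2); rewrite eP; apply: ler_pM => //.
  - by rewrite exprn_ge0//; apply: prodr_ge0 => i _; rewrite invr_ge0 mulr_ge0.
  - exact: directions_gain.
  - by rewrite (bigD1 A)//= lerDl; apply: sumr_ge0.
have S0 : 0 <= \sum_A D A by apply: sumr_ge0.
apply: (@le_trans _ _ ((4 ^+ n * majorant xi ^+ 2) * (\sum_A D A) * (majorant xi)^-1)).
  apply: ler_pM => //; first by rewrite addr_ge0// dot_ge0.
  exact: oneDdot_le.
rewrite le_eqVlt; apply/orP; left; apply/eqP; field.
by rewrite gt_eqF.
Qed.

Lemma smooth_tame r v : smooth v -> supported_in r v -> tame r (on_tuples v).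
Proof.
move=> sv vr; have cv : continuous v by exact: (sv [::]).1.
have [B B0 vB] := supported_bounded cv vr.
split.
- exact: measurable_continuous_row.
- exists (B * (1 + r ^+ 2) ^+ n).
    by rewrite mulr_ge0// exprn_ge0// addr_ge0// sqr_ge0.
  move=> y; apply: le_trans (on_tuples_le vr vB y) _.
  by rewrite -mulrA ler_wpM2l// inbox_le_majorant.
- by move=> y vy i; have := vr _ vy i; rewrite mxE.
- move=> x z; rewrite /on_tuples.
  under eq_fun do rewrite row_of_taff.
  exact: cvg_along_ray.
- exact: smooth_ctrans_decay vr.
Qed.

End decay.

(** * Interpolation between the exponents one and [p] *)

(** For [b = y / M] this is [b ^ q <= b + b ^ p]: the first term wins for
    [b <= 1], the second for [1 <= b]. *)
Lemma powR_interpolation (R : realType) (y M q p : R) :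
  0 <= y -> 0 < M -> 1 < q -> q < p ->
  y `^ q <= M `^ q / M * y + M `^ q / M `^ p * y `^ p.
Proof.
move=> y0 M0 q1 qp; have q0 : 0 < q by rewrite (lt_trans _ q1).
have p0 : 0 < p by rewrite (lt_trans q0).
have y_ge0 : 0 <= y / M by rewrite divr_ge0// ltW.
have bE r : y `^ r = M `^ r * (y / M) `^ r.
  by rewrite -powRM ?(ltW M0)// mulrCA divff ?mulr1// gt_eqF.
have -> : M `^ q / M * y + M `^ q / M `^ p * y `^ p =
    M `^ q * (y / M + (y / M) `^ p).
  rewrite (bE p); field.
  by rewrite !gt_eqF ?powR_gt0.
rewrite bE ler_wpM2l ?powR_ge0//.
have [b1|b1] := leP (y / M) 1; last first.
  by rewrite (le_trans (ler_powR (ltW b1) (ltW qp)))// lerDr.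
have [->|b0] := eqVneq (y / M) 0; first by rewrite !powR0 ?gt_eqF// addr0.
rewrite (@le_trans _ _ (y / M))// ?lerDl ?powR_ge0// ge1r_powR ?b1 ?(ltW q1)//.
by rewrite andbT lt0r b0.
Qed.

Section interpolation.
Context d (T : measurableType d) (R : realType).
Variable mu : {measure set T -> \bar R}.

Lemma Lnorm_EFin (r : R) (f : T -> R) : (forall x, 0 <= f x) ->
  Lnorm mu r%:E (fun x => (f x)%:E) = (poweR (\int[mu]_x (f x `^ r)%:E) r^-1)%E.
Proof.
move=> f0; rewrite unlock.
by under eq_integral => x _ do rewrite abse_EFin ger0_norm// poweR_EFin.
Qed.

(** If the first moment is controlled by every upper bound of the [L^p] norm,
    splitting [f] at the height of that bound controls the intermediate
    norms.  Quantifying over all upper bounds covers a vanishing norm. *)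
Lemma Lnorm_interpolation (p q K : R) (f : T -> R) :
  1 < q -> q < p -> 0 <= K -> measurable_fun setT f -> (forall x, 0 <= f x) ->
  (forall M, 0 < M -> (\int[mu]_x (f x `^ p)%:E <= (M `^ p)%:E)%E ->
    (\int[mu]_x (f x)%:E <= (K * M)%:E)%E) ->
  (Lnorm mu q%:E (fun x => (f x)%:E) <=
   ((K + 1) `^ q^-1)%:E * Lnorm mu p%:E (fun x => (f x)%:E))%E.
Proof.
move=> q1 qp K0 mf f0 hK; have q0 : 0 < q by rewrite (lt_trans _ q1).
have p0 : 0 < p by rewrite (lt_trans q0).
have C0 : 0 < (K + 1) `^ q^-1 by rewrite powR_gt0// ltr_wpDl.
have mfp r : measurable_fun setT (fun x => f x `^ r).
  exact: (measurableT_comp (measurable_powR r) mf).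
have bound M : 0 < M -> (\int[mu]_x (f x `^ p)%:E <= (M `^ p)%:E)%E ->
    (Lnorm mu q%:E (fun x => (f x)%:E) <= ((K + 1) `^ q^-1 * M)%:E)%E.
  move=> M0 hM; have f1 := hK _ M0 hM.
  have a0 : 0 <= M `^ q / M by rewrite divr_ge0 ?powR_ge0// ltW.
  have b0 : 0 <= M `^ q / M `^ p by rewrite divr_ge0 ?powR_ge0.
  have le1 : (\int[mu]_x (f x `^ q)%:E <= ((K + 1) * M `^ q)%:E)%E.
    apply: (@le_trans _ _ (\int[mu]_x (M `^ q / M * f x + M `^ q / M `^ p * f x `^ p)%:E)%E).
      apply: ge0_le_integral_EFin.
      - exact: mfp.
      - by apply: measurable_funD; exact: measurable_funM.
      - by move=> x; exact: powR_ge0.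
      - by move=> x; exact: powR_interpolation.
    rewrite ge0_integral_EFinD; last first.
    - by move=> x; rewrite mulr_ge0 ?powR_ge0.
    - by move=> x; rewrite mulr_ge0.
    - exact: measurable_funM.
    - exact: measurable_funM.
    rewrite (ge0_integralZ mu mf f0 a0) (ge0_integralZ mu (mfp p) _ b0)//; last first.
      by move=> x; exact: powR_ge0.
    have -> : (K + 1) * M `^ q = M `^ q / M * (K * M) + M `^ q / M `^ p * M `^ p.
      by field; rewrite !gt_eqF ?powR_gt0.
    rewrite EFinD; apply: leeD.
      by rewrite [leRHS]EFinM; apply: lee_wpmul2l; rewrite ?lee_fin.
    by rewrite [leRHS]EFinM; apply: lee_wpmul2l; rewrite ?lee_fin.
  rewrite Lnorm_EFin//.
  have -> : (K + 1) `^ q^-1 * M = ((K + 1) * M `^ q) `^ q^-1.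
    rewrite powRM ?powR_ge0 ?addr_ge0// -powRrM divff ?gt_eqF//.
    by rewrite powRr1// ltW.
  rewrite -poweR_EFin; apply: gt0_ler_poweR => //.
  - by rewrite invr_ge0 ltW.
  - rewrite in_itv/= leey andbT; apply: integral_ge0 => x _.
    by rewrite lee_fin powR_ge0.
  - by rewrite in_itv/= leey andbT lee_fin mulr_ge0 ?powR_ge0 ?addr_ge0.
have normE : (Lnorm mu p%:E (fun x => (f x)%:E) `^ p)%E = (\int[mu]_x (f x `^ p)%:E)%E.
  rewrite (poweR_Lnorm mu _ (lt0r_neq0 p0)).
  by under eq_integral => x _ do rewrite abse_EFin ger0_norm// poweR_EFin.
have := Lnorm_ge0 mu p%:E (fun x => (f x)%:E).
case: (Lnorm mu p%:E _) normE => [L| |] normE L0; last by [].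
- apply/lee_addgt0Pr => e e0; rewrite lee_fin in L0.
  have := bound (L + e / (K + 1) `^ q^-1); rewrite mulrDr (mulrC _ (e / _)) divfK ?gt_eqF//.
  rewrite -EFinM -EFinD; apply.
    by rewrite ltr_wpDl// divr_gt0.
  rewrite -normE poweR_EFin lee_fin ge0_ler_powR ?(ltW p0)//.
  - by rewrite nnegrE addr_ge0// divr_ge0// ltW.
  - by rewrite lerDl divr_ge0// ltW.
- by rewrite mulry gtr0_sg// mul1e leey.
Qed.

End interpolation.

(** * The fractional Laplacian as a real multiplier *)

Section fractional_laplacian.
Context {R : realType} {n : nat}.
Local Notation X := (n.+1.-tuple (measurableTypeR R)).
Local Notation lam := (lebesgue_tuple R n.+1).
Local Open Scope complex_scope.
Implicit Types (u v : X -> R) (x xi : X).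

Lemma dotrv_row_of_tuple x xi : dotrv (row_of_tuple x) (row_of_tuple xi) = dot x xi.
Proof. by apply: eq_bigr => i _; rewrite !mxE. Qed.

Lemma euclid_norm_powR (s : R) xi :
  euclid_norm (row_of_tuple xi) `^ s = dot xi xi `^ (s / 2).
Proof.
by rewrite /euclid_norm dotrv_row_of_tuple -powR12_sqrt ?dot_ge0// -powRrM mulrC.
Qed.

Lemma tame_phase_integrable rho u a x xi : tame rho u ->
  lam.-integrable setT (EFin \o
    (fun y => u y * cos (a + 2 * pi * dot (taff x (-1) y) xi))).
Proof.
move=> ut; apply: dominated_integrable (tame_norm_integrable ut).
  apply: measurable_funM; first exact: (tame_measurable ut).
  exact: (measurable_phase (measurable_cst a) (measurable_cst x)
    (@measurable_id _ _ setT) (measurable_cst xi)).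
by move=> y; rewrite normrM ler_piMr ?cos_max.
Qed.

(** The addition theorem moves the centre to the origin, where the Fourier
    integral is taken. *)
Lemma ctrans_rotate rho u a x xi : tame rho u ->
  ctrans u a x xi = cos (2 * pi * dot x xi) * ctrans u a origin xi +
    sin (2 * pi * dot x xi) * ctrans u (a + pi / 2) origin xi.
Proof.
move=> ut; rewrite /ctrans -!RintegralZl//; try exact: tame_phase_integrable ut.
rewrite -RintegralD//; last 2 first.
- by apply: integrableZ; exact: tame_phase_integrable ut.
- by apply: integrableZ; exact: tame_phase_integrable ut.
apply: eq_Rintegral => y _; rewrite !dot_taffl dot_originl.
rewrite (_ : a + 2 * pi * (dot x xi + -1 * dot y xi) = 2 * pi * dot x xi + (a + 2 * pi * (0 + -1 * dot y xi))); last by ring.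
rewrite (_ : a + pi / 2 + 2 * pi * (0 + -1 * dot y xi) = (a + 2 * pi * (0 + -1 * dot y xi)) + pi / 2); last by ring.
rewrite [in LHS]cosD [cos (_ + pi / 2)]cosD cos_pihalf sin_pihalf; ring.
Qed.

Lemma ctrans_addpi rho u a x xi : tame rho u ->
  ctrans u (a + pi) x xi = - ctrans u a x xi.
Proof.
move=> ut; rewrite -[RHS]mulN1r /ctrans -RintegralZl//; last first.
  exact: tame_phase_integrable ut.
apply: eq_Rintegral => y _; rewrite [a + pi + _]addrAC [cos (_ + pi)]cosD cospi sinpi; ring.
Qed.

Let Re_mul (z w : R[i]) :
  complex.Re (z * w) = complex.Re z * complex.Re w - complex.Im z * complex.Im w.
Proof. by case: z => a b; case: w. Qed.

Let Im_mul (z w : R[i]) :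
  complex.Im (z * w) = complex.Re z * complex.Im w + complex.Im z * complex.Re w.
Proof. by case: z => a b; case: w. Qed.

(** The phase [pi / 2] gives the sine transform, which is odd in the frequency. *)
Lemma sine_multiplier_eq0 rho u (m : X -> R) (cm : R) x :
  tame rho u -> measurable_fun setT m -> 0 <= cm -> (forall xi, 0 <= m xi) ->
  (forall xi, m xi <= cm * (1 + dot xi xi)) ->
  (forall xi, m (taff origin (-1) xi) = m xi) ->
  \int[lam]_xi (m xi * ctrans u (pi / 2) x xi) = 0.
Proof.
move=> ut mm cm0 m0 mle meven.
have im := integrable_multiplier ut mm cm0 m0 mle (pi / 2) x.
have N10 : (-1 : R) != 0 by rewrite oppr_eq0 oner_eq0.
set I := LHS; suff : I = - I by lra.
rewrite {1}/I (Rintegral_taff origin N10 im) normrN normr1 expr1n mul1r.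
rewrite -[in RHS]mulN1r -RintegralZl//; apply: eq_Rintegral => xi _.
rewrite meven mulrCA; congr (_ * _).
rewrite /ctrans -RintegralZl//; last exact: (tame_phase_integrable _ _ _ ut).
apply: eq_Rintegral => y _; rewrite mulrCA; congr (_ * _).
set t := dot (taff x (-1) y) xi.
have -> : dot (taff x (-1) y) (taff origin (-1) xi) = - t.
  by rewrite dot_taffr [dot _ origin]dotC dot_originl add0r mulN1r.
by rewrite mulrN cosD [in RHS]cosD cosN sinN cos_pihalf sin_pihalf; ring.
Qed.

Section representation.
Variables (rho : R) (phi : 'rV[R]_n.+1 -> R[i]).
Local Notation u := (on_tuples (fun w => complex.Re (phi w))).
Local Notation v := (on_tuples (fun w => complex.Im (phi w))).
Hypotheses (ut : tame rho u) (vt : tame rho v).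

Let phase_origin y xi : 2 * pi * dot (taff origin (-1) y) xi = - (2 * pi * dot y xi).
Proof. by rewrite dot_taffl dot_originl; ring. Qed.

Lemma Re_fourier xi : complex.Re (fourier phi (row_of_tuple xi)) =
  ctrans u 0 origin xi + ctrans v (pi / 2) origin xi.
Proof.
rewrite /fourier /Cintegral [LHS]/= /ctrans -RintegralD//; last 2 first.
- exact: tame_phase_integrable ut.
- exact: tame_phase_integrable vt.
apply: eq_Rintegral => y _; rewrite Re_mul /cis/= dotrv_row_of_tuple phase_origin.
by rewrite add0r [cos (pi / 2 + _)]cosD cos_pihalf sin_pihalf /on_tuples; ring.
Qed.

Lemma Im_fourier xi : complex.Im (fourier phi (row_of_tuple xi)) =
  ctrans v 0 origin xi - ctrans u (pi / 2) origin xi.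
Proof.
rewrite /fourier /Cintegral [LHS]/= /ctrans -RintegralB//; last 2 first.
- exact: tame_phase_integrable vt.
- exact: tame_phase_integrable ut.
apply: eq_Rintegral => y _; rewrite Im_mul /cis/= dotrv_row_of_tuple phase_origin.
by rewrite add0r [cos (pi / 2 + _)]cosD cos_pihalf sin_pihalf /on_tuples; ring.
Qed.

(** Both inversions produce cosine integrals of the real and imaginary parts,
    plus sine integrals that vanish because the symbol is even. *)
Lemma fraclap_multiplier s t : 0 < s -> s < 1 ->
  fraclap s phi (row_of_tuple t) =
  multiplier u (symbol s ((2 * pi) `^ s)) t +i*
  multiplier v (symbol s ((2 * pi) `^ s)) t.
Proof.
move=> s0 s1; set c := (2 * pi) `^ s; set m := symbol s c : X -> R.
have c0 : 0 < c by rewrite powR_gt0// mulr_gt0// pi_gt0.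
have mm : measurable_fun setT m by exact: measurable_symbol.
have m0 : forall xi, 0 <= m xi by exact: symbol_ge0.
have mle : forall xi, m xi <= c * (1 + dot xi xi) by exact: symbol_le.
have meven xi : m (taff origin (-1) xi) = m xi.
  rewrite /m /symbol dot_taffl !dot_taffr [dot xi origin]dotC !dot_originl.
  by congr (_ * _ `^ _); ring.
have iu a := integrable_multiplier ut mm (ltW c0) m0 mle a t.
have iv a := integrable_multiplier vt mm (ltW c0) m0 mle a t.
have u0 := sine_multiplier_eq0 t ut mm (ltW c0) m0 mle meven.
have v0 := sine_multiplier_eq0 t vt mm (ltW c0) m0 mle meven.
have vpi xi : ctrans v (pi / 2 + pi / 2) origin xi = - ctrans v 0 origin xi.
  by rewrite -splitr -(add0r pi); exact: ctrans_addpi vt.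
have upi xi : ctrans u (pi / 2 + pi / 2) origin xi = - ctrans u 0 origin xi.
  by rewrite -splitr -(add0r pi); exact: ctrans_addpi ut.
have symbE xi : c * euclid_norm (row_of_tuple xi) `^ s = m xi.
  by rewrite euclid_norm_powR.
rewrite /fraclap /inv_fourier /Cintegral; congr (_ +i* _).
- rewrite -[RHS]addr0 -v0 /multiplier -RintegralD//.
  apply: eq_Rintegral => xi _; rewrite Re_mul Re_mul Im_mul symbE /cis.
  rewrite Re_fourier Im_fourier dotrv_row_of_tuple [complex.Re _%:C]/= [complex.Im _%:C]/=.
  rewrite [complex.Re _]/= [complex.Im _]/=.
  rewrite (ctrans_rotate 0 t xi ut) (ctrans_rotate (pi / 2) t xi vt) vpi add0r.
  ring.
- rewrite -[RHS]subr0 -u0 /multiplier -RintegralB//.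
  apply: eq_Rintegral => xi _; rewrite Im_mul Re_mul Im_mul symbE /cis.
  rewrite Re_fourier Im_fourier dotrv_row_of_tuple [complex.Re _%:C]/= [complex.Im _%:C]/=.
  rewrite [complex.Re _]/= [complex.Im _]/=.
  rewrite (ctrans_rotate 0 t xi vt) (ctrans_rotate (pi / 2) t xi ut) upi add0r.
  ring.
Qed.

Lemma normc_fraclap s t : 0 < s -> s < 1 ->
  Normc.normc (fraclap s phi (row_of_tuple t)) =
  Num.sqrt (multiplier u (symbol s ((2 * pi) `^ s)) t ^+ 2 +
            multiplier v (symbol s ((2 * pi) `^ s)) t ^+ 2).
Proof. by move=> s0 s1; rewrite fraclap_multiplier. Qed.

Lemma measurable_normc_fraclap s : 0 < s -> s < 1 ->
  measurable_fun setT (fun t : X => Normc.normc (fraclap s phi (row_of_tuple t))).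
Proof.
move=> s0 s1; under eq_fun do rewrite normc_fraclap//.
have msqrt : measurable_fun setT (@Num.sqrt R).
  exact: (continuous_measurable_fun (@sqrt_continuous R)).
apply: (measurableT_comp msqrt); apply: measurable_funD.
  exact: (measurable_funX 2 (measurable_multiplier ut (measurable_symbol s _))).
exact: (measurable_funX 2 (measurable_multiplier vt (measurable_symbol s _))).
Qed.

End representation.

Let sqrt_addsqr_le (a b : R) : Num.sqrt (a ^+ 2 + b ^+ 2) <= `|a| + `|b|.
Proof.
have ab0 : 0 <= `|a| + `|b| by rewrite addr_ge0.
rewrite -(ger0_norm ab0) -sqrtr_sqr ler_wsqrtr// sqrrD.
rewrite !real_normK ?num_real//.
by rewrite addrAC lerDl mulrn_wge0// mulr_ge0.
Qed.

(** Both components are multipliers of tame functions, and the modulus is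
    comparable with the sum of their absolute values. *)
Lemma fraclap_L1_le s rho p : 0 < s -> s < 1 -> 1 <= p ->
  exists2 C, 0 <= C & forall (phi : 'rV[R]_n.+1 -> R[i]) M,
    tame rho (on_tuples (fun w => complex.Re (phi w))) ->
    tame rho (on_tuples (fun w => complex.Im (phi w))) -> 0 < M ->
    let f t := Normc.normc (fraclap s phi (row_of_tuple t)) in
    (\int[lam]_t (f t `^ p)%:E <= (M `^ p)%:E)%E ->
    (\int[lam]_t (f t)%:E <= (C * M)%:E)%E.
Proof.
move=> s0 s1 p1; set c := (2 * pi) `^ s.
have c0 : 0 < c by rewrite powR_gt0// mulr_gt0// pi_gt0.
have [C C0 hC] := multiplier_L1_le (n := n) rho s0 s1 c0 p1.
exists (C + C); first exact: addr_ge0.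
move=> phi M ut vt M0 f hf.
pose Tu := multiplier (on_tuples (fun w => complex.Re (phi w))) (symbol s c).
pose Tv := multiplier (on_tuples (fun w => complex.Im (phi w))) (symbol s c).
have fE t : f t = Num.sqrt (Tu t ^+ 2 + Tv t ^+ 2).
  by rewrite /f (normc_fraclap ut vt _ s0 s1).
have mu : measurable_fun setT Tu by exact: (measurable_multiplier ut (measurable_symbol s c)).
have mv : measurable_fun setT Tv by exact: (measurable_multiplier vt (measurable_symbol s c)).
have mf : measurable_fun setT f by exact: (measurable_normc_fraclap ut vt s0 s1).
have le_u t : `|Tu t| <= f t.
  by rewrite fE -sqrtr_sqr ler_wsqrtr// lerDl sqr_ge0.
have le_v t : `|Tv t| <= f t.
  by rewrite fE -sqrtr_sqr ler_wsqrtr// lerDr sqr_ge0.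
have le_f t : f t <= `|Tu t| + `|Tv t|.
  by rewrite fE; exact: sqrt_addsqr_le.
have f0 t : 0 <= f t by rewrite (le_trans _ (le_u t)).
have p0 : 0 <= p by rewrite (le_trans _ p1).
have mpow (g : X -> R) : measurable_fun setT g -> measurable_fun setT (fun t : X => g t `^ p).
  exact: (measurableT_comp (measurable_powR p)).
have mnorm (g : X -> R) : measurable_fun setT g -> measurable_fun setT (fun t : X => `|g t| : R).
  exact: (measurableT_comp (@normr_measurable R setT)).
have pow_le (g : X -> R) : measurable_fun setT g -> (forall t, `|g t| <= f t) ->
    (\int[lam]_t (`|g t| `^ p)%:E <= (M `^ p)%:E)%E.
  move=> mg gf; apply: le_trans hf; apply: ge0_le_integral_EFin.
  - exact: mpow (mnorm _ mg).
  - exact: mpow.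
  - by move=> t; exact: powR_ge0.
  - by move=> t; rewrite ge0_ler_powR// nnegrE.
apply: (@le_trans _ _ (\int[lam]_t (`|Tu t| + `|Tv t|)%:E)%E).
  by apply: ge0_le_integral_EFin => //; apply: measurable_funD; exact: mnorm.
rewrite ge0_integral_EFinD//; [|exact: mnorm|exact: mnorm].
rewrite mulrDl EFinD; apply: leeD.
  exact: (hC _ _ ut M0 (pow_le _ mu le_u)).
exact: (hC _ _ vt M0 (pow_le _ mv le_v)).
Qed.

End fractional_laplacian.

Lemma compact_closure_bounded_coord (R : realType) n (Omega : set 'rV[R]_n) :
  compact (closure Omega) -> exists2 rho : R, 0 <= rho &
  forall x, Omega x -> forall i, `|x 0 i| <= rho.
Proof.
move=> /compact_bounded[M [_ hM]]; exists (`|M| + 1); first by rewrite addr_ge0.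
move=> x Ox i.
have := hM (`|M| + 1); rewrite (le_lt_trans (ler_norm M)) ?ltrDl// => /(_ isT x).
move=> /(_ (@subset_closure _ Omega x Ox)); apply: le_trans.
rewrite [leRHS]mx_normrE.
exact: (le_bigmax _ (fun ij : 'I_1 * 'I_n => `|x ij.1 ij.2|) (0, i)).
Qed.

(** In dimension zero the only frequency has norm [0], and [0 ^ s = 0]. *)
Lemma fraclap_dim0 (R : realType) (s : R) (phi : 'rV[R]_0 -> R[i]) x :
  s != 0 -> fraclap s phi x = 0.
Proof.
move=> s0; rewrite /fraclap /inv_fourier.
have e0 (xi : 'rV[R]_0) : euclid_norm xi `^ s = 0.
  by rewrite /euclid_norm /dotrv big_ord0 sqrtr0 powR0.
under eq_fun do rewrite e0 mulr0 !mul0r.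
by rewrite /Cintegral/= Rintegral_cst// mul0r.
Qed.

Unset Implicit Arguments.

Theorem lemma3p5 (R : realType) (N : nat) (p q s : R) (Omega : set 'rV[R]_N)
    (q_gt1 : 1 < q) (q_lt_p : q < p)
    (openO : open Omega) (bndO : compact (closure Omega))
    (s_gt0 : 0 < s) (s_lt1 : s < 1) :
  exists C : R, 0 < C /\
    forall phi : 'rV[R]_N -> R[i], Cc_infty Omega phi ->
      (Lpnorm q (fraclap s phi) <= C%:E * Lpnorm p (fraclap s phi))%E.
Proof.
have q_gt0 : 0 < q by rewrite (lt_trans _ q_gt1).
have p_gt0 : 0 < p by rewrite (lt_trans q_gt0).
case: N Omega openO bndO => [|n] Omega _ bndO.
  have norm0 r phi : 0 < r -> Lpnorm r (fraclap s phi : 'rV[R]_0 -> R[i]) = 0%E.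
    move=> r0; rewrite /Lpnorm (eq_Lnorm _ _ (g := cst 0%E)).
      by rewrite Lnorm0// eqe gt_eqF.
    by move=> t; rewrite fraclap_dim0 ?gt_eqF// Normc.normc0.
  by exists 1; split=> // phi _; rewrite !norm0// mule0.
have [rho rho0 Orho] := compact_closure_bounded_coord bndO.
have p_ge1 : 1 <= p by rewrite ltW// (lt_trans q_gt1).
have [K K0 hK] := fraclap_L1_le (n := n) rho s_gt0 s_lt1 p_ge1.
exists ((K + 1) `^ q^-1); split; first by rewrite powR_gt0// ltr_wpDl.
move=> phi [smR smI _ sub].
have box (h : R[i] -> R) : h 0 = 0 -> supported_in rho (fun w => h (phi w)).
  move=> h0 x hx; apply: Orho; apply: sub; apply: subset_closure => /=.
  by apply: contraNneq hx => ->; rewrite h0.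
have ut := smooth_tame smR (box (@complex.Re R) erefl).
have vt := smooth_tame smI (box (@complex.Im R) erefl).
apply: Lnorm_interpolation => //.
- exact: (measurable_normc_fraclap ut vt s_gt0 s_lt1).
- by move=> t; rewrite (normc_fraclap ut vt) ?sqrtr_ge0.
- by move=> M M0; exact: hK.
Qed.
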